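(* Let $x:\mathbf M^2\to\mathbb Q^3_1$ be a space-like conformal surface, i.e. a regular space-like surface whose conformal form $\Phi$ vanishes identically. Then $x$ is locally conformally equivalent to one of the following three standard embedded surfaces: (i) $\mathbb H^1(r)\times\mathbb H^1(\sqrt{1-r^2})\subset\mathbb H^3_1$; (ii) $\mathbb H^1(r)\times\mathbb S^1(\sqrt{r^2+1})\subset\mathbb S^3_1$; (iii) $\mathbb H^1\times\mathbb R^1\subset\mathbb R^3_1$, where all radii are positive (so $0<r<1$ in (i) and $r>0$ in (ii)).
   Context: **Ambient spaces.** $\mathbb R^N_s$ is $\mathbb R^N$ with inner product $\langle\xi,\eta\rangle=-\sum_{i=1}^s x_iy_i+\sum_{i=s+1}^N x_iy_i$. The light cone is $C^{4}=\{\xi\in\mathbb R^{5}_{2}:\langle\xi,\xi\rangle=0,\ \xi\ne0\}$ and the conformal space is $\mathbb Q^3_1=C^{4}/(\mathbb R\setminus\{0\})\subset\mathbb RP^{4}$, with its natural conformal class of Lorentzian metrics (for a local section $\sigma$ of $C^4\to\mathbb Q^3_1$, the metric $\langle d\sigma,d\sigma\rangle$ belongs to this class). Every conformal transformation of $\mathbb Q^3_1$ has the form $[X]\mapsto[XT]$ with $T$ in the orthogonal group of $\mathbb R^5_2$. For $r>0$ put $\mathbb S^n_s(r)=\{u\in\mathbb R^{n+1}_s:\langle u,u\rangle=r^2\}$ and $\mathbb H^n_s(r)=\{u\in\mathbb R^{n+1}_{s+1}:\langle u,u\rangle=-r^2\}$; the radius is omitted when $r=1$ and the index is omitted when $s=0$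 (e.g. $\mathbb H^1(r)\subset\mathbb R^2_1$, $\mathbb S^1(r)\subset\mathbb R^2$). The standard conformal embeddings into $\mathbb Q^3_1$ are $u\mapsto[(1,u)]$ on $\mathbb S^3_1$, $u\mapsto[(u,1)]$ on $\mathbb H^3_1$, and $u\mapsto[(\tfrac{\langle u,u\rangle+1}{2},u,\tfrac{\langle u,u\rangle-1}{2})]$ on $\mathbb R^3_1$; the three spaces are regarded as subsets of $\mathbb Q^3_1$ in this way. The products in the claim are the standard ones, obtained from the orthogonal splittings (after reordering coordinates) $\mathbb R^4_2=\mathbb R^2_1\oplus\mathbb R^2_1$, $\mathbb R^4_1=\mathbb R^2_1\oplus\mathbb R^2$ and $\mathbb R^3_1=\mathbb R^2_1\oplus\mathbb R^1$ respectively. **Regular surfaces.** Let $x:\mathbf M^2\to\mathbb Q^{3}_1$ be an immersed surface whose induced (conformal class of) metric is space-like, i.e. positive definite. For a local lift $y:U\to C^{4}$ of $x$ let $\Delta$ and $\rho$ be the Laplacian and scalar curvature (twice the Gauss curvature) of $\langle dy,dy\rangle$. The 2-form $g=\pm\big(\langle\Delta y,\Delta y\rangle-2\rho\big)\langle dy,dy\rangle$ does not depend on the choice of $y$; $x$ is regular if $g$ is non-degenerate, where the sign $\pm$ is taken so that the factor in front of $\langle dy,dy\rangle$ is positive. For regular $x$ there is a lift $Y$ (canonical lift, unique up to sign) with $g=\langle dY,dY\rangle$. **Conformal form.** Let $\{e_1,e_2\}$ be a local frame of $T\mathbf M$ with dual coframe $\{\omega^1,\omega^2\}$, $Y_i=e_i(Y)$,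 $\Delta$ the Laplacian of $g$, and $N=-\frac12\Delta Y-\frac18\langle\Delta Y,\Delta Y\rangle Y$. Let $\xi$ be a local unit vector field ($\varepsilon=\langle\xi,\xi\rangle=\pm1$) orthogonal to $Y,N,Y_1,Y_2$. The conformal form is $\Phi=\sum_i C_i\omega^i\,\xi$ with $C_i=\varepsilon\langle e_i(N),\xi\rangle$. A regular surface is called conformal if $\Phi\equiv0$. **Conformal equivalence.** Two surfaces $x,\tilde x$ in $\mathbb Q^3_1$ are conformally equivalent if there is a conformal transformation $\sigma$ of $\mathbb Q^3_1$ with $\tilde x=\sigma\circ x$ (up to a diffeomorphism of the parameter manifolds); locally conformally equivalent means that each point has a neighborhood on which $x$ is conformally equivalent to an open piece of the model surface. *)

(* Defs.v *)
From HB Require Import structures.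
From mathcomp Require Import all_boot all_order all_algebra.
From mathcomp Require Import all_classical all_reals all_analysis.

Set Implicit Arguments.
Unset Strict Implicit.
Unset Printing Implicit Defensive.

Import Order.TTheory GRing.Theory Num.Theory.
Import numFieldNormedType.Exports.

Local Open Scope classical_set_scope.
Local Open Scope ring_scope.

Section SmoothMaps.
Variables (R : realType).

(* Only the values of f on the open set V matter. *)
Fixpoint Ck {U W : normedModType R} (k : nat) (V : set U) (f : U -> W) : Prop :=
  match k with
  | 0%N => forall u, V u -> {for u, continuous f}
  | k'.+1 => (forall u, V u -> differentiable f u) /\
             (forall v : U, Ck k' V (fun u => 'D_v f u))
  end.

Definition smooth_on {U W : normedModType R} (V : set U) (f : U -> W) : Prop :=
  forall k, Ck k V f.

(* Smooth maps and diffeomorphisms between arbitrary subsets of normed spaces: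
   f is smooth on A if near each point of A it has a smooth extension to an
   open set. On embedded submanifolds this is the usual notion. *)
Definition smooth_map {U W : normedModType R} (A : set U) (f : U -> W) : Prop :=
  forall a, A a -> exists (O : set U) (F : U -> W),
    [/\ open O, O a, smooth_on O F & forall u, A u -> O u -> F u = f u].

Definition diffeomorphism {U W : normedModType R} (A : set U) (B : set W)
    (f : U -> W) : Prop :=
  exists g : W -> U,
    [/\ (forall a, A a -> B (f a)) /\ (forall b, B b -> A (g b)),
        (forall a, A a -> g (f a) = a) /\ (forall b, B b -> f (g b) = b),
        smooth_map A f & smooth_map B g].

End SmoothMaps.

Section Surfaces.
Variables (R : realType) (M : topologicalType).

(* The values of chart_map off chart_dom, and of chart_inv off
   chart_map @` chart_dom, are irrelevant. *)
Record chart := Chart {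
  chart_dom : set M;
  chart_map : M -> 'rV[R]_2;
  chart_inv : 'rV[R]_2 -> M }.

Definition chart_img (c : chart) : set 'rV[R]_2 := chart_map c @` chart_dom c.

Definition is_chart (c : chart) : Prop :=
  [/\ open (chart_dom c) /\ open (chart_img c),
      forall p, chart_dom c p -> chart_inv c (chart_map c p) = p,
      forall p, chart_dom c p -> {for p, continuous (chart_map c)} &
      forall u, chart_img c u -> {for u, continuous (chart_inv c)}].

Definition compatible (c d : chart) : Prop :=
  smooth_on (chart_map c @` (chart_dom c `&` chart_dom d))
            (chart_map d \o chart_inv c).

Definition smooth_surface (A : set chart) : Prop :=
  [/\ hausdorff_space M, @second_countable M,
      forall c, A c -> is_chart c,
      forall p, exists2 c, A c & chart_dom c p &
      forall c d, A c -> A d -> compatible c d].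

End Surfaces.

Section ConformalSpace.
Variables (R : realType).

Definition scal {n : nat} (s : nat) (u v : 'rV[R]_n) : R :=
  \sum_(i < n) (if (i < s)%N then -1 else 1) * u 0 i * v 0 i.

Definition pseudo_sphere (n s : nat) (r : R) : set 'rV[R]_(n.+1) :=
  [set u | scal s u u = r ^+ 2].

Definition pseudo_hyperbolic (n s : nat) (r : R) : set 'rV[R]_(n.+1) :=
  [set u | scal s.+1 u u = - r ^+ 2].

Definition light_cone : set 'rV[R]_5 := [set X | scal 2 X X = 0 /\ X != 0].

(* The point [X] of the projective space, as the set of its representatives. *)
Definition line (X : 'rV[R]_5) : set 'rV[R]_5 :=
  [set Z | exists2 a : R, a != 0 & Z = a *: X].

(* Points are the projective classes of light-like vectors. *)
Definition conformal_space : set (set 'rV[R]_5) := line @` light_cone.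

Definition orthogonal_mx (T : 'M[R]_5) : Prop :=
  forall X Y : 'rV[R]_5, scal 2 (X *m T) (Y *m T) = scal 2 X Y.

Definition conformal_transformation (f : set 'rV[R]_5 -> set 'rV[R]_5) : Prop :=
  exists2 T : 'M[R]_5, orthogonal_mx T &
    forall X, light_cone X -> f (line X) = line (X *m T).

Definition embS (u : 'rV[R]_4) : 'rV[R]_5 := row_mx (1%:M : 'M[R]_1) u.

Definition embH (u : 'rV[R]_4) : 'rV[R]_5 := row_mx u (1%:M : 'M[R]_1).

Definition embR (u : 'rV[R]_3) : 'rV[R]_5 :=
  row_mx (((scal 1 u u + 1) / 2)%:M : 'M[R]_1)
         (row_mx u (((scal 1 u u - 1) / 2)%:M : 'M[R]_1)).

Definition coords2 {n : nat} (u : 'rV[R]_n) (i j : 'I_n) : 'rV[R]_2 :=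
  \row_(k < 2) u 0 (if k == 0 then i else j).

(* In 'rV_4 with signature (-,-,+,+), coordinates 0, 2 and 1, 3 span the two
   Lorentz planes. *)
Definition HxH (r s : R) : set 'rV[R]_4 :=
  [set u | pseudo_hyperbolic 0 r
             (coords2 u (Ordinal (isT : (0 < 4)%N)) (Ordinal (isT : (2 < 4)%N)))
        /\ pseudo_hyperbolic 0 s
             (coords2 u (Ordinal (isT : (1 < 4)%N)) (Ordinal (isT : (3 < 4)%N)))].

Definition HxS (r s : R) : set 'rV[R]_4 :=
  [set u | pseudo_hyperbolic 0 r
             (coords2 u (Ordinal (isT : (0 < 4)%N)) (Ordinal (isT : (1 < 4)%N)))
        /\ pseudo_sphere 0 s
             (coords2 u (Ordinal (isT : (2 < 4)%N)) (Ordinal (isT : (3 < 4)%N)))].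

Definition HxR : set 'rV[R]_3 :=
  [set u | pseudo_hyperbolic 0 1
             (coords2 u (Ordinal (isT : (0 < 3)%N)) (Ordinal (isT : (1 < 3)%N)))].

End ConformalSpace.

Arguments light_cone {R}.
Arguments conformal_space {R}.
Arguments HxR {R}.

Section RiemannianMetrics.
Variables (R : realType).

Definition pd {W : normedModType R} (i : 'I_2) (f : 'rV[R]_2 -> W)
    (u : 'rV[R]_2) : W := 'D_(delta_mx 0 i) f u.

Variable (G : 'rV[R]_2 -> 'M[R]_2).

Definition christoffel (k i j : 'I_2) (u : 'rV[R]_2) : R :=
  2^-1 * \sum_(l < 2) invmx (G u) k l *
    (pd i (fun v => G v j l : R) u + pd j (fun v => G v i l : R) u
     - pd l (fun v => G v i j : R) u).

Definition laplacian {W : normedModType R} (f : 'rV[R]_2 -> W)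
    (u : 'rV[R]_2) : W :=
  \sum_(i < 2) \sum_(j < 2) invmx (G u) i j *:
    (pd i (pd j f) u - \sum_(k < 2) christoffel k i j u *: pd k f u).

Definition ricci (j k : 'I_2) (u : 'rV[R]_2) : R :=
  \sum_(l < 2) (pd l (christoffel l j k) u - pd j (christoffel l l k) u
    + \sum_(m < 2) (christoffel l l m u * christoffel m j k u
                    - christoffel l j m u * christoffel m l k u)).

Definition scalar_curvature (u : 'rV[R]_2) : R :=
  \sum_(j < 2) \sum_(k < 2) invmx (G u) j k * ricci j k u.

End RiemannianMetrics.

Section ConformalSurfaces.
Variables (R : realType).

(* y and Y are lifts written in local coordinates. *)

Definition first_form (y : 'rV[R]_2 -> 'rV[R]_5) (u : 'rV[R]_2) : 'M[R]_2 :=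
  \matrix_(i < 2, j < 2) scal 2 (pd i y u) (pd j y u).

Definition pos_def (G : 'M[R]_2) : Prop :=
  forall v : 'rV[R]_2, v != 0 -> 0 < (v *m G *m v^T) 0 0.

(* The induced map u |-> [y u] has injective differential at u. *)
Definition immersive_at (y : 'rV[R]_2 -> 'rV[R]_5) (u : 'rV[R]_2) : Prop :=
  row_free (col_mx (y u) (col_mx (pd 0 y u) (pd 1 y u))).

Definition conformal_factor (y : 'rV[R]_2 -> 'rV[R]_5) (u : 'rV[R]_2) : R :=
  let Dy := laplacian (first_form y) y u in
  scal 2 Dy Dy - 2 * scalar_curvature (first_form y) u.

(* The absolute value is the choice of the sign making the factor positive. *)
Definition conformal_metric (y : 'rV[R]_2 -> 'rV[R]_5) (u : 'rV[R]_2)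
    : 'M[R]_2 :=
  `|conformal_factor y u| *: first_form y u.

Definition Nvec (Y : 'rV[R]_2 -> 'rV[R]_5) (u : 'rV[R]_2) : 'rV[R]_5 :=
  let DY := laplacian (first_form Y) Y u in
  - (2^-1 *: DY) - (8^-1 * scal 2 DY DY) *: Y u.

Definition unit_normal (W : set 'rV[R]_2) (Y xi : 'rV[R]_2 -> 'rV[R]_5)
    : Prop :=
  smooth_on W xi /\
  forall u, W u ->
    [/\ scal 2 (xi u) (xi u) = 1 \/ scal 2 (xi u) (xi u) = -1,
        scal 2 (xi u) (Y u) = 0,
        scal 2 (xi u) (Nvec Y u) = 0 &
        forall i : 'I_2, scal 2 (xi u) (pd i Y u) = 0].

(* The 1-form is evaluated on the tangent vector v; it does not depend on the
   frame, taken here to be the coordinate frame, so that omega^i (v) = v 0 i. *)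
Definition conformal_coef (Y xi : 'rV[R]_2 -> 'rV[R]_5) (i : 'I_2)
    (u : 'rV[R]_2) : R :=
  scal 2 (xi u) (xi u) * scal 2 (pd i (Nvec Y) u) (xi u).

Definition conformal_form (Y xi : 'rV[R]_2 -> 'rV[R]_5) (u v : 'rV[R]_2)
    : 'rV[R]_5 :=
  (\sum_(i < 2) conformal_coef Y xi i u * v 0 i) *: xi u.

Variables (M : topologicalType) (A : set (chart R M)) (x : M -> set 'rV[R]_5).

(* y is a lift, on the open coordinate domain W of the chart c, of x. *)
Definition local_lift (c : chart R M) (W : set 'rV[R]_2)
    (y : 'rV[R]_2 -> 'rV[R]_5) : Prop :=
  [/\ A c, open W, W `<=` chart_img c, smooth_on W y &
      forall u, W u -> light_cone (y u) /\ x (chart_inv c u) = line (y u)].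

Definition smooth_into_conformal_space : Prop :=
  (forall p, conformal_space (x p)) /\
  forall p, exists c W y,
    [/\ local_lift c W y, chart_dom c p & W (chart_map c p)].

Definition immersed : Prop :=
  smooth_into_conformal_space /\
  forall c W y, local_lift c W y -> forall u, W u -> immersive_at y u.

Definition space_like : Prop :=
  forall c W y, local_lift c W y -> forall u, W u -> pos_def (first_form y u).

Definition regular : Prop :=
  forall c W y, local_lift c W y ->
  forall u, W u -> conformal_metric y u \in unitmx.

(* conformal_metric is the same for all lifts, so it may be computed from Y. *)
Definition canonical_lift (c : chart R M) (W : set 'rV[R]_2)
    (Y : 'rV[R]_2 -> 'rV[R]_5) : Prop :=
  local_lift c W Y /\ forall u, W u -> conformal_metric Y u = first_form Y u.

Definition vanishing_conformal_form : Prop :=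
  forall c W Y xi, canonical_lift c W Y -> unit_normal W Y xi ->
  forall u v, W u -> conformal_form Y xi u v = 0.

Definition space_like_conformal_surface : Prop :=
  [/\ immersed, space_like, regular & vanishing_conformal_form].

(* S is the model surface and iota : 'rV_n -> 'rV_5 induces the embedding
   u |-> [iota u]; S `&` O is the open piece of S, and phi, written in the
   chart c, identifies the neighborhood V of p with it. *)
Definition conformally_equivalent_near (n : nat) (S : set 'rV[R]_n)
    (iota : 'rV[R]_n -> 'rV[R]_5) (p : M) : Prop :=
  exists (c : chart R M) (V : set M) (O : set 'rV[R]_n)
         (phi : 'rV[R]_2 -> 'rV[R]_n) (f : set 'rV[R]_5 -> set 'rV[R]_5),
    [/\ [/\ A c, open V, V p & V `<=` chart_dom c],
        open O,
        diffeomorphism (chart_map c @` V) (S `&` O) phi,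
        conformal_transformation f &
        forall q, V q -> x q = f (line (iota (phi (chart_map c q))))].

End ConformalSurfaces.

(* Main.v *)
(** In a lift y with unit normal xi the conformal factor is
    4 det b / det g - (tr_g b)^2, where b is the second fundamental form along xi (Gauss
    equation); it scales by mu^-2 when y is multiplied by mu, which yields the canonical
    lift Y.  For xi orthogonal to N the condition Phi = 0 means that d xi = S dY, with
    tr S = 0 and det S = -1/4.  Hence P = xi + Y/2 and Q = xi - Y/2 have differentials of
    rank one, Y = P - Q, and <P,P> = <Q,Q> = <P,Q> = -1.  In suitable coordinates
    P = P(s) and Q = Q(t), and <P(s), Q(t)> = -1 forces P and -Q onto conics
    s^2 = 2 h + l h^2 and t^2 = 2 k + m k^2 in orthogonal planes, with l + m = 1; up to
    exchanging l and m, the sign of m selects one of the three models.  The pair {P, Q} is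
    determined by the surface up to sign, and l and m are read off the mutual distances of
    three points of these curves, so {l, m} is locally constant. *)

Require Import Defs.
From HB Require Import structures.
From mathcomp Require Import all_boot all_order all_algebra.
From mathcomp Require Import all_classical all_reals all_analysis.
From mathcomp Require Import ring lra.

Set Implicit Arguments.
Unset Strict Implicit.
Unset Printing Implicit Defensive.

Import Order.TTheory GRing.Theory Num.Theory.
Import numFieldNormedType.Exports.

Local Open Scope classical_set_scope.
Local Open Scope ring_scope.

(** * Differential calculus *)

(** The vectors [Y], [N] and [dY] span a subspace of signature (3,1) in the (3,2) ambient space, so
    the normal of a space-like surface is time-like; hence [xi] has square -1 throughout. Since [N]
    is a combination of the Laplacian of [Y] and [Y] itself, orthogonality of [xi] to [N] says that
    [b] is trace free. The canonical normalisation then reads |4 det b / det g| = 1, and a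
    trace-free form has nonpositive determinant; so [S] has eigenvalues 1/2 and -1/2. This is the
    origin of the constant 1/2 in [P] and [Q]: the differentials of [P] and [Q] are [dY] composed
    with the two singular operators S + 1/2 and S - 1/2. Rank one lets the variables separate, and
    the identity <P,Q> = -1 at single points becomes <P(s),Q(t)> = -1 for independent s and t; this
    replaces the integration of structure equations. The parameter of the model must be the same on
    a whole component, although charts, lifts and normals change from point to point. It is
    therefore read off a quantity insensitive to these choices, the circumradius of triples of
    points on the curves [P] and [Q]. *)

Section Calculus.
Variable R : realType.
Implicit Types U V W : normedModType R.

(** The little-o remainder is written with an epsilon so that a differential can be exhibited by
    norm estimates, as is done for the local inverse in [inverse_function]. *)
Lemma is_diff_approx V W (f : V -> W) (x : V) (L : {linear V -> W}) :
  continuous L ->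
  (forall e : R, 0 < e -> \forall h \near (0 : V),
     `|f (h + x) - (f x + L h)| <= e * `|h|) ->
  is_diff x f L.
Proof.
move=> cL H.
have E : f \o shift x = cst (f x) + L +o_ (0 : V) id.
  apply/eqaddoP => e e0; have := H e e0; apply: filterS => h /=.
  by [].
have dE := diff_unique cL E.
apply: DiffDef => //; apply/diff_locallyP; rewrite dE; split => //.
Qed.

Lemma diff_approx V W (f : V -> W) (x : V) : differentiable f x ->
  forall e : R, 0 < e -> \forall h \near (0 : V),
     `|f (h + x) - (f x + 'd f x h)| <= e * `|h|.
Proof.
move=> /diff_locally/eqaddoP H e e0; have := H e e0; apply: filterS => h /=.
by [].
Qed.

Lemma near_eq_is_diff V W (f g : V -> W) x :
  (\near x, f x = g x) -> differentiable f x -> is_diff x g ('d f x).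
Proof.
move=> fg df; apply: is_diff_approx; first exact: diff_continuous.
move=> e e0; have H := diff_approx df e0.
have fgx : f x = g x by exact: nbhs_singleton fg.
have fg0 : \forall h \near (0 : V), f (h + x) = g (h + x).
  move: fg; rewrite (near_shift 0)/= => fg.
  by apply: filterS fg => h; rewrite subr0.
near=> h; rewrite -fgx -(near fg0 h)//; near: h; exact: H.
Unshelve. all: by end_near. Qed.

Lemma near_eq_differentiable V W (f g : V -> W) x :
  (\near x, f x = g x) -> differentiable f x -> differentiable g x.
Proof. by move=> fg /(near_eq_is_diff fg) h; exact: ex_diff. Qed.

Lemma open_near_eq V W (A : set V) (f g : V -> W) x : open A -> A x ->
  (forall y, A y -> f y = g y) -> \near x, f x = g x.
Proof.
move=> oA Ax fg; have := open_nbhs_nbhs (conj oA Ax).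
by apply: filterS => y /fg.
Qed.

Lemma derive_comp U V W (f : U -> V) (g : V -> W) (x v : U) :
  differentiable f x -> differentiable g (f x) ->
  'D_v (g \o f) x = 'D_('D_v f x) g (f x).
Proof.
move=> df dg; rewrite !deriveE//; last exact: differentiable_comp.
by rewrite diff_comp.
Qed.

(** On an open set only the germs matter. The closure rules below go through this, because the
    product, quotient and chain rules hold only at the points of [A]. *)
Lemma Ck_ext U W k (A : set U) (f g : U -> W) : open A ->
  (forall u, A u -> f u = g u) -> Ck k A f -> Ck k A g.
Proof.
elim: k f g => [|k IH] f g oA fg /=.
  move=> cf u Au; have := cf u Au; rewrite /prop_for /continuous_at -fg//.
  by move=> H; apply: cvg_trans H; apply: near_eq_cvg; exact: open_near_eq fg.
move=> [df Df]; split => [u Au|v].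
  by apply: (near_eq_differentiable (open_near_eq oA Au fg)); exact: df.
apply: IH (Df v) => // u Au; apply: near_eq_derive; exact: open_near_eq fg.
Qed.

Lemma CkS U W k (A : set U) (f : U -> W) : Ck k.+1 A f -> Ck k A f.
Proof.
elim: k f => [|k IH] f; first by case=> df _ u /df; exact: differentiable_continuous.
case=> df Df; split => // v; apply: IH; exact: Df.
Qed.

Lemma Ck_subset U W k (A B : set U) (f : U -> W) : B `<=` A -> Ck k A f -> Ck k B f.
Proof.
elim: k f => [|k IH] f BA /=; first by move=> cf u /BA; exact: cf.
by move=> [df Df]; split => [u /BA|v]; [exact: df|exact: IH].
Qed.

Lemma smooth_ext U W (A : set U) (f g : U -> W) : open A ->
  (forall u, A u -> f u = g u) -> smooth_on A f -> smooth_on A g.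
Proof. by move=> oA fg sf k; exact: Ck_ext (sf k). Qed.

Lemma smooth_subset U W (A B : set U) (f : U -> W) : B `<=` A ->
  smooth_on A f -> smooth_on B f.
Proof. by move=> BA sf k; exact: Ck_subset (sf k). Qed.

Lemma smooth_diff U W (A : set U) (f : U -> W) u : smooth_on A f -> A u ->
  differentiable f u.
Proof. by move=> /(_ 1%N)[df _] /df. Qed.

Lemma smooth_derivable U W (A : set U) (f : U -> W) u v : smooth_on A f -> A u ->
  derivable f u v.
Proof. by move=> sf Au; apply: diff_derivable; exact: smooth_diff Au. Qed.

Lemma smooth_cont U W (A : set U) (f : U -> W) u : smooth_on A f -> A u ->
  {for u, continuous f}.
Proof. by move=> /(_ 0%N) /= H /H. Qed.

Lemma smooth_derive U W (A : set U) (f : U -> W) v : smooth_on A f ->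
  smooth_on A (fun u => 'D_v f u).
Proof. by move=> sf k; exact: (sf k.+1).2. Qed.

Lemma Ck_cst U W k (A : set U) (c : W) : Ck k A (fun _ : U => c).
Proof.
elim: k c => [|k IH] c /=; first by move=> u _; exact: cvg_cst.
split => [u _|v]; first exact: differentiable_cst.
have -> : (fun u : U => 'D_v (fun=> c) u) = (fun=> 0) by apply/funext => u; exact: derive_cst.
exact: IH.
Qed.

Lemma Ck_linear U W k (A : set U) (L : {linear U -> W}) : continuous L ->
  Ck k A L.
Proof.
case: k => [|k] cL /=; first by move=> u _; exact: cL.
split => [u _|v]; first exact: linear_differentiable.
suff -> : (fun u : U => 'D_v L u) = (fun=> L v) by exact: Ck_cst.
by apply/funext => u; rewrite deriveE ?diff_lin//; exact: linear_differentiable.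
Qed.

Lemma CkD U W k (A : set U) (f g : U -> W) : open A ->
  Ck k A f -> Ck k A g -> Ck k A (fun u => f u + g u).
Proof.
move=> oA; elim: k f g => [|k IH] f g /=.
  by move=> cf cg u Au; apply: cvgD; [exact: cf|exact: cg].
move=> [df Df] [dg Dg]; split => [u Au|v].
  by apply: differentiableD; [exact: df|exact: dg].
apply: (Ck_ext oA _ (IH _ _ (Df v) (Dg v))) => u Au.
by rewrite deriveD//; apply: diff_derivable; [exact: df|exact: dg].
Qed.


Lemma CkM U k (A : set U) (f g : U -> R) : open A ->
  Ck k A f -> Ck k A g -> Ck k A (fun u => f u * g u).
Proof.
move=> oA; elim: k f g => [|k IH] f g.
  by move=> cf cg u Au; apply: cvgM; [exact: cf|exact: cg].
(* The product rule leaves one factor undifferentiated, so the induction also needs [f] and [g] at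
   the lower order. *)
move=> Hf Hg; have Cf := CkS Hf; have Cg := CkS Hg.
case: Hf => df Df; case: Hg => dg Dg; split => [u Au|v].
  by apply: differentiableM; [exact: df|exact: dg].
apply: (@Ck_ext _ _ _ _ (fun u => f u * 'D_v g u + g u * 'D_v f u)) => //; last first.
  by apply: CkD => //; [exact: IH (Dg v)|exact: IH (Df v)].
move=> u Au; rewrite deriveM//; apply: diff_derivable; [exact: df|exact: dg].
Qed.

Lemma CkN U W k (A : set U) (f : U -> W) : open A ->
  Ck k A f -> Ck k A (fun u => - f u).
Proof.
move=> oA; elim: k f => [|k IH] f.
  by move=> cf u Au; apply: cvgN; exact: cf.
case=> df Df; split => [u Au|v]; first by apply: differentiableN; exact: df.
apply: (Ck_ext oA _ (IH _ (Df v))) => u Au.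
by rewrite deriveN//; apply: diff_derivable; exact: df.
Qed.

Lemma CkZl U W k (A : set U) (f : U -> R) (c : W) : open A ->
  Ck k A f -> Ck k A (fun u => f u *: c).
Proof.
move=> oA; elim: k f => [|k IH] f.
  by move=> cf u Au; apply: cvgZr_tmp; exact: cf.
case=> df Df; split => [u Au|v]; first by apply: differentiableZl; exact: df.
apply: (Ck_ext oA _ (IH _ (Df v))) => u Au.
have dfu := df _ Au.
by rewrite !deriveE ?diffZl//; exact: differentiableZl.
Qed.

Lemma Ck_sum U W k (A : set U) (I : Type) (r : seq I) (P : pred I)
    (f : I -> U -> W) : open A ->
  (forall i, Ck k A (f i)) -> Ck k A (fun u => \sum_(i <- r | P i) f i u).
Proof.
move=> oA Hf; elim: r => [|i r IH].
  by apply: (Ck_ext oA _ (Ck_cst k A 0)) => u _; rewrite big_nil.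
case Pi: (P i); last by apply: (Ck_ext oA _ IH) => u _; rewrite big_cons Pi.
by apply: (Ck_ext oA _ (CkD oA (Hf i) IH)) => u _; rewrite big_cons Pi.
Qed.

Lemma coord_linear n (j : 'I_n) : linear (fun w : 'rV[R]_n => w 0 j).
Proof. by move=> a x y; rewrite !mxE. Qed.

Definition coord_map n (j : 'I_n) : {linear 'rV[R]_n -> R} :=
  HB.pack (fun w : 'rV[R]_n => w 0 j)
    (GRing.isLinear.Build _ _ _ _ _ (@coord_linear n j)).

Lemma derive_coord U n (f : U -> 'rV[R]_n) (j : 'I_n) u v : derivable f u v ->
  'D_v (fun u => f u 0 j) u = ('D_v f u) 0 j.
Proof. by move=> /derive_mx ->; rewrite mxE. Qed.

Lemma Ck_rVP U n k (A : set U) (f : U -> 'rV[R]_n) : open A ->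
  Ck k A f <-> forall j, Ck k A (fun u => f u 0 j).
Proof.
move=> oA; split; last first.
  move=> Hf; apply: (@Ck_ext _ _ _ _ (fun u => \sum_j f u 0 j *: delta_mx 0 j)) => //.
    by move=> u _; rewrite -row_sum_delta.
  by apply: Ck_sum => // j; exact: CkZl.
move=> Hf j; elim: k f Hf => [|k IH] f.
  move=> cf u Au; apply: (@continuous_comp _ _ _ f (coord_map j)); first exact: cf.
  exact: coord_continuous.
case=> df Df; split => [u Au|v].
  by apply: (@differentiable_comp _ _ _ _ f (coord_map j)); [exact: df|exact: differentiable_coord].
apply: (Ck_ext oA _ (IH _ (Df v))) => u Au.
by rewrite derive_coord//; apply: diff_derivable; exact: df.
Qed.

Lemma derive_basis W n (f : 'rV[R]_n -> W) u v : differentiable f u ->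
  'D_v f u = \sum_j v 0 j *: 'D_(delta_mx 0 j) f u.
Proof.
move=> df; rewrite deriveE// {1}(row_sum_delta v) linear_sum/=.
by apply: eq_bigr => j _; rewrite linearZ/= deriveE.
Qed.

(** [Ck] tests derivatives along fixed directions, whereas the chain rule differentiates [g] along
    the moving direction ['D_v f u]. Expanding that direction in the standard basis of the middle
    space restores fixed directions. *)
Lemma Ck_comp U m n k (A : set U) (B : set 'rV[R]_m) (f : U -> 'rV[R]_m)
    (g : 'rV[R]_m -> 'rV[R]_n) : open A -> open B -> (forall u, A u -> B (f u)) ->
  Ck k A f -> Ck k B g -> Ck k A (g \o f).
Proof.
move=> oA oB fAB; elim: k g => [|k IH] g.
  move=> cf cg u Au; apply: continuous_comp; first exact: cf.
  by apply: cg; exact: fAB.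
move=> Hf; have Cf := CkS Hf; case: Hf => df Df [dg Dg]; split => [u Au|v].
  by apply: differentiable_comp; [exact: df|apply: dg; exact: fAB].
apply: (@Ck_ext _ _ _ _ (fun u => \sum_j ('D_v f u) 0 j *: 'D_(delta_mx 0 j) g (f u))) => //.
  move=> u Au; have dfu := df _ Au; have dgu := dg _ (fAB _ Au).
  by rewrite (derive_comp _ dfu dgu) -derive_basis.
apply: Ck_sum => // j; apply/(Ck_rVP _ _ oA) => i.
apply: (@Ck_ext _ _ _ _ (fun u => ('D_v f u) 0 j * ('D_(delta_mx 0 j) g (f u)) 0 i)) => //.
  by move=> u _; rewrite mxE.
apply: CkM => //; first exact: ((Ck_rVP _ _ oA).1 (Df v) j).
exact: ((Ck_rVP _ _ oA).1 (IH _ Cf (Dg _)) i).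
Qed.

Lemma CkV U k (A : set U) (f : U -> R) : open A -> (forall u, A u -> f u != 0) ->
  Ck k A f -> Ck k A (fun u => (f u)^-1).
Proof.
move=> oA f0; elim: k => [|k IH].
  by move=> cf u Au; apply: cvgV; [exact: f0|exact: cf].
move=> Hf; have Cf := IH (CkS Hf); case: Hf => df Df; split => [u Au|v].
  by apply: differentiableV; [exact: df|exact: f0].
apply: (@Ck_ext _ _ _ _ (fun u => - ((f u)^-1 * (f u)^-1 * 'D_v f u))) => //.
  move=> u Au; have fu0 := f0 _ Au; have dfu : derivable f u v by apply: diff_derivable; exact: df.
  by rewrite deriveV//= scaleNr expr2 invfM.
apply: CkN => //; apply: CkM => //; first exact: CkM.
exact: Df.
Qed.

End Calculus.

Section Calculus2.
Variable R : realType.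
Implicit Types U V W : normedModType R.

Lemma Ck_prod U k (A : set U) (I : Type) (r : seq I) (P : pred I)
    (f : I -> U -> R) : open A ->
  (forall i, Ck k A (f i)) -> Ck k A (fun u => \prod_(i <- r | P i) f i u).
Proof.
move=> oA Hf; elim: r => [|i r IH].
  by apply: (Ck_ext oA _ (Ck_cst k A (1 : R))) => u _; rewrite big_nil.
case Pi: (P i); last by apply: (Ck_ext oA _ IH) => u _; rewrite big_cons Pi.
by apply: (Ck_ext oA _ (CkM oA (Hf i) IH)) => u _; rewrite big_cons Pi.
Qed.

Lemma Ck_det U k (A : set U) n (M : U -> 'M[R]_n) : open A ->
  (forall i j, Ck k A (fun u => M u i j)) -> Ck k A (fun u => \det (M u)).
Proof.
move=> oA HM; apply: Ck_sum => // s; apply: CkM => //; first exact: Ck_cst.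
by apply: Ck_prod => // i.
Qed.

Lemma Ck_invmx U k (A : set U) n (M : U -> 'M[R]_n) i j : open A ->
  (forall u, A u -> M u \in unitmx) ->
  (forall i j, Ck k A (fun u => M u i j)) -> Ck k A (fun u => invmx (M u) i j).
Proof.
move=> oA uM HM.
(* Cramer's rule: each entry of the inverse is a cofactor divided by the determinant. *)
apply: (@Ck_ext _ _ _ _ _ (fun u => (\det (M u))^-1 *
   ((-1) ^+ (j + i) * \det (row' j (col' i (M u)))))) => //.
  by move=> u Au; rewrite /invmx uM// !mxE.
apply: CkM => //.
  apply: CkV => //; last exact: Ck_det.
  by move=> u /uM; rewrite unitmxE unitfE.
apply: CkM => //; first exact: Ck_cst.
apply: Ck_det => // a b.
by apply: (Ck_ext oA _ (HM (lift j a) (lift i b))) => u _; rewrite !mxE.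
Qed.

Lemma Ck_sqrt U k (A : set U) (f : U -> R) : open A ->
  (forall u, A u -> 0 < f u) -> Ck k A f -> Ck k A (fun u => Num.sqrt (f u)).
Proof.
move=> oA f0; elim: k => [|k IH].
  move=> cf u Au; apply: (@continuous_comp _ _ _ f); first exact: cf.
  exact: sqrt_continuous.
move=> Hf; have Cf := IH (CkS Hf); case: Hf => df Df.
have ds u : A u -> differentiable (Num.sqrt : R -> R) (f u).
  by move=> /f0/is_derive1_sqrt[/derivable1_diffP].
split => [u Au|v].
  by apply: differentiable_comp; [exact: df|exact: ds].
apply: (@Ck_ext _ _ _ _ _ (fun u => (2 * Num.sqrt (f u))^-1 * 'D_v f u)) => //.
  move=> u Au; have dfu := df _ Au; have dsu := ds _ Au.
  rewrite -[RHS]/('D_v (Num.sqrt \o f) u) (derive_comp v dfu dsu).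
  have := is_derive1_sqrt (f0 _ Au) => -[_]; rewrite !(deriveE _ dsu) => <-.
  by rewrite -[X in _ = 'd _ _ X](mulr1 ('D_v f u)) linearZ/= mulrC.
apply: CkM => //; last exact: Df.
apply: CkV => //; last by apply: CkM => //; exact: Ck_cst.
by move=> u Au; rewrite mulf_neq0// gt_eqF// sqrtr_gt0 f0.
Qed.

Lemma derive_affine U (a v : U) (t : R) :
  is_diff t (fun s : R => s *: v + a) (fun s : R => s *: v).
Proof.
apply: is_diff_eq; apply/funext => s /=; exact: addr0.
Qed.

Lemma line_derive U W (f : U -> W) (a v : U) (t : R) :
  differentiable f (t *: v + a) ->
  is_derive t 1 (fun s : R => f (s *: v + a)) ('D_v f (t *: v + a)).
Proof.
move=> df; have [da Da] := derive_affine a v t.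
split; last first.
  rewrite -[LHS]/('D_1 (f \o (fun s => s *: v + a)) t) (derive_comp _ da df).
  by rewrite (deriveE _ da) Da scale1r.
apply/derivable1_diffP.
exact: (@differentiable_comp _ _ _ _ (fun s : R => s *: v + a) f).
Qed.

Lemma MVT_line U (f : U -> R) (a v : U) :
  (forall t : R, 0 <= t <= 1 -> differentiable f (t *: v + a)) ->
  exists2 c : R, 0 <= c <= 1 & f (v + a) - f a = 'D_v f (c *: v + a).
Proof.
move=> df.
have [||c] := @MVT_segment R (fun s : R => f (s *: v + a))
   (fun s => 'D_v f (s *: v + a)) 0 1 ler01.
- move=> x; rewrite in_itv/= => /andP[/ltW x0 /ltW x1].
  by apply: line_derive; apply: df; rewrite x0.
- apply: derivable_within_continuous => x; rewrite in_itv/= => x01.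
  by have [] := line_derive (df x x01).
rewrite in_itv/= => c01; rewrite scale1r scale0r add0r subr0 mulr1 => ?.
by exists c.
Qed.

(** The mean value theorem applied twice. The bound on [h] keeps the whole parallelogram spanned at
    [u] inside the ball. *)
Lemma second_difference U (f : U -> R) (u v w : U) (h r : R) :
  0 < h -> h * (`|v| + `|w|) < r -> Ck 2 (ball u r) f ->
  exists2 p, ball u r p &
    f (h *: v + h *: w + u) - f (h *: v + u) - f (h *: w + u) + f u
    = h * (h * 'D_w (fun x => 'D_v f x) p).
Proof.
move=> h0 hr [df Df].
have inB s t : 0 <= s <= 1 -> 0 <= t <= 1 ->
    ball u r (s *: (h *: v) + t *: (h *: w) + u).
  move=> /andP[s0 s1] /andP[t0 t1]; rewrite -ball_normE/= opprD addrA addrAC subrr add0r normrN.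
  apply: le_lt_trans hr; apply: le_trans (ler_normD _ _) _.
  rewrite mulrDr lerD// !normrZ ?ger0_norm// ?(ltW h0)// mulrA ler_wpM2r//.
  - by rewrite ler_piMl// ltW.
  - by rewrite ler_piMl// ltW.
(* The second difference is the increment along [h *: v] of this first difference along [h *: w]. *)
pose g x := f (h *: w + x) - f x.
have dg t : 0 <= t <= 1 -> differentiable g (t *: (h *: v) + u).
  move=> t01; apply: differentiableB; last first.
    by apply: df; have := inB t 0 t01; rewrite scale0r addr0; apply; rewrite lexx ler01.
  apply: (@differentiable_comp _ _ _ _ (fun x => h *: w + x) f) => //.
  apply: df; have := inB t 1 t01; rewrite scale1r (addrC (t *: _)) addrA; apply.
  by rewrite lexx ler01.
have [c c01 Ec] := MVT_line dg.
have dDv t : 0 <= t <= 1 ->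
    differentiable (fun x => 'D_v f x) (t *: (h *: w) + (c *: (h *: v) + u)).
  move=> t01; apply: (Df v).1; have := inB c t c01 t01.
  by rewrite addrA (addrC (t *: _)).
have [c' c01' Ec'] := MVT_line dDv.
exists (c' *: (h *: w) + (c *: (h *: v) + u)).
  by rewrite addrA (addrC (c' *: _)); exact: inB.
have DZ (F : U -> R) z x : differentiable F x -> 'D_(h *: z) F x = h * 'D_z F x.
  by move=> dF; rewrite !deriveE// linearZ.
rewrite -DZ; last exact: dDv.
rewrite -Ec'.
have -> : f (h *: v + h *: w + u) - f (h *: v + u) - f (h *: w + u) + f u
   = g (h *: v + u) - g u.
  rewrite /g addrA (addrC (h *: w) (h *: v)); ring.
rewrite Ec DZ; last exact: dg.
congr (_ * _).
have df1 : differentiable f (h *: w + (c *: (h *: v) + u)).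
  apply: df; have := inB c 1 c01; rewrite scale1r (addrC (c *: _)) addrA; apply.
  by rewrite lexx ler01.
have df0 : differentiable f (c *: (h *: v) + u).
  by apply: df; have := inB c 0 c01; rewrite scale0r addr0; apply; rewrite lexx ler01.
have ds : is_diff (c *: (h *: v) + u) (fun x => h *: w + x) id.
  by apply: is_diff_eq; apply/funext => s /=; exact: add0r.
have dfs : differentiable (f \o (fun x => h *: w + x)) (c *: (h *: v) + u).
  exact: differentiable_comp.
rewrite deriveB; [|exact: diff_derivable|exact: diff_derivable].
rewrite -[X in X - _]/('D_v (f \o (fun x => h *: w + x)) (c *: (h *: v) + u)).
rewrite derive_comp//; congr ('D__ f _ - _).
by rewrite deriveE// diff_val.
Qed.

(** The second difference is symmetric in the two directions. It therefore equates the two mixed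
    derivatives taken at two points near [u], each within e/2 of its value at [u] by continuity. *)
Lemma derive_sym U (f : U -> R) (A : set U) (v w u : U) : open A -> A u ->
  smooth_on A f -> 'D_v (fun x => 'D_w f x) u = 'D_w (fun x => 'D_v f x) u.
Proof.
move=> oA Au sf; apply/eqP; rewrite -subr_eq0 -normr_le0 leNgt; apply/negP => e0.
set e := `|_| in e0.
have /nbhs_ballP[r /= r0 rA] := open_nbhs_nbhs (conj oA Au).
have near2 v' w' : exists2 d, 0 < d & forall x, ball u d x ->
   `|'D_v' (fun x => 'D_w' f x) u - 'D_v' (fun x => 'D_w' f x) x| < e / 2.
  have := smooth_cont (smooth_derive v' (smooth_derive w' sf)) Au.
  move=> /cvgrPdist_lt/(_ (e / 2)); rewrite divr_gt0// => /(_ isT).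
  move=> /nbhs_ballP[d /= d0 H]; exists d => // x /H.
have [d1 d10 H1] := near2 v w; have [d2 d20 H2] := near2 w v.
pose m := Num.min r (Num.min d1 d2).
have m0 : 0 < m by rewrite !lt_min r0 d10.
have mB x : ball u m x -> [/\ ball u r x, ball u d1 x & ball u d2 x].
  move=> mx; split; apply: le_ball mx; rewrite /m !ge_min lexx ?orbT//.
have s0 : 0 < `|v| + `|w| + 1 by rewrite ltr_wpDl// addr_ge0.
pose h := m / (`|v| + `|w| + 1).
have h0 : 0 < h by rewrite divr_gt0.
have hm : h * (`|v| + `|w|) < m.
  by rewrite /h mulrAC ltr_pdivrMr// ltr_pM2l// ltrDl.
have sm : smooth_on (ball u m) f.
  by apply: smooth_subset sf => x /mB[/rA].
have [p /mB[_ _ p2] Ep] := second_difference h0 hm (sm 2%N).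
have hm' : h * (`|w| + `|v|) < m by rewrite addrC.
have [q /mB[_ q1 _] Eq] := second_difference h0 hm' (sm 2%N).
have pq : 'D_w (fun x => 'D_v f x) p = 'D_v (fun x => 'D_w f x) q.
  apply: (mulfI (lt0r_neq0 h0)); apply: (mulfI (lt0r_neq0 h0)).
  by rewrite -Ep -Eq (addrC (h *: w) (h *: v)); ring.
have := H1 _ q1; have := H2 _ p2; rewrite pq => B1 B2.
suff : e < e by rewrite ltxx.
rewrite {2}(splitr e) {1}/e.
rewrite (le_lt_trans _ (ltrD B2 B1))//.
rewrite [X in _ <= _ + X]distrC; apply: le_trans (ler_normD _ _).
by rewrite addrA subrK.
Qed.

End Calculus2.

Section RowVectors.
Variable R : realType.

(** Completeness of row spaces is what the Banach fixed point theorem asks for in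
    [inverse_near_id]. *)
HB.instance Definition _ m n := Uniform_isComplete.Build 'M[R^o]_(m, n) (@mx_complete R^o m n).

Lemma rowV_norm_le n (w : 'rV[R]_n) (c : R) : 0 <= c ->
  (forall j, `|w 0 j| <= c) -> `|w| <= c.
Proof.
move=> c0 H; rewrite /Num.Def.normr/= mx_normrE; apply: bigmax_le => // -[i j] _ /=.
by rewrite ord1.
Qed.

Lemma coord_le_norm n (w : 'rV[R]_n) j : `|w 0 j| <= `|w|.
Proof.
rewrite [leRHS]/Num.Def.normr/= mx_normrE.
exact: (le_bigmax _ (fun ij : 'I_1 * 'I_n => `|w ij.1 ij.2|) (0, j)).
Qed.

Lemma mulmx_bound n m (K : 'M[R]_(n, m)) :
  exists2 C, 0 < C & forall w : 'rV[R]_n, `|w *m K| <= C * `|w|.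
Proof.
exists (1 + \sum_j \sum_i `|K i j|).
  by rewrite ltr_pwDl// sumr_ge0// => j _; rewrite sumr_ge0.
move=> w; apply: rowV_norm_le.
  by rewrite mulr_ge0// addr_ge0// sumr_ge0// => j _; rewrite sumr_ge0.
move=> j; rewrite mxE; apply: le_trans (ler_norm_sum _ _ _) _.
apply: (@le_trans _ _ (\sum_i `|K i j| * `|w|)).
  apply: ler_sum => i _; rewrite normrM mulrC ler_wpM2l//; exact: coord_le_norm.
rewrite -mulr_suml ler_wpM2r// (bigD1 j)//= addrCA lerDl addr_ge0//.
by rewrite sumr_ge0// => i _; rewrite sumr_ge0.
Qed.

Lemma mulmxr_continuous n m (K : 'M[R]_(n, m)) :
  continuous (mulmxr K : 'rV[R]_n -> 'rV[R]_m).
Proof.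
have [C C0 HC] := mulmx_bound K.
apply: (@bounded_linear_continuous R 'rV[R]_n 'rV[R]_m (mulmxr K)).
apply/linear_boundedP; exists C; split; first exact: gtr0_real.
move=> C' CC' w /=; apply: le_trans (HC w) _.
by rewrite ler_wpM2r// ltW.
Qed.

Lemma smooth_mulmx (U : normedModType R) (A : set U) n m (f : U -> 'rV[R]_n)
  (K : 'M[R]_(n, m)) : open A -> smooth_on A f -> smooth_on A (fun u => f u *m K).
Proof.
move=> oA sf k.
apply: (Ck_comp (B := setT) (g := mulmxr K) oA openT _ (sf k)) => //.
exact/Ck_linear/mulmxr_continuous.
Qed.

Lemma derive_mulmx (U : normedModType R) n m (f : U -> 'rV[R]_n)
  (K : 'M[R]_(n, m)) u v : differentiable f u ->
  'D_v (fun u => f u *m K) u = 'D_v f u *m K.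
Proof.
move=> df; have cK := @mulmxr_continuous _ _ K.
have dK : differentiable (mulmxr K : 'rV[R]_n -> 'rV[R]_m) (f u) by exact: linear_differentiable.
rewrite -[LHS]/('D_v (mulmxr K \o f) u) (derive_comp _ df dK) (deriveE _ dK).
by rewrite diff_lin.
Qed.

End RowVectors.

(** * The inverse function theorem *)

Section InverseFunction.
Variables (R : realType) (n : nat).
Implicit Types (W : set 'rV[R]_n) (F : 'rV[R]_n -> 'rV[R]_n).

(** The differential of [r] is continuous and vanishes at [u0], hence is at most 1/2 nearby; the
    mean value theorem on segments, one coordinate at a time, suffices because the norm is the
    maximum norm. *)
Lemma near_id_lipschitz W (r : 'rV[R]_n -> 'rV[R]_n) u0 : open W -> W u0 ->
  smooth_on W r -> (forall v, 'D_v r u0 = 0) ->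
  exists rho : R, [/\ 0 < rho, ball u0 rho `<=` W,
    forall u v, ball u0 rho u -> `|'D_v r u| <= `|v| / 2 &
    forall u v, ball u0 rho u -> ball u0 rho v -> `|r u - r v| <= `|u - v| / 2].
Proof.
move=> oW Wu sr r0.
(* The [n] partial derivatives, each bounded by [e], add up to at most 1/2; [n.+1] keeps the
   denominator nonzero when [n] is 0. *)
pose e : R := (2 * n.+1%:R)^-1.
have e0 : 0 < e by rewrite invr_gt0 mulr_gt0.
have H i : \forall u \near u0, `|'D_(delta_mx 0 i) r u| <= e.
  have := smooth_cont (smooth_derive (delta_mx 0 i) sr) Wu.
  move=> /cvgrPdist_le/(_ e e0); rewrite r0; apply: filterS => u.
  by rewrite sub0r normrN.
have {}H := filter_forall _ H; move: H => /(_ (nbhs_filter _)) H.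
have /nbhs_ballP[rho /= rho0 {}H] : nbhs u0 (W `&` [set u | forall i, `|'D_(delta_mx 0 i) r u| <= e]) by apply: filterI => //; exact: open_nbhs_nbhs.
have D u v : ball u0 rho u -> `|'D_v r u| <= `|v| / 2.
  move=> /H[Wu' Hu]; rewrite derive_basis; last exact: smooth_diff sr Wu'.
  apply: le_trans (ler_norm_sum _ _ _) _.
  apply: (@le_trans _ _ (\sum_(i < n) `|v| * e)).
    apply: ler_sum => i _; rewrite normrZ ler_pM//; exact: coord_le_norm.
  rewrite sumr_const card_ord -mulrnAr ler_wpM2l// /e invfM mulrC -mulrnAl.
  rewrite -mulr_natl ler_piMl//.
  by rewrite ler_pdivrMr// mul1r ler_nat.
exists rho; split => // [u /H[]//|u v Bu Bv].
apply: rowV_norm_le; first by rewrite mulr_ge0.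
move=> j; pose f := fun u => r u 0 j.
have seg t : 0 <= t <= 1 -> ball u0 rho (t *: (u - v) + v).
  move=> /andP[t0 t1]; move: Bu Bv; rewrite -!ball_normE/= => Bu Bv.
  have -> : u0 - (t *: (u - v) + v) = t *: (u0 - u) + (1 - t) *: (u0 - v).
    by apply/rowP => k; rewrite !mxE; ring.
  have t1' : 0 <= 1 - t by rewrite subr_ge0.
  apply: le_lt_trans (ler_normD _ _) _; rewrite !normrZ !ger0_norm//.
  have -> : rho = t * rho + (1 - t) * rho by ring.
  move: t0; rewrite le_eqVlt => /predU1P[<-|t0].
    by rewrite !mul0r !add0r subr0 !mul1r.
  by rewrite ltr_leD// ?ltr_pM2l// ler_wpM2l// ltW.
have dr t : 0 <= t <= 1 -> differentiable r (t *: (u - v) + v).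
  by move=> /seg/H[Wt _]; exact: smooth_diff sr Wt.
have [t t01 /= E] : exists2 c : R, 0 <= c <= 1 & f (u - v + v) - f v = 'D_(u - v) f (c *: (u - v) + v).
  apply: MVT_line => t t01.
  by apply: (@differentiable_comp _ _ _ _ r (coord_map R j)); [exact: dr|exact: differentiable_coord].
rewrite !mxE -/(f u) -/(f v); rewrite subrK in E; rewrite E derive_coord; last exact/diff_derivable/dr.
exact/(le_trans (coord_le_norm _ _))/D/seg.
Qed.

End InverseFunction.

Section InverseFunction2.
Variables (R : realType) (n : nat).
Implicit Types (W : set 'rV[R]_n) (F : 'rV[R]_n -> 'rV[R]_n).

(** [F] is the identity plus a map [r] with Lipschitz constant 1/2. This gives the lower bound on
    [F u - F u'] and the injectivity of the differentials at once; solving F u = z amounts to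
    finding a fixed point of the contraction z - r. *)
Lemma inverse_near_id W F u0 : open W -> W u0 -> smooth_on W F ->
  (forall v, 'D_v F u0 = v) ->
  exists rho d : R, exists g : 'rV[R]_n -> 'rV[R]_n,
  [/\ 0 < d, ball u0 rho `<=` W /\ ball u0 rho u0,
    (forall z, ball (F u0) d z -> ball u0 rho (g z) /\ F (g z) = z),
    (forall u u', ball u0 rho u -> ball u0 rho u' -> `|u - u'| <= 2 * `|F u - F u'|) &
    (forall u v, ball u0 rho u -> 'D_v F u = 0 -> v = 0)].
Proof.
move=> oW Wu sF DF0.
pose r u := F u - u.
have sr : smooth_on W r.
  move=> k; apply: CkD => //; apply: CkN => //.
  exact: (@Ck_linear _ _ _ _ _ idfun (fun=> cvg_id)).
have Dr u v : W u -> 'D_v r u = 'D_v F u - v.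
  move=> Wu'; rewrite deriveB ?derive_id//; exact: smooth_derivable sF Wu'.
have r0 v : 'D_v r u0 = 0 by rewrite Dr// DF0 subrr.
have [rho [rho0 rW Hd Hl]] := near_id_lipschitz oW Wu sr r0.
have EF u u' : u - u' = (F u - F u') - (r u - r u') by rewrite /r; apply/rowP => k; rewrite !mxE; ring.
have inj u u' : ball u0 rho u -> ball u0 rho u' -> `|u - u'| <= 2 * `|F u - F u'|.
  move=> Bu Bu'; have := Hl _ _ Bu Bu'; have := ler_normB (F u - F u') (r u - r u').
  rewrite -EF; lra.
have Bu0 : ball u0 rho u0 by exact: ballxx.
pose U := closed_ball u0 (rho / 2).
have rho20 : 0 < rho / 2 by rewrite divr_gt0.
have UE u : U u <-> `|u0 - u| <= rho / 2.
  by rewrite /U closed_ballE.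
have UB u : U u -> ball u0 rho u.
  move=> /UE H; rewrite -ball_normE/=; apply: le_lt_trans H _.
  by rewrite ltr_pdivrMr// mulr_natr mulr2n ltrDl.
have sol z : ball (F u0) (rho / 4) z -> exists u, ball u0 rho u /\ F u = z.
  move=> zB0; have {zB0}zB : `|F u0 - z| < rho / 4 by move: zB0; rewrite -ball_normE.
  pose T u := z - r u.
  (* On the closed ball of radius rho/2 the distance of [T u] from [u0] is at most |F u0 - z| + |r
     u0 - r u|, and both terms are at most rho/4. *)
  have TU : set_fun U U T.
    move=> u Uu; apply/UE; have := (UE u).1 Uu => Hu.
    have -> : u0 - T u = (F u0 - z) - (r u0 - r u).
      by rewrite /T /r; apply/rowP => k; rewrite !mxE; ring.
    have := Hl _ _ Bu0 (UB _ Uu); have := ler_normB (F u0 - z) (r u0 - r u).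
    lra.
  have ctr : is_contraction (mkfun_fun TU).
    exists (2^-1)%:nng; split => /=; first lra.
    move=> [u v] [/= /UB Bu /UB Bv]; rewrite /T.
    have -> : z - r u - (z - r v) = r v - r u.
      by apply/rowP => k; rewrite !mxE; ring.
    by rewrite distrC mulrC; exact: Hl.
  have [||u Uu Eu] := banach_fixed_point ctr.
  - exact: closed_ball_closed.
  - by exists u0; apply/UE; rewrite subrr normr0 ltW.
  exists u; split; first exact: UB.
  apply/rowP => k; have /rowP/(_ k) := Eu; rewrite /= /T /r !mxE; lra.
exists rho, (rho / 4), (fun z => get (fun u => ball u0 rho u /\ F u = z)); split => //.
- by rewrite divr_gt0.
- by move=> z /sol H; exact: getPex H.
- move=> u v Bu Dv; have := Hd _ v Bu; rewrite Dr; last exact: rW.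
  rewrite Dv sub0r normrN => H; apply/eqP; rewrite -normr_le0; lra.
Qed.

Lemma jacobianE F u v : differentiable F u -> v *m jacobian F u = 'D_v F u.
Proof. by move=> dF; rewrite deriveEjacobian. Qed.

Lemma injective_unitmx (J : 'M[R]_n) : (forall v : 'rV_n, v *m J = 0 -> v = 0) -> J \in unitmx.
Proof.
move=> H; rewrite -row_free_unit -kermx_eq0; apply/rowV0P => v /sub_kermxP.
exact: H.
Qed.

(** Composing with the inverse Jacobian [K] at [u0] reduces the existence of the inverse to a
    differential equal to the identity. Smoothness of the inverse is then proved for [F] itself. *)
Theorem inverse_function W F u0 : open W -> W u0 -> smooth_on W F ->
  (forall v, 'D_v F u0 = 0 -> v = 0) ->
  exists (V : set 'rV[R]_n) (d : R) (g : 'rV[R]_n -> 'rV[R]_n),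
  [/\ [/\ open V, V u0, V `<=` W & 0 < d],
    forall u, V u -> ball (F u0) d (F u) /\ g (F u) = u,
    forall z, ball (F u0) d z -> V (g z) /\ F (g z) = z,
    smooth_on (ball (F u0) d) g &
    forall u v, V u -> 'D_v F u = 0 -> v = 0].
Proof.
move=> oW Wu sF inj0.
have dF u : W u -> differentiable F u by exact: smooth_diff sF.
pose K := invmx (jacobian F u0).
have uJ0 : jacobian F u0 \in unitmx.
  by apply: injective_unitmx => v; rewrite (jacobianE _ (dF _ Wu)); exact: inj0.
pose G u := F u *m K.
have sG : smooth_on W G by exact: smooth_mulmx.
have DG u v : W u -> 'D_v G u = 'D_v F u *m K.
  by move=> Wu'; rewrite derive_mulmx//; exact: dF.
have [|rho [d [g [d0 [rW Bu0] Hg inj injD]]]] := inverse_near_id oW Wu sG.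
  by move=> v; rewrite DG// -(jacobianE _ (dF _ Wu)) mulmxK.
have KF u : G u *m jacobian F u0 = F u by rewrite mulmxKV.
have [C C0 HC] := mulmx_bound K.
pose d' := d / C.
have d'0 : 0 < d' by rewrite divr_gt0.
have BG z : ball (F u0) d' z -> ball (G u0) d (z *m K).
  rewrite -!ball_normE/= => H; rewrite -mulmxBl; apply: le_lt_trans (HC _) _.
  by rewrite mulrC -ltr_pdivlMr.
pose h z := g (z *m K).
have Hh z : ball (F u0) d' z -> ball u0 rho (h z) /\ F (h z) = z.
  move=> /BG/Hg[? E]; split => //.
  by rewrite -KF E mulmxKV.
have injF u u' : ball u0 rho u -> ball u0 rho u' -> `|u - u'| <= 2 * C * `|F u - F u'|.
  move=> Bu Bu'; apply: le_trans (inj _ _ Bu Bu') _.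
  by rewrite -mulrA ler_wpM2l// -mulmxBl.
have uJ u : ball u0 rho u -> jacobian F u \in unitmx.
  move=> Bu; apply: injective_unitmx => v; rewrite (jacobianE _ (dF _ (rW _ Bu))).
  by move=> E; apply: (injD _ _ Bu); rewrite (DG _ _ (rW _ Bu)) E mul0mx.
pose V := ball u0 rho `&` F @^-1` (ball (F u0) d').
have hF u : V u -> h (F u) = u.
  move=> [Bu Fu]; have [Bh Eh] := Hh _ Fu.
  by apply/eqP; rewrite -subr_eq0 -normr_le0; apply: le_trans (injF _ _ Bh Bu) _;
    rewrite Eh subrr normr0 mulr0.
have Bopen (x : 'rV[R]_n) e : open (ball x e) by exact: ball_open.
exists V, d', h; split.
- split => //; last by move=> u [/rW].
  + rewrite openE => u [Bu Fu]; apply: filterI; first exact: open_nbhs_nbhs.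
    have cF := smooth_cont sF (rW _ Bu).
    by apply: cF; exact: open_nbhs_nbhs.
  + by split => //=; exact: ballxx.
- by move=> u Vu; split; [case: Vu|exact: hF].
- by move=> z Bz; have [Bh Eh] := Hh _ Bz; split => //; split => //=; rewrite Eh.
- have is_diff_h z : ball (F u0) d' z ->
      is_diff z h (mulmxr (invmx (jacobian F (h z)))).
    move=> Bz; have [Bh Eh] := Hh _ Bz; set K' := invmx _.
    apply: is_diff_approx; first exact: mulmxr_continuous.
    have [C' C'0 HC'] := mulmx_bound K'.
    (* [2 * C] bounds an increment of [h] by the increment of its argument, and [C'] bounds
       multiplication by [K']; dividing by both makes the final error [e]. *)
    move=> e e0; pose e' := e / (C' * (2 * C)).
    have C20 : 0 < 2 * C by rewrite mulr_gt0.
    have e'0 : 0 < e' by rewrite divr_gt0// mulr_gt0.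
    have /nbhs_ballP[r /= r0 Hr] := diff_approx (dF _ (rW _ Bh)) e'0.
    have B1 : \forall k \near (0 : 'rV[R]_n), ball (F u0) d' (k + z).
      have /nbhs_ballP[s /= s0 Hs] := open_nbhs_nbhs (conj (Bopen _ _) Bz).
      apply/nbhs_ballP; exists s => //= k Hk; apply: Hs; move: Hk.
      by rewrite -!ball_normE/= sub0r opprD addrCA subrr addr0.
    have B2 : \forall k \near (0 : 'rV[R]_n), `|k| < r / (2 * C).
      apply/nbhs_ballP; exists (r / (2 * C)) => /=; first by rewrite divr_gt0.
      by move=> k; rewrite -ball_normE/= sub0r normrN.
    near=> k.
    have Bk : ball (F u0) d' (k + z) by near: k.
    have [Bhk Ehk] := Hh _ Bk.
    set l := h (k + z) - h z.
    have lk : `|l| <= 2 * C * `|k|.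
      by apply: le_trans (injF _ _ Bhk Bh) _; rewrite Ehk Eh addrK.
    have lr : ball (0 : 'rV[R]_n) r l.
      rewrite -ball_normE/= sub0r normrN; apply: le_lt_trans lk _.
      by rewrite mulrC -ltr_pdivlMr//; near: k.
    have := Hr _ lr; rewrite /l subrK Ehk Eh -/l => HH.
    (* The linearisation error of [h] is minus that of [F] at [h z] along [l], carried over by the
       inverse Jacobian. *)
    have -> : h (k + z) - (h z + mulmxr K' k) = - ((k + z - (z + 'd F (h z) l)) *m K').
      have -> : 'd F (h z) l = l *m jacobian F (h z).
        by rewrite (jacobianE _ (dF _ (rW _ Bh))) (deriveE _ (dF _ (rW _ Bh))).
      have -> : k + z - (z + l *m jacobian F (h z)) = k - l *m jacobian F (h z).
        by apply/rowP => ?; rewrite !mxE; ring.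
      rewrite mulmxBl /K' mulmxK ?uJ//= opprB opprD addrA /l.
      by [].
    rewrite normrN; apply: le_trans (HC' _) _.
    apply: (@le_trans _ _ (C' * (e' * (2 * C * `|k|)))).
      rewrite ler_pM2l//; apply: le_trans HH _; by rewrite ler_pM2l.
    rewrite !mulrA ler_wpM2r// /e'.
    by rewrite le_eqVlt; apply/orP; left; apply/eqP; field; rewrite !gt_eqF.
  have Dh z v : ball (F u0) d' z -> 'D_v h z = v *m invmx (jacobian F (h z)).
    by move=> /is_diff_h[dh Eh]; rewrite deriveE// Eh.
  (* Bootstrap: the derivative of [h] is the inverse Jacobian of [F] evaluated at [h], so each order
     of smoothness of [h] yields the next. *)
  elim=> [|k IH].
    move=> z /is_diff_h[dh _]; exact: differentiable_continuous.
  split => [z /is_diff_h[]//|v].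
  apply: (@Ck_ext _ _ _ _ _ (fun z => v *m invmx (jacobian F (h z)))) => //.
    by move=> z /Dh ->.
  apply/(Ck_rVP _ _ (Bopen _ _)) => j.
  apply: (@Ck_ext _ _ _ _ _ (fun z => \sum_i v 0 i * invmx (jacobian F (h z)) i j)) => //.
    by move=> z _; rewrite mxE.
  apply: Ck_sum => // i; apply: CkM => //; first exact: Ck_cst.
  apply: (@Ck_invmx R _ k _ n (fun z => jacobian F (h z)) i j (Bopen _ _)).
    by move=> z /Hh[/uJ].
  move=> a b.
  have sJ : smooth_on W (fun u => jacobian F u a b).
    apply: (@smooth_ext _ _ _ _ (fun u => ('D_(delta_mx 0 a) F u) 0 b)) => //.
      by move=> u Wu'; rewrite -(jacobianE _ (dF _ Wu')) -rowE mxE.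
    by move=> l; have := (Ck_rVP l _ oW).1 (smooth_derive (delta_mx 0 a) sF l) b.
  (* [Ck_comp] concerns row-valued maps, so the scalar entry is wrapped as a row of length one. *)
  have sJB : smooth_on (ball u0 rho) (fun u => \row_(j < 1) jacobian F u a b).
    move=> l; apply/Ck_rVP => // j'.
    by apply: (Ck_ext (Bopen _ _) _ (Ck_subset rW (sJ l))) => u _; rewrite [RHS]mxE.
  have := Ck_comp (Bopen (F u0) d') (Bopen u0 rho) (fun z Bz => (Hh z Bz).1) IH (sJB k).
  move=> /(Ck_rVP _ _ (Bopen _ _))/(_ 0).
  by apply: (Ck_ext (Bopen _ _)) => z _; rewrite [LHS]mxE.
- move=> u v [Bu _] E; apply: (injD _ _ Bu); by rewrite (DG _ _ (rW _ Bu)) E mul0mx.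
Unshelve. all: by end_near. Qed.

End InverseFunction2.

(** * Pseudo-Euclidean linear algebra *)

Section Scal.
Variables (R : realType) (n s : nat).
Implicit Types (u v w : 'rV[R]_n).
Local Notation "<< u , v >>" := (scal s u v).

Lemma scalC u v : scal s u v = scal s v u.
Proof. by apply: eq_bigr => i _; rewrite -!mulrA (mulrC (u 0 i)). Qed.

Lemma scalDl u v w : scal s (u + v) w = scal s u w + scal s v w.
Proof. by rewrite /scal -big_split; apply: eq_bigr => i _; rewrite !mxE/=; ring. Qed.

Lemma scalZl a u w : scal s (a *: u) w = a * scal s u w.
Proof. by rewrite /scal mulr_sumr; apply: eq_bigr => i _; rewrite !mxE/=; ring. Qed.

Lemma scalDr u v w : scal s w (u + v) = scal s w u + scal s w v.
Proof. by rewrite !(scalC w) scalDl. Qed.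

Lemma scalZr a u w : scal s w (a *: u) = a * scal s w u.
Proof. by rewrite !(scalC w) scalZl. Qed.

Lemma scalNl u w : scal s (- u) w = - scal s u w.
Proof. by rewrite -scaleN1r scalZl mulN1r. Qed.

Lemma scalNr u w : scal s w (- u) = - scal s w u.
Proof. by rewrite !(scalC w) scalNl. Qed.

Lemma scalBl u v w : scal s (u - v) w = scal s u w - scal s v w.
Proof. by rewrite scalDl scalNl. Qed.

Lemma scalBr u v w : scal s w (u - v) = scal s w u - scal s w v.
Proof. by rewrite scalDr scalNr. Qed.

Lemma scal0l w : scal s 0 w = 0.
Proof. by rewrite -(scale0r w) scalZl mul0r. Qed.

Lemma scal0r w : scal s w 0 = 0.
Proof. by rewrite scalC scal0l. Qed.

Lemma scal_suml (I : Type) (r : seq I) (P : pred I) (f : I -> 'rV[R]_n) w :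
  scal s (\sum_(i <- r | P i) f i) w = \sum_(i <- r | P i) scal s (f i) w.
Proof.
by apply: (big_morph (fun x => scal s x w)) => [x y|]; rewrite ?scalDl ?scal0l.
Qed.

Lemma scal_sumr (I : Type) (r : seq I) (P : pred I) (f : I -> 'rV[R]_n) w :
  scal s w (\sum_(i <- r | P i) f i) = \sum_(i <- r | P i) scal s w (f i).
Proof. by rewrite scalC scal_suml; apply: eq_bigr => i _; rewrite scalC. Qed.

Lemma scal_eq0 u : (forall w, scal s u w = 0) -> u = 0.
Proof.
move=> H; apply/rowP => j; rewrite mxE; have := H (delta_mx 0 j).
rewrite /scal (bigD1 j)//= big1 => [|i ij]; last by rewrite mxE (negPf ij) andbF mulr0.
rewrite !mxE !eqxx/= addr0 mulr1; case: ifP => _; rewrite ?mul1r ?mulN1r//.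
by move/eqP; rewrite oppr_eq0 => /eqP.
Qed.

Variable (U : normedModType R).

Lemma differentiable_rV m (f : U -> 'rV[R]_m) (x : U) j : differentiable f x ->
  differentiable (fun x => f x 0 j) x.
Proof.
move=> df; apply: (@differentiable_comp _ _ _ _ f (coord_map R j)) => //.
exact: differentiable_coord.
Qed.

Lemma Ck_scal k (A : set U) (f g : U -> 'rV[R]_n) : open A ->
  Ck k A f -> Ck k A g -> Ck k A (fun x : U => scal s (f x) (g x)).
Proof.
move=> oA /(Ck_rVP _ _ oA) Cf /(Ck_rVP _ _ oA) Cg; apply: Ck_sum => // i.
by apply: CkM => //; apply: CkM => //; exact: Ck_cst.
Qed.

Lemma smooth_scal (A : set U) (f g : U -> 'rV[R]_n) : open A ->
  smooth_on A f -> smooth_on A g -> smooth_on A (fun x : U => scal s (f x) (g x)).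
Proof. by move=> oA sf sg k; exact: Ck_scal. Qed.

Lemma derive_scal (f g : U -> 'rV[R]_n) (u v : U) :
  differentiable f u -> differentiable g u ->
  'D_v (fun x : U => scal s (f x) (g x)) u =
  scal s ('D_v f u) (g u) + scal s (f u) ('D_v g u).
Proof.
move=> df dg.
pose h i := (fun x : U => f x 0 i) * (fun x : U => g x 0 i) : U -> R.
have df' i : derivable (fun x : U => f x 0 i) u v by apply: diff_derivable; exact: differentiable_rV.
have dg' i : derivable (fun x : U => g x 0 i) u v by apply: diff_derivable; exact: differentiable_rV.
have dh i : derivable (h i) u v by apply: derivableM.
pose k (i : 'I_n) := (if (i < s)%N then -1 else 1 : R).
have -> : (fun x : U => scal s (f x) (g x)) = \sum_(i < n) (k i *: h i).
  by apply/funext => x; rewrite fct_sumE; apply: eq_bigr => i _; rewrite -mulrA.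
rewrite derive_sum; last by move=> i; exact: derivableZ.
rewrite /scal -big_split; apply: eq_bigr => i _ /=.
rewrite deriveZ// deriveM// !derive_coord; [|exact: diff_derivable..].
by rewrite -[LHS]/(k i * (f u 0 i * _ + g u 0 i * _)) -/(k i); ring.
Qed.

End Scal.

Definition scalE := (scalDl, scalDr, scalZl, scalZr, scalNl, scalNr, scalBl, scalBr, scal0l, scal0r).

Section Frames.
Variable R : realType.
Implicit Types (u v w e : 'rV[R]_5).

Lemma kernel_vector m n (M : 'M[R]_(n, m)) : (m < n)%N ->
  exists2 v : 'rV[R]_n, v != 0 & v *m M = 0.
Proof.
move=> mn; have : kermx M != 0.
  rewrite kermx_eq0 /row_free; apply/negP => /eqP E; have := rank_leq_col M.
  by rewrite E leqNgt mn.
by move=> /rowV0Pn[v /sub_kermxP vM v0]; exists v.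
Qed.

Lemma big_ord2 (V : nmodType) (F : 'I_2 -> V) : \sum_(i < 2) F i = F 0 + F 1.
Proof.
by rewrite big_ord_recl big_ord_recl big_ord0 addr0; congr (F _ + F _); exact/val_inj.
Qed.

Lemma ord2P (i : 'I_2) : i = 0 \/ i = 1.
Proof. by case: i => [[|[|]]]// h; [left|right]; apply/val_inj. Qed.

Definition frame4 (a b c d : 'rV[R]_5) : 'M[R]_(4, 5) :=
  \matrix_(i < 4) [:: a; b; c; d]`_i.

Lemma mulmx_frame4 (v : 'rV[R]_4) a b c d :
  v *m frame4 a b c d = v 0 (inord 0) *: a + v 0 (inord 1) *: b + v 0 (inord 2) *: c + v 0 (inord 3) *: d.
Proof.
rewrite mulmx_sum_row !big_ord_recl big_ord0 !rowK /= addr0 !addrA.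
by do !congr (_ + _); congr (_ *: _); congr (v _ _); apply/val_inj; rewrite /= inordK.
Qed.

Lemma row4_eq0 (v : 'rV[R]_4) : v 0 (inord 0) = 0 -> v 0 (inord 1) = 0 ->
  v 0 (inord 2) = 0 -> v 0 (inord 3) = 0 -> v = 0.
Proof.
move=> h0 h1 h2 h3; apply/rowP => -[[|[|[|[|]]]]// h]; rewrite mxE;
 [rewrite -[RHS]h0|rewrite -[RHS]h1|rewrite -[RHS]h2|rewrite -[RHS]h3];
 congr (v _ _); apply/val_inj; by rewrite /= inordK.
Qed.

Definition sgn5 : 'M[R]_5 := diag_mx (\row_(i < 5) if (i < 2)%N then -1 else 1).

Lemma scal_mx u v : scal 2 u v = (u *m sgn5 *m v^T) 0 0.
Proof.
rewrite mxE; apply: eq_bigr => i _; rewrite mul_mx_diag !mxE; ring.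
Qed.

(** Four linear conditions on five unknowns. *)
Lemma exists_orthogonal4 (a b c d : 'rV[R]_5) : exists2 e : 'rV[R]_5, e != 0 &
  [/\ scal 2 e a = 0, scal 2 e b = 0, scal 2 e c = 0 & scal 2 e d = 0].
Proof.
have [//|e e0 E] := @kernel_vector 4 5 (sgn5 *m (frame4 a b c d)^T).
exists e => //.
have H (i : 'I_4) : scal 2 e ([:: a; b; c; d]`_i) = 0.
  have <- : row i (frame4 a b c d) = [:: a; b; c; d]`_i by rewrite rowK.
  by rewrite scal_mx tr_row colE !mulmxA -(mulmxA e) E mul0mx mxE.
split; [exact: (H (@Ordinal 4 0 isT))|exact: (H (@Ordinal 4 1 isT))|
  exact: (H (@Ordinal 4 2 isT))|exact: (H (@Ordinal 4 3 isT))].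
Qed.

Lemma scal5E u v : scal 2 u v = - u 0 (inord 0) * v 0 (inord 0) - u 0 (inord 1) * v 0 (inord 1)
  + u 0 (inord 2) * v 0 (inord 2) + u 0 (inord 3) * v 0 (inord 3) + u 0 (inord 4) * v 0 (inord 4).
Proof.
rewrite /scal (eq_bigr (fun i : 'I_5 => (if (i < 2)%N then -1 else 1) * u 0 (inord i) * v 0 (inord i))).
  by rewrite !big_ord_recl big_ord0 /= /bump /= !add1n !addr0; ring.
by move=> i _; rewrite inord_val.
Qed.

Lemma coords5_eq0 u : u 0 (inord 0) = 0 -> u 0 (inord 1) = 0 -> u 0 (inord 2) = 0 ->
  u 0 (inord 3) = 0 -> u 0 (inord 4) = 0 -> u = 0.
Proof.
move=> h0 h1 h2 h3 h4; apply: (@scal_eq0 _ _ 2) => w.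
by rewrite (scal5E u w) h0 h1 h2 h3 h4; ring.
Qed.

(* A four-dimensional positive semidefinite subspace would meet the negative
   definite plane of the first two coordinates. *)
Lemma no_semidefinite4 (a b c d : 'rV[R]_5) :
  (forall x y z t : R, 0 <= scal 2 (x *: a + y *: b + z *: c + t *: d) (x *: a + y *: b + z *: c + t *: d)) ->
  exists x y z t : R, [/\ x *: a + y *: b + z *: c + t *: d = 0 & ~ [/\ x = 0, y = 0, z = 0 & t = 0]].
Proof.
move=> H.
pose M := \matrix_(i < 4, j < 3) frame4 a b c d i (rshift 2 j).
have [v v0 E] := kernel_vector M isT.
pose w := v *m frame4 a b c d.
have w0 (j : 'I_3) : w 0 (rshift 2 j) = 0.
  have /rowP/(_ j) := E; rewrite mxE [RHS]mxE => <-; rewrite /w mxE.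
  by apply: eq_bigr => i _; rewrite [in RHS]mxE.
have K k (hk : (k < 3)%N) : w 0 (inord (2 + k)) = 0.
  rewrite -(w0 (Ordinal hk)); congr (w _ _); apply/val_inj; rewrite /= inordK// -[5%N]/(2 + 3)%N ltn_add2l.
have := H (v 0 (inord 0)) (v 0 (inord 1)) (v 0 (inord 2)) (v 0 (inord 3)).
rewrite -mulmx_frame4 -/w scal5E (K 0%N isT) (K 1%N isT) (K 2%N isT) => w_ge0.
have w00 : w 0 (inord 0) = 0 by nra.
have w01 : w 0 (inord 1) = 0 by nra.
have wE : w = 0.
  by apply: coords5_eq0 => //; [exact: (K 0%N)|exact: (K 1%N)|exact: (K 2%N)].
exists (v 0 (inord 0)), (v 0 (inord 1)), (v 0 (inord 2)), (v 0 (inord 3)); split.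
  by rewrite -mulmx_frame4.
by case=> h0 h1 h2 h3; move/eqP: v0; apply; exact: row4_eq0.
Qed.

End Frames.

(** * Frames adapted to a light-like vector *)

Section LightFrames.
Variable R : realType.
Implicit Types (y n a b e xi v : 'rV[R]_5).

(** A hyperbolic pair [y], [n] and a positive definite plane orthogonal to it, the latter expressed
    by leading minors. Together they have signature (3,1), which leaves one negative direction in
    the ambient space. *)
Record light_frame y n a b : Prop := LightFrame {
  lf_yy : scal 2 y y = 0; lf_nn : scal 2 n n = 0; lf_yn : scal 2 y n = 1;
  lf_ya : scal 2 y a = 0; lf_yb : scal 2 y b = 0;
  lf_na : scal 2 n a = 0; lf_nb : scal 2 n b = 0;
  lf_aa : 0 < scal 2 a a;
  lf_det : 0 < scal 2 a a * scal 2 b b - scal 2 a b ^+ 2 }.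

Lemma pos_form (g11 g12 g22 p q : R) : 0 < g11 -> 0 < g11 * g22 - g12 ^+ 2 ->
  0 <= p ^+ 2 * g11 + 2 * p * q * g12 + q ^+ 2 * g22.
Proof.
move=> g0 d0; rewrite -(pmulr_rge0 _ g0).
have -> : g11 * (p ^+ 2 * g11 + 2 * p * q * g12 + q ^+ 2 * g22) =
   (p * g11 + q * g12) ^+ 2 + q ^+ 2 * (g11 * g22 - g12 ^+ 2) by ring.
by rewrite addr_ge0 ?sqr_ge0// mulr_ge0 ?sqr_ge0// ltW.
Qed.

Lemma form_kernel (g11 g12 g22 p q : R) : 0 < g11 * g22 - g12 ^+ 2 ->
  p * g11 + q * g12 = 0 -> p * g12 + q * g22 = 0 -> p = 0 /\ q = 0.
Proof.
move=> /lt0r_neq0 d0 E1 E2; split; apply: (mulIf d0); rewrite mul0r.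
  have -> : p * (g11 * g22 - g12 ^+ 2) = (p * g11 + q * g12) * g22 - (p * g12 + q * g22) * g12 by ring.
  by rewrite E1 E2 !mul0r subrr.
have -> : q * (g11 * g22 - g12 ^+ 2) = (p * g12 + q * g22) * g11 - (p * g11 + q * g12) * g12 by ring.
by rewrite E1 E2 !mul0r subrr.
Qed.

(** Otherwise [y + n], of square 2, together with [a], [b] and [e] would be independent and span a
    positive semidefinite space of dimension four, against [no_semidefinite4]. *)
Lemma light_frame_timelike y n a b e : light_frame y n a b -> e != 0 ->
  scal 2 e y = 0 -> scal 2 e n = 0 -> scal 2 e a = 0 -> scal 2 e b = 0 ->
  scal 2 e e < 0.
Proof.
move=> [yy nn yn ya yb na nb aa dt] e0 ey en ea eb; rewrite ltNge; apply/negP => ee.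
have [] := @no_semidefinite4 R (y + n) a b e.
  move=> x p q t; rewrite !scalE (scalC 2 a y) (scalC 2 b y) (scalC 2 a n) (scalC 2 b n) (scalC 2 n y)
    (scalC 2 y e) (scalC 2 n e) (scalC 2 a e) (scalC 2 b e) (scalC 2 b a).
  rewrite yy nn yn ya yb na nb ey en ea eb.
  have := pos_form p q aa dt.
  have := mulr_ge0 (sqr_ge0 t) ee; have := sqr_ge0 x.
  nra.
move=> x [p [q [t [E]]]]; apply.
have pair w : scal 2 (x *: (y + n) + p *: a + q *: b + t *: e) w = 0 by rewrite E scal0l.
have x0 : x = 0.
  have := pair y; rewrite !scalE yy (scalC 2 n y) yn (scalC 2 a y) ya (scalC 2 b y) yb ey; lra.
have pa := pair a; have pb := pair b.
rewrite !scalE x0 ya na (scalC 2 b a) ea in pa; rewrite !scalE x0 yb nb eb in pb.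
have [p0 q0] : p = 0 /\ q = 0 by apply: (form_kernel dt); lra.
split => //; move: E; rewrite x0 p0 q0 !scale0r !add0r => /eqP.
by rewrite scaler_eq0 (negPf e0) orbF => /eqP.
Qed.

(** Six vectors in dimension five satisfy a linear relation; pairing it with the frame vectors kills
    their coefficients one after the other. Vector identities are verified below by pairing the
    difference of both sides with the frame. *)
Lemma light_frame_zero y n a b xi v : light_frame y n a b ->
  scal 2 xi y = 0 -> scal 2 xi n = 0 -> scal 2 xi a = 0 -> scal 2 xi b = 0 ->
  scal 2 xi xi = -1 ->
  scal 2 v y = 0 -> scal 2 v n = 0 -> scal 2 v a = 0 -> scal 2 v b = 0 ->
  scal 2 v xi = 0 -> v = 0.
Proof.
move=> [yy nn yn ya yb na nb aa dt] xy xn xa xb xx vy vn va vb vx.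
apply/eqP; apply: contraT => v0.
pose M : 'M[R]_(6, 5) := \matrix_(i < 6) [:: y; n; a; b; xi; v]`_i.
have [c c0 E] := kernel_vector M isT.
pose k i := c 0 (inord i).
have {}E : k 0%N *: y + k 1%N *: n + k 2%N *: a + k 3%N *: b + k 4%N *: xi + k 5%N *: v = 0.
  rewrite -E mulmx_sum_row (eq_bigr (fun i : 'I_6 => k i *: [:: y; n; a; b; xi; v]`_i)).
    by rewrite !big_ord_recl big_ord0 /= /bump /= !add1n addr0 !addrA.
  by move=> i _; rewrite rowK /k inord_val.
have pair w : scal 2 (k 0%N *: y + k 1%N *: n + k 2%N *: a + k 3%N *: b + k 4%N *: xi + k 5%N *: v) w = 0.
  by rewrite E scal0l.
have k1 : k 1%N = 0.
  have := pair y; rewrite !scalE yy (scalC 2 n y) yn (scalC 2 a y) ya (scalC 2 b y) yb xy vy; lra.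
have k0 : k 0%N = 0.
  have := pair n; rewrite !scalE nn yn (scalC 2 a n) na (scalC 2 b n) nb xn vn; lra.
have k4 : k 4%N = 0.
  have := pair xi; rewrite !scalE (scalC 2 y xi) (scalC 2 n xi) (scalC 2 a xi) (scalC 2 b xi) xy xn xa xb xx vx; lra.
have pa := pair a; have pb := pair b.
rewrite !scalE ya na (scalC 2 b a) xa va in pa; rewrite !scalE yb nb xb vb in pb.
have [k2 k3] : k 2%N = 0 /\ k 3%N = 0 by apply: (form_kernel dt); lra.
have k5 : k 5%N = 0.
  move: E; rewrite k0 k1 k2 k3 k4 !scale0r !add0r => /eqP.
  by rewrite scaler_eq0 (negPf v0) orbF => /eqP.
move: c0; suff -> : c = 0 by rewrite eqxx.
apply/rowP => i; rewrite mxE -(inord_val i) -/(k i).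
by case: i => [[|[|[|[|[|[|]]]]]]].
Qed.

(** For the hyperbolic pair the coefficient along [y] is the pairing with [n] and conversely; the
    minus sign comes from the time-like [xi]. *)
Lemma light_frame_parseval y n a b xi v w : light_frame y n a b ->
  scal 2 xi y = 0 -> scal 2 xi n = 0 -> scal 2 xi a = 0 -> scal 2 xi b = 0 ->
  scal 2 xi xi = -1 -> scal 2 v a = 0 -> scal 2 v b = 0 ->
  scal 2 v w = scal 2 v y * scal 2 w n + scal 2 v n * scal 2 w y - scal 2 v xi * scal 2 w xi.
Proof.
move=> F xy xn xa xb xx va vb; have [yy nn yn ya yb na nb aa dt] := F.
pose v' := v - (scal 2 v n *: y + scal 2 v y *: n - scal 2 v xi *: xi).
have v'0 : v' = 0.
  apply: (light_frame_zero F xy xn xa xb xx); rewrite /v' !scalE;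
  rewrite ?(scalC 2 n y) ?(scalC 2 y xi) ?(scalC 2 n xi) ?va ?vb ?xx ?xy ?xn ?xa ?xb ?yy ?nn ?yn ?ya ?yb ?na ?nb; ring.
have -> : v = scal 2 v n *: y + scal 2 v y *: n - scal 2 v xi *: xi.
  by apply/eqP; rewrite -subr_eq0 -/v' v'0.
move: (scal 2 v n) (scal 2 v y) (scal 2 v xi) => p q r.
rewrite !scalE ?(scalC 2 n y) ?(scalC 2 y xi) ?(scalC 2 n xi) ?xx ?xy ?xn ?yy ?nn ?yn (scalC 2 w y) (scalC 2 w n) (scalC 2 w xi); ring.
Qed.

End LightFrames.

Section Matrix2.
Variable R : realType.
Implicit Types M : 'M[R]_2.

Lemma det2 M : \det M = M 0 0 * M 1 1 - M 0 1 * M 1 0.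
Proof.
rewrite (expand_det_row _ 0) big_ord2 /cofactor !det_mx11 !mxE /=.
rewrite (_ : lift 0 0 = 1 :> 'I_2); last exact/val_inj.
rewrite (_ : lift 1 0 = 0 :> 'I_2); last exact/val_inj.
by rewrite /= expr0 expr1; ring.
Qed.

Lemma invmx2 M : M \in unitmx ->
  [/\ invmx M 0 0 = M 1 1 / \det M, invmx M 0 1 = - M 0 1 / \det M,
      invmx M 1 0 = - M 1 0 / \det M & invmx M 1 1 = M 0 0 / \det M].
Proof.
move=> uM; rewrite /invmx uM !mxE /cofactor !det_mx11 !mxE /=.
rewrite (_ : lift 0 0 = 1 :> 'I_2); last exact/val_inj.
rewrite (_ : lift 1 0 = 0 :> 'I_2); last exact/val_inj.
by split; rewrite /= ?expr0 ?expr1; ring.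
Qed.

Lemma pos_def_minors M : M 0 1 = M 1 0 -> pos_def M -> 0 < M 0 0 /\ 0 < \det M.
Proof.
move=> sM pM.
have E v : (v *m M *m v^T) 0 0 = v 0 0 * (v 0 0 * M 0 0 + v 0 1 * M 1 0) + v 0 1 * (v 0 0 * M 0 1 + v 0 1 * M 1 1).
  by rewrite mxE big_ord2 !mxE !big_ord2; ring.
have g0 : 0 < M 0 0.
  have := pM (delta_mx 0 0); rewrite E !mxE /= => H.
  have : 0 < 1 * (1 * M 0 0 + 0 * M 1 0) + 0 * (1 * M 0 1 + 0 * M 1 1).
    by apply: H; apply/eqP => /rowP/(_ 0); rewrite !mxE /= => /eqP; rewrite oner_eq0.
  lra.
(* At this vector the quadratic form takes the value [M 0 0 * \det M]. *)
split => //; pose v : 'rV[R]_2 := \row_j (if j == 0 then - M 0 1 else M 0 0).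
have v0 : v 0 0 = - M 0 1 by rewrite mxE.
have v1 : v 0 1 = M 0 0 by rewrite mxE.
have := pM v; rewrite E v0 v1 => H.
rewrite -(pmulr_rgt0 _ g0) det2 -sM.
have : v != 0.
  by apply/eqP => /rowP/(_ 1); rewrite v1 mxE => E0; move: g0; rewrite E0 ltxx.
move=> /H; rewrite -sM; congr (_ < _); ring.
Qed.

End Matrix2.

(** * The Gauss equation and the conformal factor *)

(* A sealed copy of pd: unification would otherwise unfold partial derivatives down to limits. *)
HB.lock Definition pder (R : realType) (V : normedModType R) (i : 'I_2)
  (f : 'rV[R]_2 -> V) (u : 'rV[R]_2) : V := pd i f u.
Arguments pder {R V}.

Lemma pd_pder (R : realType) (V : normedModType R) : @pd R V = @pder R V.
Proof. by rewrite pder.unlock. Qed.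

Lemma pderE (R : realType) (V : normedModType R) i (f : 'rV[R]_2 -> V) u :
  pder i f u = 'D_(delta_mx 0 i) f u.
Proof. by rewrite pder.unlock. Qed.

(** The covariant Hessian of the map [y]. It is orthogonal to the tangent plane
    ([second_form_tangent]), hence is the vector-valued second fundamental form, and its trace is
    the Laplacian of [y]. *)
HB.lock Definition second_form (R : realType) (y : 'rV[R]_2 -> 'rV[R]_5)
  (j k : 'I_2) (u : 'rV[R]_2) : 'rV[R]_5 :=
  pder j (pder k y) u - \sum_(m < 2) christoffel (first_form y) m j k u *: pder m y u.

Lemma second_formE (R : realType) (y : 'rV[R]_2 -> 'rV[R]_5) j k u :
  second_form y j k u =
  pder j (pder k y) u - \sum_(m < 2) christoffel (first_form y) m j k u *: pder m y u.
Proof. by rewrite second_form.unlock. Qed.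

Section CurvatureAlgebra.
Variable R : realType.
Implicit Types (g A B a b c : 'I_2 -> R) (K L : 'I_2 -> 'I_2 -> R).

(** The algebra of the Gauss equation without derivatives. Here [g] is a column of the metric, [A],
    [B], [K], [L] are Christoffel symbols, and [t] is the third-derivative term common to both
    hypotheses, which cancels; [s] and [s'] are products of second derivatives. *)
Lemma curvature_cancel g A B dA dB a b K L t s s' :
  \sum_(m < 2) (dA m * g m + A m * (\sum_(n < 2) K n m * g n + a m)) = t + s ->
  \sum_(m < 2) (dB m * g m + B m * (\sum_(n < 2) L n m * g n + b m)) = t + s' ->
  \sum_(m < 2) g m * (dA m - dB m + \sum_(n < 2) (K m n * A n - L m n * B n)) =
  (s - \sum_(m < 2) A m * a m) - (s' - \sum_(m < 2) B m * b m).
Proof.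
rewrite !big_ord2; move: (g 0) (g 1) (A 0) (A 1) (B 0) (B 1) (dA 0) (dA 1) (dB 0) (dB 1).
move: (a 0) (a 1) (b 0) (b 1) (K 0 0) (K 0 1) (K 1 0) (K 1 1) (L 0 0) (L 0 1) (L 1 0) (L 1 1).
move=> a0 a1 b0 b1 k00 k01 k10 k11 l00 l01 l10 l11 g0 g1 A0 A1 B0 B1 dA0 dA1 dB0 dB1 E1 E2.
have -> : s = dA0 * g0 + A0 * (k00 * g0 + k10 * g1 + a0) + (dA1 * g1 + A1 * (k01 * g0 + k11 * g1 + a1)) - t.
  by rewrite E1; ring.
have -> : s' = dB0 * g0 + B0 * (l00 * g0 + l10 * g1 + b0) + (dB1 * g1 + B1 * (l01 * g0 + l11 * g1 + b1)) - t.
  by rewrite E2; ring.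
ring.
Qed.

Lemma raise_index (h c : 'I_2 -> R) L m :
  (forall l, \sum_(i < 2) h i * L l i = (m == l)%:R) ->
  c m = \sum_(i < 2) h i * \sum_(l < 2) L l i * c l.
Proof.
move=> E.
transitivity (\sum_(l < 2) (\sum_(i < 2) h i * L l i) * c l).
  by rewrite big_ord2 !E; case: (ord2P m) => ->; rewrite ?eqxx/=; ring.
rewrite !big_ord2; ring.
Qed.

End CurvatureAlgebra.

Section Gauss.
Variables (R : realType) (W : set 'rV[R]_2) (y : 'rV[R]_2 -> 'rV[R]_5).
Hypotheses (oW : open W) (sy : smooth_on W y).
Hypothesis y_light : forall u, W u -> scal 2 (y u) (y u) = 0.
Hypothesis y_pos : forall u, W u -> pos_def (first_form y u).

Local Notation G := (first_form y).
Local Notation H := (fun u => invmx (G u)).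
Local Notation Gam := (christoffel G).
Local Notation y2 i j := (pder i (pder j y)).

Lemma smooth_pder (V : normedModType R) (f : 'rV[R]_2 -> V) i : smooth_on W f -> smooth_on W (pder i f).
Proof.
have -> : pder i f = (fun u => 'D_(delta_mx 0 i) f u) by apply/funext => u; rewrite pderE.
exact: smooth_derive.
Qed.

Lemma pder_sym n (f : 'rV[R]_2 -> 'rV[R]_n) i j u : W u -> smooth_on W f ->
  pder i (pder j f) u = pder j (pder i f) u.
Proof.
move=> Wu sf; apply/rowP => k.
have sfk : smooth_on W (fun u => f u 0 k) by move=> l; exact: ((Ck_rVP l _ oW).1 (sf l) k).
have E (i' j' : 'I_2) : pder i' (pder j' f) u 0 k = pder i' (pder j' (fun u => f u 0 k)) u.
  rewrite !pderE -derive_coord; last exact: smooth_derivable (smooth_pder _ sf) Wu.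
  apply: near_eq_derive; apply: (open_near_eq oW Wu) => v Wv.
  by rewrite !pderE derive_coord//; exact: smooth_derivable sf Wv.
rewrite !E.
have D i' j' : pder i' (pder j' (fun u => f u 0 k)) u =
    'D_(delta_mx 0 i') (fun v => 'D_(delta_mx 0 j') (fun u => f u 0 k) v) u.
  rewrite pderE; apply: near_eq_derive; apply: (open_near_eq oW Wu) => v _.
  by rewrite pderE.
rewrite !D; exact: (derive_sym (delta_mx 0 i) (delta_mx 0 j) oW Wu sfk).
Qed.

Lemma pder_ext (V : normedModType R) (f g : 'rV[R]_2 -> V) i u : W u ->
  (forall v, W v -> f v = g v) -> pder i f u = pder i g u.
Proof. by move=> Wu fg; rewrite !pderE; apply: near_eq_derive; exact: (open_near_eq oW Wu). Qed.

Lemma pder_scal n s (f g : 'rV[R]_2 -> 'rV[R]_n) i u : W u -> smooth_on W f -> smooth_on W g ->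
  pder i (fun v => scal s (f v) (g v)) u = scal s (pder i f u) (g u) + scal s (f u) (pder i g u).
Proof. by move=> Wu sf sg; rewrite !pderE; apply: derive_scal; [exact: smooth_diff sf Wu|exact: smooth_diff sg Wu]. Qed.

Lemma first_formE u i j : G u i j = scal 2 (pder i y u) (pder j y u).
Proof. by rewrite mxE pd_pder. Qed.

Lemma first_form_sym u i j : G u i j = G u j i.
Proof. by rewrite !first_formE scalC. Qed.

Lemma first_form_minors u : W u -> 0 < G u 0 0 /\ 0 < \det (G u).
Proof. by move=> Wu; apply: pos_def_minors (y_pos Wu); exact: first_form_sym. Qed.

Lemma first_form_unit u : W u -> G u \in unitmx.
Proof. by move=> /first_form_minors[_ d]; rewrite unitmxE unitfE gt_eqF. Qed.

Lemma smooth_first_form i j : smooth_on W (fun u => G u i j).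
Proof.
apply: (@smooth_ext _ _ _ _ (fun u => scal 2 (pder i y u) (pder j y u))) => //.
  by move=> u _; rewrite first_formE.
by apply: smooth_scal => //; exact: smooth_pder.
Qed.

Lemma smooth_inv_first_form i j : smooth_on W (fun u => H u i j).
Proof.
move=> k; apply: Ck_invmx => //; first exact: first_form_unit.
by move=> a b; exact: smooth_first_form.
Qed.

Lemma pder_first_form l i j u : W u ->
  pder l (fun v => G v i j : R) u = scal 2 (y2 l i u) (pder j y u) + scal 2 (pder i y u) (y2 l j u).
Proof.
move=> Wu; rewrite -pder_scal//; [|exact: smooth_pder|exact: smooth_pder].
by apply: pder_ext => // v _; rewrite first_formE.
Qed.

(** Differentiating the metric coefficients as scalar products of partial derivatives, four of the
    six terms cancel and the other two are equal, which absorbs the factor 1/2. *)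
Lemma christoffelE k i j u : W u ->
  Gam k i j u = \sum_(l < 2) H u k l * scal 2 (y2 i j u) (pder l y u).
Proof.
move=> Wu; rewrite /christoffel !pd_pder mulr_sumr; apply: eq_bigr => l _.
rewrite !pder_first_form //.
rewrite (pder_sym j i Wu sy).
rewrite (pder_sym l i Wu sy).
rewrite (pder_sym l j Wu sy).
rewrite (scalC 2 (pder j y u)) (scalC 2 (pder i y u) (y2 j l u)); by field.
Qed.

Lemma smooth_christoffel k i j : smooth_on W (Gam k i j).
Proof.
apply: (@smooth_ext _ _ _ _ (fun u => \sum_(l < 2) H u k l * scal 2 (y2 i j u) (pder l y u))) => //.
  by move=> u Wu; rewrite christoffelE.
move=> m; apply: Ck_sum => // l; apply: CkM => //; first exact: smooth_inv_first_form.
by apply: Ck_scal => //; do ?apply: smooth_pder.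
Qed.

Lemma inv_first_formK u i j : W u -> \sum_(m < 2) H u i m * G u m j = (i == j)%:R.
Proof. by move=> /first_form_unit uG; have /matrixP/(_ i j) := mulVmx uG; rewrite !mxE. Qed.

Lemma inv_first_form_sym u i j : W u -> H u i j = H u j i.
Proof.
move=> /first_form_unit uG; have [h00 h01 h10 h11] := invmx2 uG.
by case: (ord2P i) => ->; case: (ord2P j) => ->; rewrite // h01 h10 first_form_sym.
Qed.

Lemma christoffel_lower j k i u : W u ->
  \sum_(m < 2) Gam m j k u * G u m i = scal 2 (y2 j k u) (pder i y u).
Proof.
move=> Wu; rewrite big_ord2 !christoffelE// !big_ord2.
have E l : H u 0 l * G u 0 i + H u 1 l * G u 1 i = (l == i)%:R.
  by rewrite -(inv_first_formK l i Wu) big_ord2 !(inv_first_form_sym l _ Wu).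
transitivity (\sum_(l < 2) scal 2 (y2 j k u) (pder l y u) * (H u 0 l * G u 0 i + H u 1 l * G u 1 i)).
  by rewrite big_ord2; ring.
rewrite big_ord2 !E; case: (ord2P i) => -> /=; rewrite ?eqxx/=; ring.
Qed.

Local Notation II := (second_form y).

Lemma second_form_tangent j k i u : W u -> scal 2 (II j k u) (pder i y u) = 0.
Proof.
move=> Wu; rewrite !second_formE scalBl scal_suml -(christoffel_lower j k i Wu).
apply/eqP; rewrite subr_eq0; apply/eqP/eq_bigr => m _.
by rewrite scalZl first_formE.
Qed.

Lemma second_form_sym j k u : W u -> II j k u = II k j u.
Proof.
move=> Wu; rewrite !second_formE (pder_sym j k Wu sy); congr (_ - _); apply: eq_bigr => m _.
by rewrite !christoffelE// (pder_sym j k Wu sy).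
Qed.

Lemma lift_tangent i u : W u -> scal 2 (y u) (pder i y u) = 0.
Proof.
move=> Wu; have : pder i (fun v => scal 2 (y v) (y v)) u = pder i (fun=> 0 : R) u.
  by apply: pder_ext => // v /y_light.
rewrite pder_scal// [RHS]pderE derive_cst (scalC 2 (pder i y u)); lra.
Qed.

Lemma lift_second i j u : W u -> scal 2 (y u) (y2 i j u) = - G u i j.
Proof.
move=> Wu; have : pder i (fun v => scal 2 (y v) (pder j y v)) u = pder i (fun=> 0 : R) u.
  by apply: pder_ext => // v /lift_tangent.
rewrite pder_scal//; last exact: smooth_pder.
rewrite [RHS]pderE derive_cst first_formE; lra.
Qed.

Lemma second_form_lift j k u : W u -> scal 2 (II j k u) (y u) = - G u j k.
Proof.
move=> Wu; rewrite !second_formE scalBl scal_suml big1 ?subr0; first by rewrite scalC lift_second.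
by move=> m _; rewrite scalZl scalC lift_tangent// mulr0.
Qed.

Lemma laplacianE u : laplacian G y u = \sum_(i < 2) \sum_(j < 2) H u i j *: II i j u.
Proof.
apply: eq_bigr => i _; apply: eq_bigr => j _; by rewrite second_formE !pd_pder.
Qed.

Lemma pder_christoffel_lower l j k i u : W u ->
  \sum_(m < 2) (pder l (Gam m j k) u * G u m i
     + Gam m j k u * (scal 2 (y2 l m u) (pder i y u) + scal 2 (pder m y u) (y2 l i u)))
  = scal 2 (pder l (y2 j k) u) (pder i y u) + scal 2 (y2 j k u) (y2 l i u).
Proof.
move=> Wu.
have s1 := smooth_pder j (smooth_pder k sy).
rewrite -(pder_scal 2 l Wu s1 (smooth_pder i sy)).
transitivity (pder l (fun v => Gam 0 j k v * G v 0 i + Gam 1 j k v * G v 1 i) u); last first.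
  by apply: pder_ext => // v Wv; rewrite -christoffel_lower// big_ord2.
have dGam m : derivable (Gam m j k) u (delta_mx 0 l) by exact: smooth_derivable (smooth_christoffel m j k) Wu.
have dG m : derivable (fun v => G v m i) u (delta_mx 0 l) by exact: smooth_derivable (smooth_first_form m i) Wu.
have -> : (fun v => Gam 0 j k v * G v 0 i + Gam 1 j k v * G v 1 i) =
  (Gam 0 j k * (fun v => G v 0 i) + Gam 1 j k * (fun v => G v 1 i) : 'rV[R]_2 -> R) by [].
rewrite [RHS]pderE deriveD; [|exact: derivableM|exact: derivableM].
rewrite (deriveM (dGam 0) (dG 0)) (deriveM (dGam 1) (dG 1)) big_ord2 -!pderE !pder_first_form//.
by rewrite -[RHS]/(_ * _ + _ * _ + (_ * _ + _ * _)); ring.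
Qed.

Definition curv m l j k u := pder l (Gam m j k) u - pder j (Gam m l k) u
    + \sum_(n < 2) (Gam m l n u * Gam n j k u - Gam m j n u * Gam n l k u).

(** The Gauss equation with all indices down: differentiate [christoffel_lower] along [l] and along
    [j] and subtract, so that the third derivatives of [y] disappear by symmetry. *)
Lemma curv_lower l j k i u : W u ->
  \sum_(m < 2) G u m i * curv m l j k u =
  scal 2 (II j k u) (II l i u) - scal 2 (II l k u) (II j i u).
Proof.
move=> Wu.
(* As the second form is normal, only the first factor needs its tangential correction. *)
have EII j' k' l' i' : scal 2 (II j' k' u) (II l' i' u) =
    scal 2 (y2 j' k' u) (y2 l' i' u) - \sum_(m < 2) Gam m j' k' u * scal 2 (pder m y u) (y2 l' i' u).
  rewrite (second_formE _ l') scalBr scal_sumr big1 ?subr0; last first.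
    by move=> m _; rewrite scalZr second_form_tangent// mulr0.
  by rewrite second_formE scalBl scal_suml; congr (_ - _); apply: eq_bigr => m _; rewrite scalZl.
have T : pder l (y2 j k) u = pder j (y2 l k) u by apply: pder_sym => //; exact: smooth_pder.
have E l' j' k' : \sum_(m < 2) (pder l' (Gam m j' k') u * G u m i
     + Gam m j' k' u * (\sum_(n < 2) Gam n l' m u * G u n i + scal 2 (pder m y u) (y2 l' i u)))
  = scal 2 (pder l' (y2 j' k') u) (pder i y u) + scal 2 (y2 j' k' u) (y2 l' i u).
  rewrite -pder_christoffel_lower//; apply: eq_bigr => m _; by rewrite christoffel_lower.
have E1 := E l j k; have E2 := E j l k; rewrite T in E1.
have X := @curvature_cancel _ (fun m => G u m i) (fun m => Gam m j k u) (fun m => Gam m l k u)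
  (fun m => pder l (Gam m j k) u) (fun m => pder j (Gam m l k) u)
  (fun m => scal 2 (pder m y u) (y2 l i u)) (fun m => scal 2 (pder m y u) (y2 j i u))
  (fun n m => Gam n l m u) (fun n m => Gam n j m u) _ _ _ E1 E2.
by apply: etrans X _; congr (_ - _); symmetry; exact: EII.
Qed.

Lemma curvE m l j k u : W u ->
  curv m l j k u = \sum_(i < 2) H u m i * (scal 2 (II j k u) (II l i u) - scal 2 (II l k u) (II j i u)).
Proof.
move=> Wu.
rewrite (raise_index (fun m' => curv m' l j k u) (h := fun i => H u m i) (L := fun l' i => G u l' i)).
  by apply: eq_bigr => i _; rewrite -curv_lower.
by move=> l'; rewrite -(inv_first_formK m l' Wu); apply: eq_bigr => i _; rewrite first_form_sym.
Qed.

Lemma gauss_equation u : W u ->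
  scalar_curvature G u = \sum_(j < 2) \sum_(k < 2) H u j k * \sum_(l < 2) \sum_(i < 2)
    H u l i * (scal 2 (II j k u) (II l i u) - scal 2 (II l k u) (II j i u)).
Proof.
move=> Wu; apply: eq_bigr => j _; apply: eq_bigr => k _; congr (_ * _).
by rewrite /ricci !pd_pder; apply: eq_bigr => l _; rewrite -curvE.
Qed.

End Gauss.

Section ConformalFactor.
Variables (R : realType) (W : set 'rV[R]_2) (y : 'rV[R]_2 -> 'rV[R]_5).
Hypotheses (oW : open W) (sy : smooth_on W y).
Hypothesis y_light : forall u, W u -> scal 2 (y u) (y u) = 0.
Hypothesis y_pos : forall u, W u -> pos_def (first_form y u).

Local Notation G := (first_form y).
Local Notation H := (fun u => invmx (G u)).
Local Notation II := (second_form y).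
Local Notation y2 i j := (pder i (pder j y)).

Lemma laplacian_tangent i u : W u -> scal 2 (laplacian G y u) (pder i y u) = 0.
Proof.
move=> Wu; rewrite laplacianE scal_suml big1// => k _; rewrite scal_suml big1// => l _.
by rewrite scalZl (second_form_tangent oW sy y_pos)// mulr0.
Qed.

Lemma laplacian_lift u : W u -> scal 2 (laplacian G y u) (y u) = -2.
Proof.
move=> Wu; rewrite laplacianE scal_suml.
transitivity (- \sum_(i < 2) \sum_(j < 2) H u i j * G u j i).
  rewrite -sumrN; apply: eq_bigr => i _; rewrite scal_suml -sumrN; apply: eq_bigr => j _.
  by rewrite scalZl (second_form_lift oW sy y_light)// mulrN (first_form_sym _ _ j).
by rewrite big_ord2 !(inv_first_formK y_pos)//= !eqxx.
Qed.

(** The Laplacian of [y] is orthogonal to the tangent plane and has product -2 with [y]. The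
    coefficient -1/2 in [Nvec] therefore gives product 1 with [y], and the coefficient 1/8 makes
    [Nvec] null. *)
Lemma Nvec_frame u : W u -> light_frame (y u) (Nvec y u) (pder 0 y u) (pder 1 y u).
Proof.
move=> Wu; have [g0 gd] := first_form_minors y_pos Wu.
have T i : scal 2 (Nvec y u) (pder i y u) = 0.
  by rewrite /Nvec !scalE laplacian_tangent// (lift_tangent oW sy y_light)// !mulr0 oppr0 addr0.
have Ly := laplacian_lift Wu; have yL := Ly; rewrite scalC in yL.
split; rewrite ?(lift_tangent oW sy y_light) ?T//; first exact: y_light.
- by rewrite /Nvec !scalE Ly yL y_light//; field.
- by rewrite /Nvec !scalE yL y_light//; field.
- by rewrite -first_formE.
- by move: gd; rewrite det2 !first_formE (scalC 2 (pder 1 y u) (pder 0 y u)).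
Qed.

Definition second_coef (xi : 'rV[R]_5) i j u := scal 2 (y2 i j u) xi.

Definition trace_coef (xi : 'rV[R]_5) u :=
  (G u 1 1 * second_coef xi 0 0 u - 2 * G u 0 1 * second_coef xi 0 1 u + G u 0 0 * second_coef xi 1 1 u) / \det (G u).

Lemma second_form_coef xi i j u : (forall k, scal 2 xi (pder k y u) = 0) ->
  scal 2 (II i j u) xi = second_coef xi i j u.
Proof.
move=> x0; rewrite second_formE scalBl scal_suml big1 ?subr0// => m _.
by rewrite scalZl scalC x0 mulr0.
Qed.

Lemma laplacian_coef xi u : W u -> (forall k, scal 2 xi (pder k y u) = 0) ->
  scal 2 (laplacian G y u) xi = trace_coef xi u.
Proof.
move=> Wu x0; rewrite laplacianE scal_suml big_ord2 !scal_suml !big_ord2 !scalZl !second_form_coef//.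
have [h00 h01 h10 h11] := invmx2 (first_form_unit y_pos Wu).
rewrite h00 h01 h10 h11 /trace_coef (first_form_sym _ _ 1 0).
rewrite /second_coef (pder_sym oW 1 0 Wu sy); ring.
Qed.

(** With c_ij the pairing of the second form with a null vector [n], each product <II_ij, II_kl> is
    - g_ij c_kl - c_ij g_kl - b_ij b_kl. Both the squared Laplacian and twice the scalar curvature
    contain -4 tr c, so only [b] survives in their difference. *)
Lemma conformal_factorE xi u : W u -> scal 2 xi (y u) = 0 ->
  (forall k, scal 2 xi (pder k y u) = 0) -> scal 2 xi xi = -1 ->
  conformal_factor y u =
   4 * (second_coef xi 0 0 u * second_coef xi 1 1 u - second_coef xi 0 1 u ^+ 2) / \det (G u)
   - trace_coef xi u ^+ 2.
Proof.
move=> Wu xy xt xx.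
have F := Nvec_frame Wu; move: (Nvec y u) F => N F.
pose a := scal 2 N xi.
(* [xi] is not assumed orthogonal to [N]; this correction makes it orthogonal to [n] and keeps [n]
   null with product 1 with [y]. *)
pose n := N + a *: xi - (a ^+ 2 / 2) *: y u.
have xn : scal 2 xi n = 0.
  by rewrite /n !scalE xy xx (scalC 2 xi) -/a; ring.
have {}F : light_frame (y u) n (pder 0 y u) (pder 1 y u).
  case: F => yy nn yn ya yb na nb aa dt; split => //; rewrite /n !scalE.
  - by rewrite nn xx xy (scalC 2 xi N) (scalC 2 N (y u)) yn (scalC 2 (y u) xi) xy -/a yy; field.
  - by rewrite yn yy (scalC 2 (y u) xi) xy; ring.
  - by rewrite na xt ya; ring.
  - by rewrite nb xt yb; ring.
have P i j k l : scal 2 (II i j u) (II k l u) = - G u i j * scal 2 (II k l u) n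
    + scal 2 (II i j u) n * - G u k l - second_coef xi i j u * second_coef xi k l u.
  rewrite (light_frame_parseval _ F xy xn (xt 0) (xt 1) xx); last 2 first.
  - exact: second_form_tangent oW sy y_pos _ _ _ _ Wu.
  - exact: second_form_tangent oW sy y_pos _ _ _ _ Wu.
  by rewrite !(second_form_coef _ _ xt) !(second_form_lift oW sy y_light).
rewrite /conformal_factor (gauss_equation oW sy y_pos)// laplacianE.
rewrite !(scal_suml, scal_sumr, big_ord2, scalZl, scalZr).
have [h00 h01 h10 h11] := invmx2 (first_form_unit y_pos Wu).
have [_ gd] := first_form_minors y_pos Wu.
rewrite !P /trace_coef h00 h01 h10 h11.
rewrite (second_form_sym oW sy 1 0 Wu) (first_form_sym _ _ 1 0).
have -> : second_coef xi 1 0 u = second_coef xi 0 1 u.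
  by rewrite /second_coef (pder_sym oW 1 0 Wu sy).
move: gd; rewrite det2 (first_form_sym _ _ 1 0).
move: (G u 0 0) (G u 0 1) (G u 1 1) => g00 g01 g11.
move: (second_coef _ _ _ _) (second_coef _ _ _ _) (second_coef _ _ _ _) => b0 b1 b2.
move: (scal 2 _ _) (scal 2 _ _) (scal 2 _ _) => c0 c1 c2.
move=> /lt0r_neq0 gd; field.
by [].
Qed.

End ConformalFactor.

Section Products.
Variables (R : realType) (U : normedModType R) (A : set U) (n : nat).
Hypothesis oA : open A.

Lemma smooth_scale (f : U -> R) (g : U -> 'rV[R]_n) : smooth_on A f -> smooth_on A g ->
  smooth_on A (fun u => f u *: g u).
Proof.
move=> sf sg k; apply/(Ck_rVP _ _ oA) => j.
apply: (@Ck_ext _ _ _ _ _ (fun u => f u * g u 0 j)) => //.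
  by move=> u _; rewrite mxE.
by apply: CkM => //; exact: ((Ck_rVP _ _ oA).1 (sg k) j).
Qed.

Lemma smoothD (V : normedModType R) (f g : U -> V) : smooth_on A f -> smooth_on A g ->
  smooth_on A (fun u => f u + g u).
Proof. by move=> sf sg k; exact: CkD. Qed.

Lemma smoothN (V : normedModType R) (f : U -> V) : smooth_on A f -> smooth_on A (fun u => - f u).
Proof. by move=> sf k; exact: CkN. Qed.

Lemma smoothB (V : normedModType R) (f g : U -> V) : smooth_on A f -> smooth_on A g ->
  smooth_on A (fun u => f u - g u).
Proof. by move=> sf sg; apply: smoothD => //; exact: smoothN. Qed.

Lemma smoothM (f g : U -> R) : smooth_on A f -> smooth_on A g ->
  smooth_on A (fun u => f u * g u).
Proof. by move=> sf sg k; exact: CkM. Qed.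

Lemma smooth_cst (V : normedModType R) (c : V) : smooth_on A (fun=> c).
Proof. by move=> k; exact: Ck_cst. Qed.

Lemma smooth_sum (V : normedModType R) (I : Type) (r : seq I) (P : pred I)
    (f : I -> U -> V) :
  (forall i, smooth_on A (f i)) -> smooth_on A (fun u => \sum_(i <- r | P i) f i u).
Proof. by move=> sf k; apply: Ck_sum => // i; exact: sf. Qed.

Lemma smoothV (f : U -> R) : (forall u, A u -> f u != 0) -> smooth_on A f ->
  smooth_on A (fun u => (f u)^-1).
Proof. by move=> f0 sf k; exact: CkV. Qed.

Lemma smooth_sqrt (f : U -> R) : (forall u, A u -> 0 < f u) -> smooth_on A f ->
  smooth_on A (fun u => Num.sqrt (f u)).
Proof. by move=> f0 sf k; exact: Ck_sqrt. Qed.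

Lemma derive_scale (f : U -> R) (g : U -> 'rV[R]_n) u v :
  differentiable f u -> differentiable g u ->
  'D_v (fun u => f u *: g u) u = 'D_v f u *: g u + f u *: 'D_v g u.
Proof.
move=> df dg.
have dfv : derivable f u v by exact: diff_derivable.
have dgv : derivable g u v by exact: diff_derivable.
have dgj j : derivable (fun u => g u 0 j) u v by apply: diff_derivable; exact: differentiable_rV.
have dfg : derivable (fun u => f u *: g u) u v.
  apply/derivable_mxP => i j; rewrite ord1.
  have -> : (fun x => (f x *: g x) 0 j) = f * (fun u => g u 0 j).
    by apply/funext => x; rewrite mxE.
  exact: (derivableM dfv (dgj j)).
apply/rowP => j; rewrite -derive_coord//.
have -> : (fun x => (f x *: g x) 0 j) = f * (fun u => g u 0 j).
  by apply/funext => x; rewrite mxE.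
rewrite (deriveM dfv (dgj j)) (derive_coord _ dgv) !mxE.
by rewrite -[LHS]/(_ * _ + _ * _); ring.
Qed.

End Products.

(** * Unit normals and change of lift *)

Section LocalNormal.
Variables (R : realType) (W : set 'rV[R]_2) (y : 'rV[R]_2 -> 'rV[R]_5).
Hypotheses (oW : open W) (sy : smooth_on W y).
Hypothesis y_light : forall u, W u -> scal 2 (y u) (y u) = 0.
Hypothesis y_pos : forall u, W u -> pos_def (first_form y u).

Local Notation G := (first_form y).
Local Notation H := (fun u => invmx (G u)).

Lemma smooth_second_form i j : smooth_on W (second_form y i j).
Proof.
apply: (@smooth_ext _ _ _ _ (fun u => pder i (pder j y) u - \sum_(m < 2) christoffel (first_form y) m i j u *: pder m y u)) => //.
  by move=> u _; rewrite second_formE.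
apply: smoothB => //; first by do ?apply: smooth_pder.
apply: smooth_sum => // m; apply: smooth_scale => //; last exact: smooth_pder.
exact: smooth_christoffel.
Qed.

Lemma smooth_laplacian : smooth_on W (laplacian G y).
Proof.
apply: (@smooth_ext _ _ _ _ (fun u => \sum_(i < 2) \sum_(j < 2) H u i j *: second_form y i j u)) => //.
  by move=> u _; rewrite laplacianE.
apply: smooth_sum => // i; apply: smooth_sum => // j; apply: smooth_scale => //.
  exact: smooth_inv_first_form.
exact: smooth_second_form.
Qed.

Lemma smooth_Nvec : smooth_on W (Nvec y).
Proof.
have sL := smooth_laplacian.
apply: smoothB => //.
  by apply: smoothN => //; apply: smooth_scale => //; exact: smooth_cst.
apply: smooth_scale => //; apply: smoothM => //; first exact: smooth_cst.
exact: smooth_scal.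
Qed.

(** A constant vector [e], normal at [u0], is projected onto the normal line at nearby points. Its
    square stays negative near [u0] by continuity, so the projection can be normalised there. *)
Lemma local_normal u0 : W u0 -> exists (W' : set 'rV[R]_2) (xi : 'rV[R]_2 -> 'rV[R]_5),
  [/\ open W', W' u0, W' `<=` W, smooth_on W' xi & forall u, W' u ->
    [/\ scal 2 (xi u) (xi u) = -1, scal 2 (xi u) (y u) = 0,
        scal 2 (xi u) (Nvec y u) = 0 & forall i, scal 2 (xi u) (pder i y u) = 0]].
Proof.
move=> Wu0.
have [e e0 [ey en e1 e2]] := exists_orthogonal4 (y u0) (Nvec y u0) (pder 0 y u0) (pder 1 y u0).
have ee := light_frame_timelike (Nvec_frame oW sy y_light y_pos Wu0) e0 ey en e1 e2.
pose pi u := e - scal 2 e (Nvec y u) *: y u - scal 2 e (y u) *: Nvec y u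
  - \sum_(i < 2) \sum_(j < 2) (H u i j * scal 2 e (pder i y u)) *: pder j y u.
have spi : smooth_on W pi.
  have sN := smooth_Nvec; have sd i := smooth_pder i sy; have sc := smooth_cst W e.
  apply: smoothB => //; last first.
    apply: smooth_sum => // i; apply: smooth_sum => // j; apply: smooth_scale => //.
    apply: smoothM => //; first exact: smooth_inv_first_form.
    by apply: smooth_scal.
  apply: smoothB => //; last by apply: smooth_scale => //; exact: smooth_scal.
  apply: smoothB => //; by apply: smooth_scale => //; exact: smooth_scal.
have pi0 : pi u0 = e.
  rewrite /pi en ey !scale0r !subr0 big1 ?subr0// => i _; rewrite big1// => j _.
  by case: (ord2P i) => ->; rewrite ?e1 ?e2 mulr0 scale0r.
have pi_orth u : W u -> [/\ scal 2 (pi u) (y u) = 0, scal 2 (pi u) (Nvec y u) = 0 &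
    forall i, scal 2 (pi u) (pder i y u) = 0].
  move=> Wu; have [yy nn yn ya yb na nb _ _] := Nvec_frame oW sy y_light y_pos Wu.
  have dy j : scal 2 (pder j y u) (y u) = 0 by case: (ord2P j) => ->; rewrite scalC.
  have yd j : scal 2 (y u) (pder j y u) = 0 by case: (ord2P j) => ->.
  have dn j : scal 2 (pder j y u) (Nvec y u) = 0 by case: (ord2P j) => ->; rewrite scalC.
  have nd j : scal 2 (Nvec y u) (pder j y u) = 0 by case: (ord2P j) => ->.
  rewrite /pi; move: (Nvec y u) nn yn na nb dn nd => N nn yn na nb dn nd.
  split=> [||k]; rewrite !(scalNl, scalZl, big_ord2, scalDl).
  - by rewrite yy (scalC 2 N) yn !dy; ring.
  - by rewrite nn yn !dn; ring.
  rewrite yd nd -!first_formE.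
  have E i : H u i 0 * G u 0 k + H u i 1 * G u 1 k = (i == k)%:R by rewrite -(inv_first_formK y_pos i k Wu) big_ord2.
  transitivity (scal 2 e (pder k y u) - (scal 2 e (pder 0 y u) * (H u 0 0 * G u 0 k + H u 0 1 * G u 1 k)
     + scal 2 e (pder 1 y u) * (H u 1 0 * G u 0 k + H u 1 1 * G u 1 k))); first by ring.
  by rewrite !E; case: (ord2P k) => ->; rewrite ?eqxx/=; ring.
pose q u := - scal 2 (pi u) (pi u).
have sq : smooth_on W q by apply: smoothN => //; exact: smooth_scal.
pose W' := W `&` [set u | 0 < q u].
have oW' : open W'.
  rewrite openE => u [Wu qu]; apply: filterI; first exact: open_nbhs_nbhs.
  have cq := smooth_cont sq Wu.
  have : nbhs (q u) [set r | 0 < r] by apply: open_nbhs_nbhs; split => //; exact: open_gt.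
  by move=> /cq.
have W'W : W' `<=` W by move=> u [].
have q_gt0 u : W' u -> 0 < q u by case.
exists W', (fun u => (Num.sqrt (q u))^-1 *: pi u); split => //.
- by split => //; rewrite /= /q pi0 oppr_gt0.
- apply: smooth_scale => //; last exact: smooth_subset spi.
  apply: smoothV => //; last by apply: smooth_sqrt => //; exact: smooth_subset sq.
  by move=> u /q_gt0 qu; rewrite gt_eqF// sqrtr_gt0.
- move=> u W'u; have [py pn pd] := pi_orth _ (W'W _ W'u).
  split; rewrite ?scalZl ?scalZr ?py ?pn ?mulr0//; last by move=> i; rewrite scalZl pd mulr0.
  have := q_gt0 _ W'u; rewrite /q; move: (scal 2 _ _) => s s0.
  have s0' : Num.sqrt (- s) != 0 by rewrite gt_eqF// sqrtr_gt0.
  have := sqr_sqrtr (ltW s0); move: (Num.sqrt _) s0' => r r0 E.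
  by rewrite -[s]opprK -E; field.
Qed.

End LocalNormal.

Section Rescaling.
Variables (R : realType) (W : set 'rV[R]_2) (y : 'rV[R]_2 -> 'rV[R]_5) (mu : 'rV[R]_2 -> R).
Hypotheses (oW : open W) (sy : smooth_on W y) (smu : smooth_on W mu).
Hypothesis y_light : forall u, W u -> scal 2 (y u) (y u) = 0.
Hypothesis y_pos : forall u, W u -> pos_def (first_form y u).
Hypothesis mu_gt0 : forall u, W u -> 0 < mu u.

Local Notation Y := (fun u => mu u *: y u).

Lemma pder_scale n (f : 'rV[R]_2 -> R) (g : 'rV[R]_2 -> 'rV[R]_n) i u : W u ->
  smooth_on W f -> smooth_on W g ->
  pder i (fun v => f v *: g v) u = pder i f u *: g u + f u *: pder i g u.
Proof.
move=> Wu sf sg; rewrite !pderE; apply: derive_scale.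
  exact: smooth_diff sf Wu.
exact: smooth_diff sg Wu.
Qed.

Lemma smooth_rescaled : smooth_on W Y.
Proof. exact: smooth_scale. Qed.

Lemma rescaled_light u : W u -> scal 2 (Y u) (Y u) = 0.
Proof. by move=> Wu; rewrite !scalE y_light// !mulr0. Qed.

(** Derivatives of [mu] contribute only multiples of [y], which is null and orthogonal to its own
    derivatives. *)
Lemma first_form_rescaled u : W u -> first_form Y u = mu u ^+ 2 *: first_form y u.
Proof.
move=> Wu; apply/matrixP => i j; rewrite [RHS]mxE !first_formE !pder_scale//.
have t k := lift_tangent oW sy y_light k Wu.
have t' k : scal 2 (pder k y u) (y u) = 0 by rewrite scalC.
by rewrite !(scalDl, scalDr, scalZl, scalZr) y_light// !t !t'; ring.
Qed.

Lemma rescaled_pos u : W u -> pos_def (first_form Y u).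
Proof.
move=> Wu v v0; rewrite first_form_rescaled// -scalemxAr -scalemxAl mxE.
by rewrite mulr_gt0 ?exprn_gt0 ?mu_gt0//; exact: y_pos.
Qed.

Lemma rescaled_tangent (xi : 'rV[R]_5) k u : W u -> scal 2 xi (y u) = 0 ->
  (forall k, scal 2 xi (pder k y u) = 0) -> scal 2 xi (pder k Y u) = 0.
Proof.
by move=> Wu xy xt; rewrite pder_scale// scalDr !scalZr xy xt !mulr0 addr0.
Qed.

Lemma second_coef_rescaled (xi : 'rV[R]_5) i j u : W u -> scal 2 xi (y u) = 0 ->
  (forall k, scal 2 xi (pder k y u) = 0) ->
  second_coef Y xi i j u = mu u * second_coef y xi i j u.
Proof.
move=> Wu xy xt; rewrite /second_coef.
rewrite (pder_ext oW (g := fun v => pder j mu v *: y v + mu v *: pder j y v) i Wu); last first.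
  by move=> v Wv; rewrite pder_scale.
have s1 : smooth_on W (fun v => pder j mu v *: y v).
  by apply: smooth_scale => //; exact: smooth_pder.
have s2 : smooth_on W (fun v => mu v *: pder j y v).
  by apply: smooth_scale => //; exact: smooth_pder.
have -> : pder i (fun v => pder j mu v *: y v + mu v *: pder j y v) u =
   pder i (fun v => pder j mu v *: y v) u + pder i (fun v => mu v *: pder j y v) u.
  rewrite !pderE; apply: deriveD.
    exact: smooth_derivable s1 Wu.
  exact: smooth_derivable s2 Wu.
rewrite !pder_scale//; [|exact: smooth_pder|exact: smooth_pder].
by rewrite !(scalDl, scalZl) (scalC 2 _ xi) xy !(scalC 2 (pder _ y u) xi) !xt; ring.
Qed.

(** One [xi] serves both lifts, because [conformal_factorE] does not ask it to be orthogonal to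
    [Nvec], which does depend on the lift. Then [b] scales by [mu] and the metric by its square. *)
Lemma conformal_factor_rescaled (xi : 'rV[R]_5) u : W u -> scal 2 xi (y u) = 0 ->
  (forall k, scal 2 xi (pder k y u) = 0) -> scal 2 xi xi = -1 ->
  conformal_factor Y u = conformal_factor y u / mu u ^+ 2.
Proof.
move=> Wu xy xt xx.
have xY : scal 2 xi (Y u) = 0 by rewrite scalZr xy mulr0.
have xYt k : scal 2 xi (pder k Y u) = 0 by exact: rescaled_tangent.
rewrite (conformal_factorE oW smooth_rescaled rescaled_light rescaled_pos Wu xY xYt xx).
rewrite (conformal_factorE oW sy y_light y_pos Wu xy xt xx).
rewrite /trace_coef !second_coef_rescaled// first_form_rescaled//.
have E i j : (mu u ^+ 2 *: first_form y u) i j = mu u ^+ 2 * first_form y u i j by rewrite mxE.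
have [_] := first_form_minors y_pos Wu; have := mu_gt0 Wu; rewrite detZ !E.
move: (\det _) (mu u) (first_form y u 0 0) (first_form y u 0 1) (first_form y u 1 1).
move: (second_coef _ _ _ _ _) (second_coef _ _ _ _ _) (second_coef _ _ _ _ _).
move=> b0 b1 b2 d m g0 g1 g2 /lt0r_neq0 m0 /lt0r_neq0 d0; field.
by rewrite m0 d0.
Qed.

End Rescaling.

(** * Canonical lifts *)

Section OsculatingPairs.
Variable R : realType.
Implicit Types (W : set 'rV[R]_2) (Y xi : 'rV[R]_2 -> 'rV[R]_5).

(** What the local argument keeps from the canonical lift and from the vanishing of the conformal
    form: first-order conditions on [Y] and [xi], free of [Nvec] and of the Laplacian. *)
Record osc_at Y xi (u : 'rV[R]_2) : Prop := OscAt {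
  osc_light : scal 2 (Y u) (Y u) = 0;
  osc_unit : scal 2 (xi u) (xi u) = -1;
  osc_orth : scal 2 (xi u) (Y u) = 0;
  osc_pos : pos_def (first_form Y u);
  osc_shape : exists S : 'M[R]_2, [/\ S 0 0 + S 1 1 = 0, \det S = - 4^-1 &
     forall i, pder i xi u = \sum_(j < 2) S i j *: pder j Y u] }.

Record osc_pair W Y xi : Prop := OscPair {
  osc_open : open W;
  osc_smooth : smooth_on W Y;
  osc_normal_smooth : smooth_on W xi;
  osc_on : forall u, W u -> osc_at Y xi u }.

(** By the trace condition, -g0 times the determinant of [b] is the metric evaluated on the vector
    (b1, -b0). *)
Lemma trace_free_det (g0 g1 g2 b0 b1 b2 : R) : 0 < g0 -> 0 < g0 * g2 - g1 ^+ 2 ->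
  g2 * b0 - 2 * g1 * b1 + g0 * b2 = 0 -> b0 * b2 - b1 ^+ 2 <= 0.
Proof.
move=> g0p d0 E; rewrite -(pmulr_rle0 _ g0p).
have -> : g0 * (b0 * b2 - b1 ^+ 2) = - (g0 * b1 ^+ 2 + 2 * b1 * (- b0) * g1 + (- b0) ^+ 2 * g2).
  have -> : g0 * (b0 * b2 - b1 ^+ 2) = b0 * (g0 * b2) - g0 * b1 ^+ 2 by ring.
  have -> : g0 * b2 = 2 * g1 * b1 - g2 * b0 by rewrite -[RHS]addr0 -E; ring.
  ring.
by rewrite oppr_le0 mulrC mulrC (mulrC g0); apply: pos_form.
Qed.

(** The derivatives of [xi] pair to zero with [Y], with [xi], and, by the last hypothesis, with
    [Nvec Y]; hence they are tangent. Pairing with the tangent vectors gives S = - b g^-1, so its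
    trace and determinant are - tr_g b and det b / det g. *)
Lemma osc_pair_of_canonical W Y xi : open W -> smooth_on W Y -> smooth_on W xi ->
  (forall u, W u -> scal 2 (Y u) (Y u) = 0) ->
  (forall u, W u -> pos_def (first_form Y u)) ->
  (forall u, W u -> conformal_metric Y u = first_form Y u) ->
  (forall u, W u -> [/\ scal 2 (xi u) (xi u) = -1, scal 2 (xi u) (Y u) = 0,
        scal 2 (xi u) (Nvec Y u) = 0 & forall i, scal 2 (xi u) (pder i Y u) = 0]) ->
  (forall u i, W u -> scal 2 (pder i (Nvec Y) u) (xi u) = 0) ->
  osc_pair W Y xi.
Proof.
move=> oW sY sx Yl Yp Yc xn Phi0; split => // u Wu.
have [xx xy xN xt] := xn u Wu.
split; [exact: Yl|exact: xx|exact: xy|exact: Yp|].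
have sN := smooth_Nvec oW sY Yp.
pose b i j := second_coef Y (xi u) i j u.
pose H := invmx (first_form Y u).
pose S : 'M[R]_2 := \matrix_(i, j) - \sum_(k < 2) b i k * H k j.
(* Each orthogonality relation of [xi] is differentiated through this Leibniz rule. *)
have Dxi i f (c : R) : smooth_on W f -> (forall v, W v -> scal 2 (xi v) (f v) = c) ->
    scal 2 (pder i xi u) (f u) = - scal 2 (xi u) (pder i f u).
  move=> sf E; have : pder i (fun v => scal 2 (xi v) (f v)) u = pder i (fun=> c) u.
    by apply: (pder_ext oW i Wu) => v Wv; exact: E.
  rewrite (pder_scal _ _ Wu sx sf) [RHS]pderE derive_cst => E'.
  by apply/eqP; rewrite -addr_eq0 E'.
have D0 i : scal 2 (pder i xi u) (Y u) = 0.
  by rewrite (Dxi i Y 0) ?xt ?oppr0// => v /xn[].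
have DN i : scal 2 (pder i xi u) (Nvec Y u) = 0.
  rewrite (Dxi i (Nvec Y) 0) //; last by move=> v /xn[].
  by rewrite scalC Phi0// oppr0.
have Dx i : scal 2 (pder i xi u) (xi u) = 0.
  have := Dxi i xi (-1) sx; rewrite (scalC 2 (xi u)) => E.
  have : scal 2 (pder i xi u) (xi u) = - scal 2 (pder i xi u) (xi u) by apply: E => v /xn[].
  lra.
have Dt i j : scal 2 (pder i xi u) (pder j Y u) = - b i j.
  rewrite (Dxi i (pder j Y) 0); [|exact: smooth_pder|by move=> v /xn[]].
  by rewrite /b /second_coef scalC.
have F := Nvec_frame oW sY Yl Yp Wu.
have [yy nn yn ya yb na nb aa dt] := F.
have yd j : scal 2 (pder j Y u) (Y u) = 0 by case: (ord2P j) => ->; rewrite scalC.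
have nd j : scal 2 (pder j Y u) (Nvec Y u) = 0 by case: (ord2P j) => ->; rewrite scalC.
have xd j : scal 2 (pder j Y u) (xi u) = 0 by rewrite scalC.
have SEij i j : S i j = - (b i 0 * H 0 j + b i 1 * H 1 j) by rewrite mxE big_ord2.
have SE i : pder i xi u = \sum_(j < 2) S i j *: pder j Y u.
  have T k : scal 2 (pder i xi u - \sum_(j < 2) S i j *: pder j Y u) (pder k Y u) = 0.
    rewrite scalBl Dt scal_suml big_ord2 !scalZl -!first_formE !SEij.
    have E l : H l 0 * first_form Y u 0 k + H l 1 * first_form Y u 1 k = (l == k)%:R.
      by rewrite -(inv_first_formK Yp l k Wu) big_ord2.
    move: (E 0) (E 1).
    move: (first_form Y u 0 k) (first_form Y u 1 k) (H 0 0) (H 0 1) (H 1 0) (H 1 1).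
    move=> f0 f1 h00 h01 h10 h11 E0 E1.
    transitivity (- b i k + (b i 0 * (h00 * f0 + h01 * f1) + b i 1 * (h10 * f0 + h11 * f1))).
      by move: (b i k) (b i 0) (b i 1) => b2 b0 b1; ring.
    by rewrite E0 E1; case: (ord2P k) => ->; rewrite ?eqxx/=; ring.
  apply/eqP; rewrite -subr_eq0; apply/eqP.
  move: (Nvec Y u) F xN DN nd {nn yn na nb} => N F xN DN nd.
  apply: (light_frame_zero F xy xN (xt 0) (xt 1) xx) => //.
  - by rewrite scalBl D0 scal_suml big1 ?subr0// => j _; rewrite scalZl yd mulr0.
  - by rewrite scalBl DN scal_suml big1 ?subr0// => j _; rewrite scalZl nd mulr0.
  - by rewrite scalBl Dx scal_suml big1 ?subr0// => j _; rewrite scalZl xd mulr0.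
(* The trace is the pairing of [xi] with the Laplacian, which is a combination of [Nvec Y] and
   [Y]. *)
have tr0 : trace_coef Y (xi u) u = 0.
  rewrite -(laplacian_coef oW sY Yp Wu xt) scalC.
  move: xN; rewrite /Nvec; move: (laplacian _ _ _) => L.
  rewrite !scalE xy; lra.
have b10 : b 1 0 = b 0 1 by rewrite /b /second_coef (pder_sym oW 1 0 Wu sY).
have [h00 h01 h10 h11] := invmx2 (first_form_unit Yp Wu).
have [g0 gd] := first_form_minors Yp Wu.
have gdE : \det (first_form Y u) = first_form Y u 0 0 * first_form Y u 1 1 - first_form Y u 0 1 ^+ 2.
  by rewrite det2 (first_form_sym _ _ 1 0) expr2.
have cf : `|conformal_factor Y u| = 1.
  have := Yc u Wu => /matrixP/(_ 0 0); rewrite mxE => /(congr1 (fun z => z / first_form Y u 0 0)).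
  by rewrite mulfK ?gt_eqF// divff ?gt_eqF.
have cE := conformal_factorE oW sY Yl Yp Wu xy xt xx.
rewrite tr0 -!/(b _ _) in cE.
exists S; split => //.
  rewrite !SEij /H h00 h01 h10 h11 (first_form_sym _ _ 1 0) b10.
  move: tr0; rewrite /trace_coef -!/(b _ _) => tr0; rewrite -[RHS]oppr0 -tr0; ring.
(* The normalisation fixes the determinant only up to sign; this resolves the absolute value in
   [cf]. *)
have bd : b 0 0 * b 1 1 - b 0 1 ^+ 2 <= 0.
  apply: (trace_free_det (g1 := first_form Y u 0 1) (g2 := first_form Y u 1 1) g0); first by rewrite -gdE; exact: gd.
  move: tr0; rewrite /trace_coef -!/(b _ _) => /eqP.
  by rewrite mulf_eq0 invr_eq0 (gt_eqF gd) orbF => /eqP.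
have bE : b 0 0 * b 1 1 - b 0 1 ^+ 2 = - (\det (first_form Y u) / 4).
  have dinv : 0 < (\det (first_form Y u))^-1 by rewrite invr_gt0.
  have d0 := lt0r_neq0 gd.
  move: cf; rewrite cE expr0n subr0 ler0_norm; last first.
    by rewrite -mulrA pmulr_rle0// pmulr_lle0.
  move=> /(congr1 (fun z => z * \det (first_form Y u))).
  rewrite mulNr mulfVK// mul1r; lra.
rewrite det2 !SEij /H h00 h01 h10 h11 (first_form_sym _ _ 1 0) b10.
have d0 := lt0r_neq0 gd.
transitivity ((b 0 0 * b 1 1 - b 0 1 ^+ 2) * (\det (first_form Y u) / \det (first_form Y u) ^+ 2)); last first.
  by rewrite bE; field.
move: gdE d0.
move: (b 0 0) (b 0 1) (b 1 1) (\det _) (first_form Y u 0 0) (first_form Y u 0 1) (first_form Y u 1 1).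
move=> b0 b1 b2 d f0 f1 f2 E d0.
transitivity ((b0 * b2 - b1 ^+ 2) * ((f0 * f2 - f1 ^+ 2) / d ^+ 2)); last by rewrite -E.
by field.
Qed.

End OsculatingPairs.

Section CanonicalLift.
Variables (R : realType) (M : topologicalType) (A : set (chart R M)) (x : M -> set 'rV[R]_5).

Lemma local_lift_subset c W W' y : open W' -> W' `<=` W -> local_lift A x c W y ->
  local_lift A x c W' y.
Proof.
move=> oW' W'W [Ac oW Wc sy yl]; split => //.
- exact: subset_trans Wc.
- exact: smooth_subset sy.
- by move=> u /W'W/yl.
Qed.

Lemma line_scale (X : 'rV[R]_5) a : a != 0 -> line (a *: X) = line X.
Proof.
move=> a0; apply/seteqP; split => Z [b b0 ->].
  by exists (b * a); rewrite ?mulf_neq0// scalerA.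
by exists (b / a); rewrite ?mulf_neq0 ?invr_eq0// scalerA divfK.
Qed.

(** The expression through [b] avoids differentiating Christoffel symbols in the scalar
    curvature. *)
Lemma smooth_conformal_factor W y xi : open W -> smooth_on W y -> smooth_on W xi ->
  (forall u, W u -> scal 2 (y u) (y u) = 0) -> (forall u, W u -> pos_def (first_form y u)) ->
  (forall u, W u ->
    [/\ scal 2 (xi u) (xi u) = -1, scal 2 (xi u) (y u) = 0,
        scal 2 (xi u) (Nvec y u) = 0 & forall i, scal 2 (xi u) (pder i y u) = 0]) ->
  smooth_on W (conformal_factor y : 'rV[R]_2 -> R).
Proof.
move=> oW sy sx yl yp xn.
have sb i j : smooth_on W (fun u => second_coef y (xi u) i j u).
  by apply: smooth_scal => //; do 2!apply: smooth_pder.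
have sg i j := smooth_first_form oW sy i j.
have sd : smooth_on W (fun u => \det (first_form y u)).
  by move=> k; apply: Ck_det => // i j; exact: sg.
have sdi : smooth_on W (fun u => (\det (first_form y u))^-1).
  by apply: smoothV => // u Wu; have [_ d0] := first_form_minors yp Wu; rewrite gt_eqF.
have st : smooth_on W (fun u => trace_coef y (xi u) u).
  apply: smoothM => //; apply: smoothD => //; last exact: smoothM.
  apply: smoothB => //; first exact: smoothM.
  by apply: smoothM => //; apply: smoothM => //; exact: smooth_cst.
apply: (@smooth_ext _ _ _ _ (fun u =>
   4 * (second_coef y (xi u) 0 0 u * second_coef y (xi u) 1 1 u - second_coef y (xi u) 0 1 u * second_coef y (xi u) 0 1 u)
     / \det (first_form y u) - trace_coef y (xi u) u * trace_coef y (xi u) u)) => //.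
  move=> u Wu; have [xx xy _ xt] := xn u Wu.
  by rewrite (conformal_factorE oW sy yl yp Wu xy xt xx) !expr2.
apply: smoothB => //; last exact: smoothM.
apply: smoothM => //; apply: smoothM => //; first exact: smooth_cst.
by apply: smoothB => //; exact: smoothM.
Qed.

Lemma exists_osc_pair : space_like_conformal_surface A x -> forall p,
  exists c W Y xi, [/\ local_lift A x c W Y, chart_dom c p, W (chart_map c p) & osc_pair W Y xi].
Proof.
move=> [[[_ xl] _] xsp xreg xphi] p.
have [c [W [y [yL cp Wp]]]] := xl p; exists c.
have [Ac oW Wc sy yl0] := yL.
have yl u : W u -> scal 2 (y u) (y u) = 0 by move=> /yl0[[]].
have yp u : W u -> pos_def (first_form y u) by exact: xsp yL u.
have [W1 [xi0 [oW1 W1p W1W sx0 xn0]]] := local_normal oW sy yl yp Wp.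
have sy1 := smooth_subset W1W sy.
have yl1 u : W1 u -> _ := fun h => yl u (W1W u h).
have yp1 u : W1 u -> _ := fun h => yp u (W1W u h).
have sf := smooth_conformal_factor oW1 sy1 sx0 yl1 yp1 xn0.
have f0 u : W1 u -> conformal_factor y u != 0.
  move=> W1u; apply/eqP => E; have := xreg _ _ _ yL u (W1W _ W1u).
  by rewrite /conformal_metric E normr0 scale0r unitmxE det2 !mxE mul0r subrr unitr0.
have f2 u : W1 u -> 0 < conformal_factor y u * conformal_factor y u.
  by move=> /f0 h; rewrite -expr2 exprn_even_gt0.
(* The lift is canonical when the square of [mu] is the absolute value of the factor; writing that
   absolute value as the root of a square makes it smooth where the factor is nonzero. *)
pose mu u := Num.sqrt (Num.sqrt (conformal_factor y u * conformal_factor y u)).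
have mu0 u : W1 u -> 0 < mu u by move=> /f2 h; rewrite !sqrtr_gt0.
have smu : smooth_on W1 mu.
  apply: smooth_sqrt => //; first by move=> u /f2 h; rewrite sqrtr_gt0.
  by apply: smooth_sqrt => //; exact: smoothM.
have mu2 u : W1 u -> mu u ^+ 2 = `|conformal_factor y u|.
  by move=> _; rewrite sqr_sqrtr ?sqrtr_ge0// -expr2 sqrtr_sqr.
pose Y u := mu u *: y u.
have sY : smooth_on W1 Y by exact: smooth_scale.
have Yl u : W1 u -> scal 2 (Y u) (Y u) = 0 by exact: rescaled_light.
have Yp u : W1 u -> pos_def (first_form Y u) by exact: rescaled_pos.
have YL : local_lift A x c W1 Y.
  split => //; first exact: subset_trans Wc.
  move=> u W1u; have [[_ y0] xE] := yl0 u (W1W _ W1u); split.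
    by split; [exact: Yl|rewrite scaler_eq0 negb_or y0 andbT gt_eqF ?mu0].
  by rewrite xE line_scale// gt_eqF// mu0.
have Yc u : W1 u -> conformal_metric Y u = first_form Y u.
  move=> W1u; have [xx xy _ xt] := xn0 u W1u.
  rewrite /conformal_metric (conformal_factor_rescaled oW1 sy1 smu yl1 yp1 mu0 W1u xy xt xx).
  rewrite normrM normfV mu2// normr_id divff ?scale1r// normr_eq0; exact: f0.
(* Rescaling has changed [Nvec], so a second normal is taken, orthogonal to [Nvec Y]. *)
have [W2 [xi [oW2 W2p W21 sx xn]]] := local_normal oW1 sY Yl Yp W1p.
have YL2 := local_lift_subset oW2 W21 YL.
exists W2, Y, xi; split => //.
apply: osc_pair_of_canonical => //.
- exact: smooth_subset sY.
- by move=> u /W21/Yl.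
- by move=> u /W21/Yp.
- by move=> u /W21/Yc.
- move=> u i W2u; have [xx xy xN xt] := xn u W2u.
  have CL : canonical_lift A x c W2 Y by split => // v /W21/Yc.
  have UN : unit_normal W2 Y xi.
    split => // v /xn[vx vy vN vt]; split => //; first by right.
    by move=> k; rewrite pd_pder.
  have := xphi _ _ _ _ CL UN u (delta_mx 0 i) W2u.
  rewrite /conformal_form (bigD1 i)//= big1 ?addr0; last first.
    by move=> k ki; rewrite mxE eqxx (negPf ki) mulr0.
  rewrite mxE !eqxx mulr1 => /eqP; rewrite scaler_eq0 => /orP[|/eqP x0]; last first.
    by move: xx; rewrite x0 scal0l => /eqP; rewrite eq_sym oppr_eq0 oner_eq0.
  by rewrite /conformal_coef pd_pder xx mulN1r oppr_eq0 => /eqP.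
Qed.

End CanonicalLift.

(** * Separation of variables and the conic normal form *)

Section Separation.
Variable R : realType.

Lemma derive0_line n (f : 'rV[R]_2 -> 'rV[R]_n) (a v : 'rV[R]_2) :
  (forall t : R, 0 <= t <= 1 -> differentiable f (t *: v + a)) ->
  (forall t : R, 0 <= t <= 1 -> 'D_v f (t *: v + a) = 0) -> f (v + a) = f a.
Proof.
move=> df Df; apply/rowP => j.
have [t t01 E] : exists2 c : R, 0 <= c <= 1 & f (v + a) 0 j - f a 0 j =
    'D_v (fun u => f u 0 j) (c *: v + a).
  by apply: (@MVT_line R _ (fun u => f u 0 j)) => t t01; apply: differentiable_rV; exact: df.
apply/eqP; rewrite -subr_eq0 E derive_coord; last exact/diff_derivable/df.
by rewrite Df// mxE.
Qed.

(** Balls of the maximum norm are cubes; this lets coordinates of two points of a ball be mixed. *)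
Lemma ball0P n (z : 'rV[R]_n) d : 0 < d -> ball 0 d z <-> forall j, `|z 0 j| < d.
Proof.
move=> d0; rewrite -ball_normE/= sub0r normrN; split=> [H j|H].
  by apply: le_lt_trans H; exact: coord_le_norm.
rewrite /Num.Def.normr/= mx_normrE; apply: bigmax_lt => // -[i j] _ /=.
by rewrite ord1.
Qed.

Definition pair_row (a b : R) : 'rV[R]_2 := \row_(j < 2) (if j == 0 then a else b).

Lemma pair_row0 a b : pair_row a b 0 0 = a. Proof. by rewrite mxE. Qed.
Lemma pair_row1 a b : pair_row a b 0 1 = b. Proof. by rewrite mxE. Qed.
Lemma pair_rowE (z : 'rV[R]_2) : z = pair_row (z 0 0) (z 0 1).
Proof. by apply/rowP => j; case: (ord2P j) => ->; rewrite ?pair_row0 ?pair_row1. Qed.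

Lemma shift0E (z : 'rV[R]_2) r : (r *: delta_mx 0 0 + z) 0 0 = r + z 0 0 /\
  (r *: delta_mx 0 0 + z) 0 1 = z 0 1.
Proof. by rewrite !mxE /=; split; ring. Qed.

Lemma shift1E (z : 'rV[R]_2) r : (r *: delta_mx 0 1 + z) 0 0 = z 0 0 /\
  (r *: delta_mx 0 1 + z) 0 1 = r + z 0 1.
Proof. by rewrite !mxE /=; split; ring. Qed.

Lemma pair_row_shift0 (z : 'rV[R]_2) a :
  pair_row a (z 0 1) = (a - z 0 0) *: delta_mx 0 0 + z.
Proof.
have [e0 e1] := shift0E z (a - z 0 0).
by rewrite [RHS]pair_rowE e0 e1 subrK.
Qed.

Lemma pair_row_shift1 (z : 'rV[R]_2) b :
  pair_row (z 0 0) b = (b - z 0 1) *: delta_mx 0 1 + z.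
Proof.
have [e0 e1] := shift1E z (b - z 0 1).
by rewrite [RHS]pair_rowE e0 e1 subrK.
Qed.

(** The differential has rank at most one: any two directional derivatives are proportional, with
    coefficients measured by an arbitrary functional <., e>. *)
Definition rank1_at n (P : 'rV[R]_2 -> 'rV[R]_n) u := forall v w (e : 'rV[R]_n),
  scal 2 ('D_w P u) e *: 'D_v P u = scal 2 ('D_v P u) e *: 'D_w P u.

Lemma rank1_eq0 n (a b e : 'rV[R]_n) : scal 2 b e *: a = scal 2 a e *: b ->
  scal 2 a e = 0 -> scal 2 b e != 0 -> a = 0.
Proof.
move=> E a0 b0; move: E; rewrite a0 scale0r => /eqP.
by rewrite scaler_eq0 (negPf b0) => /eqP.
Qed.

Variables (n : nat) (W : set 'rV[R]_2) (P Q : 'rV[R]_2 -> 'rV[R]_n).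
Hypotheses (oW : open W) (sP : smooth_on W P) (sQ : smooth_on W Q).
Hypothesis rP : forall u, W u -> rank1_at P u.
Hypothesis rQ : forall u, W u -> rank1_at Q u.
Variable c : R.
Hypothesis PQ : forall u, W u -> scal 2 (P u) (Q u) = c.
Variables (u0 w1 w2 : 'rV[R]_2) (E1 E2 : 'rV[R]_n).
Hypothesis Wu0 : W u0.
Hypothesis P1 : scal 2 ('D_w1 P u0) E1 != 0.
Hypothesis Q2 : scal 2 ('D_w2 Q u0) E2 != 0.
Hypothesis imm : forall v, 'D_v P u0 = 0 -> 'D_v Q u0 = 0 -> v = 0.
Hypotheses (PE1 : scal 2 (P u0) E1 = 0) (QE2 : scal 2 (Q u0) E2 = 0).

(** The sign is chosen for Y = P - Q: once [P] is orthogonal to [E2] and [Q] to [E1], these are the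
    pairings of [Y] with [E1] and [E2]. *)
Let F u := pair_row (scal 2 (P u) E1) (- scal 2 (Q u) E2).

Lemma smooth_pair_row (f g : 'rV[R]_2 -> R) : smooth_on W f -> smooth_on W g ->
  smooth_on W (fun u => pair_row (f u) (g u)).
Proof.
move=> sf sg k; apply/(Ck_rVP _ _ oW) => j; case: (ord2P j) => ->.
  by apply: (Ck_ext oW _ (sf k)) => u _; rewrite pair_row0.
by apply: (Ck_ext oW _ (sg k)) => u _; rewrite pair_row1.
Qed.

Lemma smooth_scal_cst (f : 'rV[R]_2 -> 'rV[R]_n) e : smooth_on W f ->
  smooth_on W (fun u => scal 2 (f u) e).
Proof. by move=> sf; apply: smooth_scal => //; exact: smooth_cst. Qed.

Lemma derive_scal_cst (f : 'rV[R]_2 -> 'rV[R]_n) e u v : differentiable f u ->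
  'D_v (fun u => scal 2 (f u) e) u = scal 2 ('D_v f u) e.
Proof.
move=> df; have dc := differentiable_cst e u; rewrite (derive_scal _ _ df dc).
by rewrite derive_cst scal0r addr0.
Qed.

Lemma smooth_pair_map : smooth_on W F.
Proof.
apply: smooth_pair_row; first exact: smooth_scal_cst.
by apply: smoothN => //; exact: smooth_scal_cst.
Qed.

Lemma derive_pair_map u v : W u -> 'D_v F u 0 0 = scal 2 ('D_v P u) E1 /\
  'D_v F u 0 1 = - scal 2 ('D_v Q u) E2.
Proof.
move=> Wu; have dF : derivable F u v by exact: smooth_derivable smooth_pair_map Wu.
have dP := smooth_diff sP Wu; have dQ := smooth_diff sQ Wu.
split; rewrite -derive_coord//.
  have -> : (fun u => F u 0 0) = (fun u => scal 2 (P u) E1).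
    by apply/funext => x; rewrite pair_row0.
  exact: derive_scal_cst.
have -> : (fun u => F u 0 1) = - (fun u => scal 2 (Q u) E2).
  by apply/funext => x; rewrite pair_row1.
rewrite deriveN ?derive_scal_cst//.
exact: (smooth_derivable (smooth_scal_cst E2 sQ) Wu).
Qed.

(** A vector killed by the differential of [F] is killed by those of [P] and [Q], since each has
    rank one and is detected by [E1] or [E2]; so [F] is a local chart. In it [P] depends on the
    first coordinate only and [Q] on the second only. *)
Lemma separation : exists (V : set 'rV[R]_2) (d : R) (g : 'rV[R]_2 -> 'rV[R]_2),
  [/\ [/\ open V, V u0, V `<=` W & 0 < d],
    forall u, V u -> ball 0 d (F u) /\ g (F u) = u,
    forall z, ball 0 d z -> V (g z) /\ F (g z) = z,
    smooth_on (ball 0 d) g &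
    forall u u', V u -> V u' -> scal 2 (P u) (Q u') = c].
Proof.
have inj v : 'D_v F u0 = 0 -> v = 0.
  move=> /rowP E; have [F0 F1] := derive_pair_map v Wu0.
  apply: imm.
    apply: rank1_eq0 (rP Wu0 v w1 E1) _ P1.
    by apply: etrans (esym F0) _; rewrite E mxE.
  apply: rank1_eq0 (rQ Wu0 v w2 E2) _ Q2.
  by apply: oppr_inj; rewrite oppr0; apply: etrans (esym F1) _; rewrite E mxE.
have F0 : F u0 = 0.
  by apply/rowP => j; rewrite /F PE1 QE2 oppr0; case: (ord2P j) => ->; rewrite ?pair_row0 ?pair_row1 mxE.
have [V [d [g [[oV Vu0 VW d0] HF Hg sg _]]]] := inverse_function oW Wu0 smooth_pair_map inj.
rewrite F0 in HF Hg sg.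
exists V, d, g; split => // u u' Vu Vu'.
pose B := ball (0 : 'rV[R]_2) d.
have dg z : B z -> differentiable g z by exact: smooth_diff sg.
have Wg z : B z -> W (g z) by move=> /Hg[/VW].
have oB : open B by exact: ball_open.
have DFg z v : B z -> 'D_('D_v g z) F (g z) = v.
  move=> Bz; rewrite -(derive_comp _ (dg z Bz) (smooth_diff smooth_pair_map (Wg z Bz))).
  rewrite -[RHS](derive_id z v); apply: near_eq_derive.
  by apply: (open_near_eq oB Bz) => z' /Hg[].
have e10 : (delta_mx 0 0 : 'rV[R]_2) 0 0 = 1 by rewrite mxE.
have e11 : (delta_mx 0 0 : 'rV[R]_2) 0 1 = 0 by rewrite mxE.
have e20 : (delta_mx 0 1 : 'rV[R]_2) 0 0 = 0 by rewrite mxE.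
have e21 : (delta_mx 0 1 : 'rV[R]_2) 0 1 = 1 by rewrite mxE.
(* Moving along the second coordinate leaves <P, E1> fixed; rank one and a nonzero derivative along
   the first coordinate then make the derivative of [P] vanish. *)
have P2 z : B z -> 'D_(delta_mx 0 1) (P \o g) z = 0.
  move=> Bz; rewrite (derive_comp _ (dg z Bz) (smooth_diff sP (Wg z Bz))).
  set h := 'D__ g z.
  have := DFg z (delta_mx 0 1) Bz; have := DFg z (delta_mx 0 0) Bz; rewrite -/h.
  set k := 'D__ g z => Ek Eh.
  have [h0 _] := derive_pair_map h (Wg z Bz); have [k0 _] := derive_pair_map k (Wg z Bz).
  apply: rank1_eq0 (rP (Wg z Bz) h k E1) _ _.
    by apply: etrans (esym h0) _; rewrite Eh.
  have -> : scal 2 ('D_k P (g z)) E1 = 1 by apply: etrans (esym k0) _; rewrite Ek.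
  exact: oner_neq0.
have Q1 z : B z -> 'D_(delta_mx 0 0) (Q \o g) z = 0.
  move=> Bz; rewrite (derive_comp _ (dg z Bz) (smooth_diff sQ (Wg z Bz))).
  set k := 'D__ g z.
  have := DFg z (delta_mx 0 0) Bz; have := DFg z (delta_mx 0 1) Bz; rewrite -/k.
  set h := 'D__ g z => Eh Ek.
  have [_ h0] := derive_pair_map h (Wg z Bz); have [_ k0] := derive_pair_map k (Wg z Bz).
  apply: rank1_eq0 (rQ (Wg z Bz) k h E2) _ _.
    by apply: oppr_inj; rewrite oppr0; apply: etrans (esym k0) _; rewrite Ek.
  have -> : scal 2 ('D_h Q (g z)) E2 = -1.
    by apply: oppr_inj; rewrite opprK; apply: etrans (esym h0) _; rewrite Eh.
  by rewrite oppr_eq0 oner_eq0.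
have BP (z : 'rV[R]_2) : B z <-> `|z 0 0| < d /\ `|z 0 1| < d.
  split=> [/(ball0P _ d0) H//|[H0 H1]]; apply/ball0P => // j.
  by case: (ord2P j) => ->.
have conv (a b t : R) : `|a| < d -> `|b| < d -> 0 <= t <= 1 -> `|t * (b - a) + a| < d.
  rewrite !ltr_norml => /andP[a1 a2] /andP[b1 b2] /andP[t0 t1].
  have -> : t * (b - a) + a = t * b + (1 - t) * a by ring.
  move: t0; rewrite le_eqVlt => /predU1P[<-|t0]; first by rewrite mul0r add0r subr0 mul1r a1 a2.
  have q1 : 0 <= 1 - t by rewrite subr_ge0.
  have b2' : 0 < d - b by rewrite subr_gt0.
  have b1' : 0 < b + d by lra.
  have a2' : 0 <= d - a by rewrite subr_ge0 ltW.
  have a1' : 0 <= a + d by lra.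
  have := mulr_gt0 t0 b2'; have := mulr_gt0 t0 b1'.
  have := mulr_ge0 q1 a2'; have := mulr_ge0 q1 a1'.
  by move=> *; apply/andP; split; lra.
have [Fu Eu] := HF u Vu; have [Fu' Eu'] := HF u' Vu'.
have [s1 t1] := (BP _).1 Fu; have [s2 t2] := (BP _).1 Fu'.
set s := F u 0 0 in s1; set t := F u 0 1 in t1.
set s' := F u' 0 0 in s2; set t' := F u' 0 1 in t2.
(* The corner of the rectangle: it shares its value of [P] with [u] and its value of [Q] with
   [u']. *)
pose z := pair_row s t'.
have Bz : B z by apply/BP; rewrite pair_row0 pair_row1.
have dPg x : B x -> differentiable (P \o g) x.
  by move=> Bx; apply: differentiable_comp; [exact: dg|exact: smooth_diff sP (Wg x Bx)].
have dQg x : B x -> differentiable (Q \o g) x.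
  by move=> Bx; apply: differentiable_comp; [exact: dg|exact: smooth_diff sQ (Wg x Bx)].
have EP : P (g z) = P u.
  rewrite -[in RHS]Eu.
  have zE : z = (t' - t) *: delta_mx 0 1 + F u by exact: pair_row_shift1.
  have seg r : 0 <= r <= 1 -> B (r *: ((t' - t) *: delta_mx 0 1) + F u).
    move=> r01; apply/BP; rewrite scalerA; have [-> ->] := shift1E (F u) (r * (t' - t)).
    by split => //; exact: conv.
  rewrite zE; apply: (@derive0_line _ (P \o g)) => r r01; first exact/dPg/seg.
  rewrite deriveE; last exact/dPg/seg.
  by rewrite linearZ/= -deriveE ?P2 ?scaler0//; [exact: seg|exact/dPg/seg].
have EQ : Q (g z) = Q u'.
  rewrite -[in RHS]Eu'.
  have zE : z = (s - s') *: delta_mx 0 0 + F u' by exact: pair_row_shift0.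
  have seg r : 0 <= r <= 1 -> B (r *: ((s - s') *: delta_mx 0 0) + F u').
    move=> r01; apply/BP; rewrite scalerA; have [-> ->] := shift0E (F u') (r * (s - s')).
    by split => //; exact: conv.
  rewrite zE; apply: (@derive0_line _ (Q \o g)) => r r01; first exact/dQg/seg.
  rewrite deriveE; last exact/dQg/seg.
  by rewrite linearZ/= -deriveE ?Q1 ?scaler0//; [exact: seg|exact/dQg/seg].
by rewrite -EP -EQ; exact/PQ/Wg.
Qed.

End Separation.

(** * Conics cut out by a separated pair *)

Section ConicAlgebra.
Variable R : realType.
Implicit Types (y n a b xi p q : 'rV[R]_5).

(** Adding a multiple of [xi] to [n] achieves orthogonality to [xi]; the multiple of [y] restores
    nullity. *)
Lemma light_frame_adjust y n a b xi : light_frame y n a b ->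
  scal 2 xi y = 0 -> scal 2 xi a = 0 -> scal 2 xi b = 0 -> scal 2 xi xi = -1 ->
  exists2 m, light_frame y m a b & scal 2 xi m = 0.
Proof.
move=> [yy nn yn ya yb na nb aa dt] xy xa xb xx.
pose c := scal 2 n xi.
exists (n + c *: xi - (c ^+ 2 / 2) *: y); last first.
  by rewrite !scalE xy xx (scalC 2 xi n) -/c; ring.
have yx : scal 2 y xi = 0 by rewrite scalC.
split => //; rewrite !scalE.
- by rewrite nn xx xy yx yy (scalC 2 n y) yn (scalC 2 xi n) -/c; field.
- by rewrite yn yy yx; ring.
- by rewrite na xa ya; ring.
- by rewrite nb xb yb; ring.
Qed.

Record orthonormal_frame y n a b xi : Prop := OrthonormalFrame {
  of_light : light_frame y n a b;
  of_aa : scal 2 a a = 1; of_bb : scal 2 b b = 1; of_ab : scal 2 a b = 0;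
  of_xy : scal 2 xi y = 0; of_xn : scal 2 xi n = 0;
  of_xa : scal 2 xi a = 0; of_xb : scal 2 xi b = 0;
  of_xx : scal 2 xi xi = -1 }.

Lemma orthonormal_frame_swap y n a b xi :
  orthonormal_frame y n a b xi -> orthonormal_frame y n b a (- xi).
Proof.
move=> [[yy nn yn ya yb na nb aa dt] a1 b1 ab xy xn xa xb xx].
split; rewrite ?scalNl ?scalNr ?xy ?xn ?xa ?xb ?xx ?oppr0 ?opprK//; last by rewrite scalC.
split => //; first by rewrite b1.
by rewrite mulrC (scalC 2 b a).
Qed.

(** In the expansion of [conic_point] with c = - k t, the terms proportional to t add up to t times
    this vector taken at [k]. *)
Definition conic_vector n y xi (t : R) : 'rV[R]_5 := - n - t *: y + 2^-1 *: xi.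

(** Pairings read off the coefficients of [p] in the frame: the one along [b] vanishes, and the
    product -1 with xi - y/2 expresses the one along [xi] by t. The norm of [p] is the remaining
    quadratic equation. *)
Lemma conic_point y n a b xi p : orthonormal_frame y n a b xi ->
  scal 2 p b = 0 -> scal 2 p (xi - 2^-1 *: y) = -1 -> scal 2 p p = -1 ->
  let s := scal 2 p a in let t := - scal 2 p y in let c := scal 2 p n - 2^-1 in
  p = xi + 2^-1 *: y + s *: a - t *: n + c *: y + (t / 2) *: xi /\
  s ^+ 2 = 2 * t + 2 * t * c + t ^+ 2 / 4.
Proof.
move=> [F a1 b1 ab xy xn xa xb xx] pb pQ pp s t c.
have [yy nn yn ya yb na nb aa dt] := F.
have px : scal 2 p xi = -1 - t / 2.
  by move: pQ; rewrite !scalE /t; lra.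
have sy : scal 2 p y = - t by rewrite /t opprK.
have sn : scal 2 p n = c + 2^-1 by rewrite /c subrK.
have sa : scal 2 p a = s by [].
have pE : p = xi + 2^-1 *: y + s *: a - t *: n + c *: y + (t / 2) *: xi.
  apply/eqP; rewrite -subr_eq0; apply/eqP.
  have yx : scal 2 y xi = 0 by rewrite scalC.
  have nx : scal 2 n xi = 0 by rewrite scalC.
  have ny : scal 2 n y = 1 by rewrite scalC.
  have ay : scal 2 a y = 0 by rewrite scalC.
  have an : scal 2 a n = 0 by rewrite scalC.
  have ax : scal 2 a xi = 0 by rewrite scalC.
  apply: (light_frame_zero F xy xn xa xb xx);
    rewrite !(scalNl, scalDl, scalZl) ?sy ?sn ?sa ?pb ?px;
    rewrite ?xy ?xn ?xa ?xb ?xx ?yy ?nn ?yn ?ny ?ya ?ay ?na ?an ?yb ?nb ?a1 ?ab ?yx ?nx ?ax; by field.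
split => //.
have := pp; rewrite {2}pE !(scalNr, scalDr, scalZr) sy sn sa px => E.
by rewrite expr2; nra.
Qed.

Lemma conic_relation y n a b xi (s t c s' t' c' : R) : orthonormal_frame y n a b xi ->
  scal 2 (xi + 2^-1 *: y + s *: a - t *: n + c *: y + (t / 2) *: xi)
         (- xi + 2^-1 *: y + s' *: b - t' *: n + c' *: y + (t' / 2) *: (- xi)) = 1 ->
  t * c' + c * t' = t * t' / 4.
Proof.
move=> [[yy nn yn ya yb na nb aa dt] a1 b1 ab xy xn xa xb xx].
have yx : scal 2 y xi = 0 by rewrite scalC.
have nx : scal 2 n xi = 0 by rewrite scalC.
have ny : scal 2 n y = 1 by rewrite scalC.
have ay : scal 2 a y = 0 by rewrite scalC.
have an : scal 2 a n = 0 by rewrite scalC.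
have ax : scal 2 a xi = 0 by rewrite scalC.
rewrite !(scalNl, scalDl, scalZl) !(scalNr, scalDr, scalZr).
rewrite xy xn xb xx yy nn yn ny ay an yb nb ab yx nx ax => E; lra.
Qed.

(** The Gram matrix of the base point [y] and of two mutually orthogonal planes, spanned by [a], [z]
    and by [b], [w], which carry the two conics. *)
Record adapted (y a b z w : 'rV[R]_5) (l m : R) : Prop := Adapted {
  ad_yy : scal 2 y y = 0; ad_ya : scal 2 y a = 0; ad_yb : scal 2 y b = 0;
  ad_yz : scal 2 y z = -1; ad_yw : scal 2 y w = -1;
  ad_aa : scal 2 a a = 1; ad_bb : scal 2 b b = 1; ad_ab : scal 2 a b = 0;
  ad_az : scal 2 a z = 0; ad_aw : scal 2 a w = 0;
  ad_bz : scal 2 b z = 0; ad_bw : scal 2 b w = 0;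
  ad_zz : scal 2 z z = - l; ad_ww : scal 2 w w = - m; ad_zw : scal 2 z w = 0;
  ad_sum : l + m = 1 }.

(** The product of the two conic vectors is s + t + 1/4, so the hypothesis says exactly that the two
    planes are orthogonal; it also gives l + m = 1. *)
Lemma conic_adapted y n a b xi (s t : R) : orthonormal_frame y n a b xi ->
  s + t = - 4^-1 ->
  adapted y a b (conic_vector n y xi s) (conic_vector n y (- xi) t)
    (4^-1 - 2 * s) (4^-1 - 2 * t).
Proof.
move=> [[yy nn yn ya yb na nb aa dt] a1 b1 ab xy xn xa xb xx] st.
have yx : scal 2 y xi = 0 by rewrite scalC.
have nx : scal 2 n xi = 0 by rewrite scalC.
have ny : scal 2 n y = 1 by rewrite scalC.
have ay : scal 2 a y = 0 by rewrite scalC.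
have an : scal 2 a n = 0 by rewrite scalC.
have ax : scal 2 a xi = 0 by rewrite scalC.
have by' : scal 2 b y = 0 by rewrite scalC.
have bn : scal 2 b n = 0 by rewrite scalC.
have bx : scal 2 b xi = 0 by rewrite scalC.
split => //; rewrite /conic_vector ?(scalNl, scalDl, scalZl) ?(scalNr, scalDr, scalZr);
  rewrite ?xy ?xn ?xa ?xb ?xx ?yy ?nn ?yn ?ny ?ya ?ay ?na ?an ?yb ?nb ?a1 ?ab ?yx ?nx ?ax ?by' ?bn ?bx; lra.
Qed.

End ConicAlgebra.

Lemma quadratic2 (R : realType) (M : 'M[R]_2) (v : 'rV[R]_2) : (v *m M *m v^T) 0 0 =
  v 0 0 * (v 0 0 * M 0 0 + v 0 1 * M 1 0) + v 0 1 * (v 0 0 * M 0 1 + v 0 1 * M 1 1).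
Proof. by rewrite mxE big_ord2 !mxE !big_ord2; ring. Qed.

Lemma invr_sqrt_sqr (R : realType) (q : R) : 0 < q ->
  (Num.sqrt q)^-1 * ((Num.sqrt q)^-1 * q) = 1.
Proof.
move=> q0; have r0 : Num.sqrt q != 0 by rewrite gt_eqF// sqrtr_gt0.
have := sqr_sqrtr (ltW q0); move: (Num.sqrt q) r0 => r r0 <-; by field.
Qed.

(** Used with [a] and [b] the derivatives of [Y] and [xi] along a principal direction, to recover
    the eigenvalue equation for [xi] from that of the pencil. *)
Lemma half_left (R : realType) n (a b : 'rV[R]_n) : a = b + 2^-1 *: a -> b = 2^-1 *: a.
Proof. by move=> E; apply/rowP => j; have /rowP/(_ j) := E; rewrite !mxE; lra. Qed.

Lemma half_right (R : realType) n (a b : 'rV[R]_n) :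
  - a = b + (- 2^-1) *: a -> b = (- 2^-1) *: a.
Proof. by move=> E; apply/rowP => j; have /rowP/(_ j) := E; rewrite !mxE; lra. Qed.

Lemma eigenvectors_orthogonal (R : realType) (a b p q : 'rV[R]_5) :
  p = 2^-1 *: a -> q = (- 2^-1) *: b -> scal 2 p b = scal 2 q a -> scal 2 a b = 0.
Proof. by move=> -> ->; rewrite !scalZl (scalC 2 b a) => E; lra. Qed.

(** * The shape operator and its principal directions *)

Section ShapeOperator.
Variable R : realType.
Variables (W : set 'rV[R]_2) (Y xi : 'rV[R]_2 -> 'rV[R]_5).
Hypothesis O : osc_pair W Y xi.

Let oW := osc_open O.
Let sY := osc_smooth O.
Let sx := osc_normal_smooth O.

Definition pencil (e : R) u := xi u + e *: Y u.

Lemma derive_pder (f : 'rV[R]_2 -> 'rV[R]_5) u v : differentiable f u ->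
  'D_v f u = v 0 0 *: pder 0 f u + v 0 1 *: pder 1 f u.
Proof. by move=> df; rewrite derive_basis// big_ord2 !pderE. Qed.

Lemma smooth_pencil e : smooth_on W (pencil e).
Proof.
apply: smoothD => //; apply: smooth_scale => //; exact: smooth_cst.
Qed.

Lemma derive_pencil e u v : W u -> 'D_v (pencil e) u = 'D_v xi u + e *: 'D_v Y u.
Proof.
move=> Wu; have dY : derivable Y u v by exact: smooth_derivable sY Wu.
have dx : derivable xi u v by exact: smooth_derivable sx Wu.
have dZ : derivable (e *: Y) u v by exact: derivableZ.
by rewrite -(deriveZ e dY) -(deriveD dx dZ).
Qed.

Lemma shape_exists u : W u -> exists S : 'M[R]_2, [/\ S 0 0 + S 1 1 = 0, \det S = - 4^-1 &
  forall e v, 'D_v (pencil e) u = 'D_(v *m (S + e%:M)) Y u].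
Proof.
move=> Wu; have [_ _ _ _ [S [tS dS HS]]] := osc_on O Wu; exists S; split => // e v.
have dY := smooth_diff sY Wu; have dx := smooth_diff sx Wu.
rewrite derive_pencil// !derive_pder// !HS !big_ord2 !mxE !big_ord2 !mxE !eqxx /=.
rewrite !mulr1n !mulr0n; move: (pder 0 Y u) (pder 1 Y u) => a b.
by apply/rowP => j; rewrite !mxE; ring.
Qed.

(** The differential of the pencil is [dY] after S + e, whose determinant det S + e tr S + e^2 = e^2
    - 1/4 vanishes. *)
Lemma pencil_rank1 e u : W u -> e ^+ 2 = 4^-1 -> rank1_at (pencil e) u.
Proof.
move=> Wu e2 v w f; have [S [tS dS HS]] := shape_exists Wu.
have dY := smooth_diff sY Wu.
rewrite !HS !derive_pder//; set a := v *m _; set b := w *m _.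
have ab : a 0 0 * b 0 1 - a 0 1 * b 0 0 = 0.
  transitivity (\det (S + e%:M) * (v 0 0 * w 0 1 - v 0 1 * w 0 0)).
    by rewrite det2 /a /b !mxE !big_ord2 !mxE !eqxx /= !mulr1n !mulr0n; ring.
  have -> : \det (S + e%:M) = \det S + e * (S 0 0 + S 1 1) + e ^+ 2.
    by rewrite !det2 !mxE !eqxx /= !mulr1n !mulr0n; ring.
  by rewrite tS dS e2; ring.
move: (pder 0 Y u) (pder 1 Y u) (a 0 0) (a 0 1) (b 0 0) (b 0 1) ab => X0 X1 a0 a1 b0 b1 ab.
rewrite !(scalDl, scalZl); move: (scal 2 X0 f) (scal 2 X1 f) => s0 s1.
apply/eqP; rewrite -subr_eq0; apply/eqP.
transitivity ((s1 * (a0 * b1 - a1 * b0)) *: X0 - (s0 * (a0 * b1 - a1 * b0)) *: X1).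
  by apply/rowP => j; rewrite !mxE; ring.
by rewrite ab !mulr0 !scale0r subrr.
Qed.

Lemma osc_injective u v : W u -> 'D_v Y u = 0 -> v = 0.
Proof.
move=> Wu; have [_ _ _ pY _] := osc_on O Wu; rewrite derive_pder; last exact: smooth_diff sY Wu.
have [g0 gd] := pos_def_minors (first_form_sym Y u 0 1) pY.
move=> E.
have [] := @form_kernel R (first_form Y u 0 0) (first_form Y u 0 1) (first_form Y u 1 1) (v 0 0) (v 0 1).
- by move: gd; rewrite det2 (first_form_sym _ _ 1 0) expr2.
- rewrite !first_formE (scalC 2 (pder 0 Y u) (pder 1 Y u)) -!scalZl -scalDl E scal0l; done.
- by rewrite !first_formE -!scalZl -scalDl E scal0l.
by move=> v0 v1; apply/rowP => j; rewrite mxE; case: (ord2P j) => ->.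
Qed.

Lemma osc_values u : W u -> [/\ scal 2 (pencil 2^-1 u) (pencil 2^-1 u) = -1,
  scal 2 (pencil (- 2^-1) u) (pencil (- 2^-1) u) = -1 &
  scal 2 (pencil 2^-1 u) (pencil (- 2^-1) u) = -1].
Proof.
move=> /(osc_on O)[yy xx xy _ _]; rewrite /pencil !scalE (scalC 2 (Y u) (xi u)) yy xx xy.
by split; ring.
Qed.

Lemma osc_normal u v : W u -> scal 2 (Y u) ('D_v Y u) = 0 /\ scal 2 (xi u) ('D_v Y u) = 0.
Proof.
move=> Wu; have [_ _ _ _ [S [_ _ HS]]] := osc_on O Wu.
have Yt i : scal 2 (Y u) (pder i Y u) = 0.
  by apply: (lift_tangent oW sY) => // w /(osc_on O)[].
have xt i : scal 2 (xi u) (pder i Y u) = 0.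
  have : pder i (fun w => scal 2 (xi w) (Y w)) u = pder i (fun=> 0 : R) u.
    by apply: (pder_ext oW i Wu) => w /(osc_on O)[].
  rewrite (pder_scal _ _ Wu sx sY) [RHS]pderE derive_cst HS scal_suml big1 ?add0r// => j _.
  by rewrite scalZl scalC Yt mulr0.
rewrite derive_pder; last exact: smooth_diff sY Wu.
by rewrite !(scalDr, scalZr) !Yt !xt !mulr0 addr0.
Qed.

Lemma shape_symmetric u v w : W u -> scal 2 ('D_v xi u) ('D_w Y u) = scal 2 ('D_w xi u) ('D_v Y u).
Proof.
move=> Wu.
have xt i w' : W w' -> scal 2 (xi w') (pder i Y w') = 0.
  by move=> Ww; have [_] := osc_normal (delta_mx 0 i) Ww; rewrite pderE.
have E i j : scal 2 (pder i xi u) (pder j Y u) = - scal 2 (xi u) (pder i (pder j Y) u).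
  have : pder i (fun w => scal 2 (xi w) (pder j Y w)) u = pder i (fun=> 0 : R) u.
    by apply: (pder_ext oW i Wu) => w' /xt.
  rewrite (pder_scal _ _ Wu sx (smooth_pder j sY)) [RHS]pderE derive_cst => /eqP.
  by rewrite addr_eq0 => /eqP.
rewrite !derive_pder; [|exact: smooth_diff sY Wu|exact: smooth_diff sx Wu|exact: smooth_diff sY Wu|exact: smooth_diff sx Wu].
rewrite !(scalDl, scalZl) !(scalDr, scalZr) !E (pder_sym oW 1 0 Wu sY).
by move: (scal 2 _ _) (scal 2 _ _) (scal 2 _ _) => r0 r1 r2; ring.
Qed.

(** Eigenvectors of [S] for 1/2 and -1/2, normalised in the metric. They are orthogonal by symmetry
    of the shape operator, and adding plus or minus 1/2 to the eigenvalue gives 1 or -1. *)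
Lemma principal_directions u : W u -> exists w1 w2,
  [/\ scal 2 ('D_w1 Y u) ('D_w1 Y u) = 1, scal 2 ('D_w2 Y u) ('D_w2 Y u) = 1,
      scal 2 ('D_w1 Y u) ('D_w2 Y u) = 0,
      'D_w1 (pencil 2^-1) u = 'D_w1 Y u & 'D_w2 (pencil (- 2^-1)) u = - 'D_w2 Y u].
Proof.
move=> Wu; have [S [tS dS HS]] := shape_exists Wu.
have dY := smooth_diff sY Wu.
have detE e : \det (S + e%:M) = \det S + e * (S 0 0 + S 1 1) + e ^+ 2.
  by rewrite !det2 !mxE !eqxx /= !mulr1n !mulr0n; ring.
have eig e : e ^+ 2 = 4^-1 -> exists2 w, scal 2 ('D_w Y u) ('D_w Y u) = 1 & w *m S = e *: w.
  move=> e2; have /eqP/det0P[v v0 Ev] : \det (S + (- e)%:M) = 0.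
    by rewrite detE tS dS sqrrN e2; ring.
  have vS : v *m S = e *: v.
    apply/eqP; rewrite -subr_eq0 -Ev mulmxDr mul_mx_scalar scaleNr.
    by [].
  have q0 : 0 < scal 2 ('D_v Y u) ('D_v Y u).
    have [_ _ _ pY _] := osc_on O Wu; have := pY v v0.
    rewrite quadratic2 !first_formE derive_pder// !(scalDl, scalZl) !(scalDr, scalZr).
    by congr (_ < _); move: (scal 2 _ _) (scal 2 _ _) (scal 2 _ _) (scal 2 _ _) => *; ring.
  exists ((Num.sqrt (scal 2 ('D_v Y u) ('D_v Y u)))^-1 *: v).
    have -> : 'D_((Num.sqrt (scal 2 ('D_v Y u) ('D_v Y u)))^-1 *: v) Y u =
       (Num.sqrt (scal 2 ('D_v Y u) ('D_v Y u)))^-1 *: 'D_v Y u.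
      by rewrite !deriveE// linearZ.
    by rewrite scalZl scalZr; exact: invr_sqrt_sqr.
  by rewrite -scalemxAl vS !scalerA mulrC.
have [w1 n1 E1] : exists2 w, scal 2 ('D_w Y u) ('D_w Y u) = 1 & w *m S = 2^-1 *: w.
  by apply: eig; field.
have [w2 n2 E2] : exists2 w, scal 2 ('D_w Y u) ('D_w Y u) = 1 & w *m S = (- 2^-1) *: w.
  by apply: eig; field.
have DZ c v : 'D_(c *: v) Y u = c *: 'D_v Y u by rewrite !deriveE// linearZ.
have D1 : 'D_w1 (pencil 2^-1) u = 'D_w1 Y u.
  rewrite HS mulmxDr mul_mx_scalar E1 -scalerDl.
  by congr ('D__ Y u); rewrite -[RHS]scale1r; congr (_ *: _); field.
have D2 : 'D_w2 (pencil (- 2^-1)) u = - 'D_w2 Y u.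
  rewrite HS mulmxDr mul_mx_scalar E2 -scalerDl DZ -[RHS]scaleN1r.
  by congr (_ *: _); field.
exists w1, w2; split => //.
apply: eigenvectors_orthogonal (shape_symmetric w1 w2 Wu).
  apply: half_left; rewrite -{1}D1; exact: derive_pencil.
apply: half_right; rewrite -{1}D2; exact: derive_pencil.
Qed.

End ShapeOperator.

(** * Local normal form of the surface *)

Section NormalForm.
Variable R : realType.
Variables (W : set 'rV[R]_2) (Y xi : 'rV[R]_2 -> 'rV[R]_5).

Local Notation P := (pencil Y xi 2^-1).
Local Notation Q := (pencil Y xi (- 2^-1)).

(** Divided by t t', the hypothesis says that c/t + c'/t' = 1/4 with independent arguments, so both
    quotients are constant. Evaluating one argument at a point where t or t' is nonzero covers the
    zeros of the other. *)
Lemma conic_parameter (T : Type) (V : set T) (t c t' c' : T -> R) :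
  (forall u u', V u -> V u' -> t u * c' u' + c u * t' u' = t u * t' u' / 4) ->
  (exists2 u, V u & t u != 0) -> (exists2 u, V u & t' u != 0) ->
  exists a a', [/\ a + a' = - 4^-1, forall u, V u -> c u = - a * t u &
    forall u, V u -> c' u = - a' * t' u].
Proof.
move=> E [u1 V1 t1] [u2 V2 t2].
exists (c' u2 / t' u2 - 4^-1), (c u1 / t u1 - 4^-1); split.
- have := E _ _ V1 V2; move: (t u1) (c u1) (t' u2) (c' u2) t1 t2 => s d s' d' s0 s'0 E'.
  have -> : d' / s' = 4^-1 - d / s.
    have -> : d' / s' = (s * d' + d * s') / (s * s') - d / s by field; rewrite s0 s'0.
    by rewrite E'; field; rewrite s0 s'0.
  by ring.
- move=> u Vu; have := E _ _ Vu V2; move: (t u) (c u) (t' u2) (c' u2) t2 => s d s' d' s'0 E'.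
  apply: (mulIf s'0).
  have -> : d * s' = s * s' / 4 - s * d' by rewrite -E'; ring.
  by field.
- move=> u Vu; have := E _ _ V1 Vu; move: (t u1) (c u1) (t' u) (c' u) t1 => s d s' d' s0 E'.
  apply: (mulIf s0).
  have -> : d' * s = s * s' / 4 - d * s' by rewrite -E'; ring.
  by field.
Qed.

(** The conic parameters are t = - <P, Y0> and t' = <Q, Y0>. As 2 (1 + l t) is the derivative of 2 t
    + l t^2, [cc_Ppos] and [cc_Qpos] select the branch through the base point, on which s determines
    t. *)
Record conic_chart (u0 : 'rV[R]_2) (a b z w : 'rV[R]_5) (l m : R)
    (V : set 'rV[R]_2) (d : R) (g : 'rV[R]_2 -> 'rV[R]_2) : Prop := ConicChart {
  cc_adapted : adapted (Y u0) a b z w l m;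
  cc_open : open V; cc_base : V u0; cc_sub : V `<=` W; cc_pos : 0 < d;
  cc_smooth : smooth_on (ball 0 d) g;
  cc_in : forall u, V u -> ball 0 d (pair_row (scal 2 (Y u) a) (scal 2 (Y u) b)) /\
    g (pair_row (scal 2 (Y u) a) (scal 2 (Y u) b)) = u;
  cc_out : forall v, ball 0 d v ->
    V (g v) /\ pair_row (scal 2 (Y (g v)) a) (scal 2 (Y (g v)) b) = v;
  cc_P : forall u, V u -> P u = P u0 + scal 2 (Y u) a *: a - scal 2 (P u) (Y u0) *: z;
  cc_Q : forall u, V u -> - Q u = - Q u0 + scal 2 (Y u) b *: b + scal 2 (Q u) (Y u0) *: w;
  cc_Px : forall u, V u -> scal 2 (Y u) a ^+ 2 =
     - 2 * scal 2 (P u) (Y u0) + l * scal 2 (P u) (Y u0) ^+ 2;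
  cc_Qx : forall u, V u -> scal 2 (Y u) b ^+ 2 =
     2 * scal 2 (Q u) (Y u0) + m * scal 2 (Q u) (Y u0) ^+ 2;
  cc_Ppos : forall u, V u -> 0 < 1 - l * scal 2 (P u) (Y u0);
  cc_Qpos : forall u, V u -> 0 < 1 + m * scal 2 (Q u) (Y u0) }.

Hypothesis O : osc_pair W Y xi.

Theorem normal_form u0 : W u0 -> exists a b z w l m V d g,
  conic_chart u0 a b z w l m V d g.
Proof.
move=> Wu0.
have [w1 [w2 [n1 n2 n12 DP DQ]]] := principal_directions O Wu0.
have oW := osc_open O; have sY := osc_smooth O; have sx := osc_normal_smooth O.
have sP := smooth_pencil O 2^-1; have sQ := smooth_pencil O (- 2^-1).
have sq2 : (2^-1 : R) ^+ 2 = 4^-1 by field.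
have sq2' : (- 2^-1 : R) ^+ 2 = 4^-1 by field.
have rP u : W u -> rank1_at P u by move=> Wu; exact: (pencil_rank1 O Wu sq2).
have rQ u : W u -> rank1_at Q u by move=> Wu; exact: (pencil_rank1 O Wu sq2').
have PQ u : W u -> scal 2 (P u) (Q u) = -1 by move=> /(osc_values O)[].
have PP u : W u -> scal 2 (P u) (P u) = -1 by move=> /(osc_values O)[].
have QQ u : W u -> scal 2 (Q u) (Q u) = -1 by move=> /(osc_values O)[].
have imm v : 'D_v P u0 = 0 -> 'D_v Q u0 = 0 -> v = 0.
  rewrite !(derive_pencil O)// => E1 E2; apply: (osc_injective O Wu0).
  have -> : 'D_v Y u0 = ('D_v xi u0 + 2^-1 *: 'D_v Y u0) - ('D_v xi u0 + (- 2^-1) *: 'D_v Y u0).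
    by move: ('D_v xi u0) ('D_v Y u0) => p q; apply/rowP => j; rewrite !mxE; field.
  by rewrite E1 E2 subrr.
have [Ya xa] := osc_normal O w1 Wu0; have [Yb xb] := osc_normal O w2 Wu0.
set a := 'D_w1 Y u0 in n1 n12 DP Ya xa; set b := 'D_w2 Y u0 in n2 n12 DQ Yb xb.
have LF := Nvec_frame oW sY (fun u Wu => osc_light (osc_on O Wu)) (fun u Wu => osc_pos (osc_on O Wu)) Wu0.
have Nt v : scal 2 (Nvec Y u0) ('D_v Y u0) = 0.
  rewrite derive_pder; last exact: smooth_diff sY Wu0.
  by case: LF => _ nn _ _ _ na nb _ _; rewrite !(scalDr, scalZr) na nb !mulr0 addr0.
have Na : scal 2 (Nvec Y u0) a = 0 := Nt w1; have Nb : scal 2 (Nvec Y u0) b = 0 := Nt w2.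
clearbody a b.
have P1 : scal 2 ('D_w1 P u0) a != 0 by rewrite DP n1 oner_neq0.
have Q2 : scal 2 ('D_w2 Q u0) b != 0 by rewrite DQ scalNl n2 oppr_eq0 oner_neq0.
have PE1 : scal 2 (P u0) a = 0 by rewrite /pencil scalDl scalZl Ya xa mulr0 addr0.
have QE2 : scal 2 (Q u0) b = 0 by rewrite /pencil scalDl scalZl Yb xb mulr0 addr0.
have [V [d [g [[oV Vu0 VW d0] HF Hg sg sep]]]] :=
  separation oW sP sQ rP rQ PQ Wu0 P1 Q2 imm PE1 QE2.
have QP u u' : V u -> V u' -> scal 2 (Q u) (P u') = -1.
  by move=> Vu Vu'; rewrite scalC sep.
(* After separation one argument of <P, Q> = -1 can be frozen while the other is differentiated at
   [u0]; this makes [P] orthogonal to [b] and [Q] to [a] on all of [V]. *)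
have Dsep (f : 'rV[R]_2 -> 'rV[R]_5) p v : smooth_on W f ->
    (forall u, V u -> scal 2 (f u) p = -1) -> scal 2 ('D_v f u0) p = 0.
  move=> sf E; rewrite -derive_scal_cst; last exact: smooth_diff sf Wu0.
  rewrite -[RHS](derive_cst (-1 : R) u0 v); apply: near_eq_derive.
  exact: (open_near_eq oV Vu0 E).
have Pb u : V u -> scal 2 (P u) b = 0.
  move=> Vu; have := Dsep Q (P u) w2 sQ (fun u' Vu' => QP _ _ Vu' Vu).
  by rewrite DQ scalNl scalC => /eqP; rewrite oppr_eq0 => /eqP.
have Qa u : V u -> scal 2 (Q u) a = 0.
  move=> Vu; have := Dsep P (Q u) w1 sP (fun u' Vu' => sep _ _ Vu' Vu).
  by rewrite DP scalC.
have YPQ u : Y u = P u - Q u.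
  by rewrite /pencil; move: (Y u) (xi u) => p q; apply/rowP => j; rewrite !mxE; field.
have sa u : V u -> scal 2 (Y u) a = scal 2 (P u) a.
  by move=> Vu; rewrite {1}YPQ scalBl Qa// subr0.
have sb u : V u -> scal 2 (Y u) b = - scal 2 (Q u) b.
  by move=> Vu; rewrite {1}YPQ scalBl Pb// sub0r.
have [n OF] : exists n, orthonormal_frame (Y u0) n a b (xi u0).
  have [yy xx xy _ _] := osc_on O Wu0.
  have LF' : light_frame (Y u0) (Nvec Y u0) a b.
    by case: LF => _ nn yn _ _ _ _ _ _; split => //; rewrite n1 ?n2 ?n12 ?mulr1 ?expr0n ?subr0.
  have [n LFn xn] := light_frame_adjust LF' xy xa xb xx.
  by exists n; split.
have OF' := orthonormal_frame_swap OF.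
pose t u := - scal 2 (P u) (Y u0); pose c u := scal 2 (P u) n - 2^-1.
pose t' u := scal 2 (Q u) (Y u0); pose c' u := - scal 2 (Q u) n - 2^-1.
have CP u : V u -> P u = xi u0 + 2^-1 *: Y u0 + scal 2 (Y u) a *: a - t u *: n + c u *: Y u0 + (t u / 2) *: xi u0 /\
    scal 2 (Y u) a ^+ 2 = 2 * t u + 2 * t u * c u + t u ^+ 2 / 4.
  move=> Vu; rewrite sa//; apply: (conic_point OF); [exact: Pb| |exact/PP/VW].
  by rewrite -scaleNr; exact: sep.
have CQ u : V u -> - Q u = - xi u0 + 2^-1 *: Y u0 + scal 2 (Y u) b *: b - t' u *: n + c' u *: Y u0 + (t' u / 2) *: (- xi u0) /\
    scal 2 (Y u) b ^+ 2 = 2 * t' u + 2 * t' u * c' u + t' u ^+ 2 / 4.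
  move=> Vu; have := @conic_point _ _ _ _ _ _ (- Q u) OF'.
  rewrite /= !scalNl opprK sb//; apply.
  - by rewrite Qa// oppr0.
  - by rewrite -opprD scalNr opprK; exact: QP.
  - by rewrite scalNr opprK; exact/QQ/VW.
have rel u u' : V u -> V u' -> t u * c' u' + c u * t' u' = t u * t' u' / 4.
  move=> Vu Vu'; apply: (conic_relation (s := scal 2 (Y u) a) (s' := scal 2 (Y u') b) OF).
  by rewrite -(CP u Vu).1 -(CQ u' Vu').1 scalNr sep// opprK.
have HF' u : V u -> ball 0 d (pair_row (scal 2 (Y u) a) (scal 2 (Y u) b)) /\
    g (pair_row (scal 2 (Y u) a) (scal 2 (Y u) b)) = u.
  by move=> Vu; rewrite sa// sb//; exact: HF.
have Hg' v : ball 0 d v -> V (g v) /\ pair_row (scal 2 (Y (g v)) a) (scal 2 (Y (g v)) b) = v.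
  by move=> /Hg[Vg E]; rewrite sa// sb.
have d2 : `|d / 2| < d.
  by rewrite ger0_norm ?ltW ?divr_gt0// ltr_pdivrMr// mulr_natr mulr2n ltrDl.
have d20 : d / 2 != 0 by rewrite mulf_neq0 ?invr_eq0 ?gt_eqF.
(* The conic equation forces s = 0 wherever t = 0, but the chart attains s = d/2. *)
have t0 : exists2 u, V u & t u != 0.
  have Bz : ball 0 d (pair_row (d / 2) 0).
    by apply/(ball0P _ d0) => j; case: (ord2P j) => ->; rewrite ?pair_row0 ?pair_row1 ?normr0.
  have [Vg /rowP/(_ 0)] := Hg' _ Bz; rewrite !pair_row0 => E.
  exists (g (pair_row (d / 2) 0)) => //; apply/eqP => t0.
  have := (CP _ Vg).2; rewrite E t0 !mulr0 !mul0r expr0n mul0r !addr0 => /eqP.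
  by rewrite expf_eq0 (negPf d20).
have t'0 : exists2 u, V u & t' u != 0.
  have Bz : ball 0 d (pair_row 0 (d / 2)).
    by apply/(ball0P _ d0) => j; case: (ord2P j) => ->; rewrite ?pair_row0 ?pair_row1 ?normr0.
  have [Vg /rowP/(_ 1)] := Hg' _ Bz; rewrite !pair_row1 => E.
  exists (g (pair_row 0 (d / 2))) => //; apply/eqP => t0'.
  have := (CQ _ Vg).2; rewrite E t0' !mulr0 !mul0r expr0n mul0r !addr0 => /eqP.
  by rewrite expf_eq0 (negPf d20).
have [k [k' [kk kE kE']]] := conic_parameter rel t0 t'0.
have AD := conic_adapted OF kk.
pose l := 4^-1 - 2 * k; pose m := 4^-1 - 2 * k'.
have y0 : scal 2 (Y u0) (Y u0) = 0 by have [] := osc_on O Wu0.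
have xy0 : scal 2 (xi u0) (Y u0) = 0 by have [] := osc_on O Wu0.
have P00 : scal 2 (P u0) (Y u0) = 0 by rewrite /pencil !scalE y0 xy0 mulr0 addr0.
have Q00 : scal 2 (Q u0) (Y u0) = 0 by rewrite /pencil !scalE y0 xy0 mulr0 addr0.
have F0 : pair_row (scal 2 (Y u0) a) (scal 2 (Y u0) b) = 0.
  by rewrite Ya Yb; apply/rowP => j; case: (ord2P j) => ->; rewrite ?pair_row0 ?pair_row1 mxE.
have Bopen e : open (ball (0 : 'rV[R]_2) e) by exact: ball_open.
have B0 e : 0 < e -> ball (0 : 'rV[R]_2) e 0 by exact: ballxx.
have g0 : g 0 = u0 by have := (HF' u0 Vu0).2; rewrite F0.
(* Both expressions equal 1 at [u0], so the branch conditions hold on a smaller ball of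
   coordinates. *)
pose pos u := 0 < 1 - l * scal 2 (P u) (Y u0) /\ 0 < 1 + m * scal 2 (Q u) (Y u0).
have near_pos (f : 'rV[R]_2 -> R) : smooth_on W f -> 0 < f u0 -> \forall u \near u0, 0 < f u.
  move=> sf f0; have cf := smooth_cont sf Wu0.
  have : nbhs (f u0) [set r | 0 < r] by apply: open_nbhs_nbhs; split => //; exact: open_gt.
  by move=> /cf.
have posN : \forall u \near u0, pos u.
  have N1 : \forall u \near u0, 0 < 1 - l * scal 2 (P u) (Y u0).
    apply: (near_pos (fun u => 1 - l * scal 2 (P u) (Y u0))); last by rewrite P00 mulr0 subr0.
    apply: smoothB => //; first exact: smooth_cst.
    by apply: smoothM => //; [exact: smooth_cst|exact: smooth_scal_cst].
  have N2 : \forall u \near u0, 0 < 1 + m * scal 2 (Q u) (Y u0).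
    apply: (near_pos (fun u => 1 + m * scal 2 (Q u) (Y u0))); last by rewrite Q00 mulr0 addr0.
    apply: smoothD => //; first exact: smooth_cst.
    by apply: smoothM => //; [exact: smooth_cst|exact: smooth_scal_cst].
  exact: filterI N1 N2.
have /nbhs_ballP[e /= e0 He] : nbhs (0 : 'rV[R]_2) [set v | pos (g v)].
  have cg := smooth_cont sg (B0 _ d0).
  by apply: (cg pos); rewrite g0.
pose d1 := Num.min d e.
have d10 : 0 < d1 by rewrite lt_min d0.
have B1 (v : 'rV[R]_2) : ball 0 d1 v -> ball 0 d v by apply: le_ball; rewrite ge_min lexx.
have B2 (v : 'rV[R]_2) : ball 0 d1 v -> ball 0 e v by apply: le_ball; rewrite ge_min lexx orbT.
pose F' u := pair_row (scal 2 (Y u) a) (scal 2 (Y u) b).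
pose V' := V `&` F' @^-1` (ball 0 d1).
have sF' : smooth_on W F' by apply: smooth_pair_row => //; exact: smooth_scal_cst.
have V'V u : V' u -> V u by case.
have V'pos u : V' u -> pos u.
  by move=> [Vu /B2/He]; rewrite /= (HF' u Vu).2.
exists a, b, (conic_vector n (Y u0) (xi u0) k), (conic_vector n (Y u0) (- xi u0) k'), l, m, V', d1, g.
split => //.
- rewrite openE => u [Vu Fu]; apply: filterI; first exact: open_nbhs_nbhs.
  have cF := smooth_cont sF' (VW _ Vu).
  by apply: cF; exact: open_nbhs_nbhs.
- by split => //; rewrite /= /F' F0; exact: B0.
- by move=> u /V'V/VW.
- by apply: smooth_subset sg => v /B1.
- by move=> u [Vu Fu]; split => //; exact: (HF' u Vu).2.
- move=> v Bv; have [Vg E] := Hg' _ (B1 _ Bv); split => //; split => //.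
  by rewrite /= /F' E.
- move=> u /V'V Vu; have [E _] := CP u Vu; rewrite {1}E kE// /conic_vector /t /pencil.
  move: (scal 2 (Y u) _) => r.
  by apply/rowP => j; rewrite !mxE; field.
- move=> u /V'V Vu; have [E _] := CQ u Vu; rewrite {1}E kE'// /conic_vector /t' /pencil.
  move: (scal 2 (Y u) _) => r.
  by apply/rowP => j; rewrite !mxE; field.
- move=> u /V'V Vu; have [_ ->] := CP u Vu; rewrite kE// /t /l.
  by move: (scal 2 _ _) => r; field.
- move=> u /V'V Vu; have [_ ->] := CQ u Vu; rewrite kE'// /t' /m.
  by move: (scal 2 _ _) => r; field.
- by move=> u /V'pos[].
- by move=> u /V'pos[].
Qed.

End NormalForm.

Section ConicSurface.
Variable R : realType.
Variables (W : set 'rV[R]_2) (Y : 'rV[R]_2 -> 'rV[R]_5).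

Lemma conic_sum (y y0 p p0 q q0 a b z w : 'rV[R]_5) (s s' t t' : R) :
  p = p0 + s *: a - t *: z -> - q = - q0 + s' *: b + t' *: w ->
  y = p - q -> y0 = p0 - q0 -> y = y0 + s *: a + (- t) *: z + s' *: b + t' *: w.
Proof. by move=> -> -> -> ->; apply/rowP => j; rewrite !mxE; ring. Qed.

(** Forgets [P] and [Q], whose signs differ, and keeps data symmetric under exchange of the two
    conics; this is what permits arranging [m <= l]. As [g] is curried, its smoothness is stated by
    substitution of smooth coordinates. *)
Record conic_surface (u0 : 'rV[R]_2) (a b z w : 'rV[R]_5) (l m : R)
    (V : set 'rV[R]_2) (d : R) (g : R -> R -> 'rV[R]_2) : Prop := ConicSurface {
  cs_adapted : adapted (Y u0) a b z w l m;
  cs_open : open V; cs_base : V u0; cs_sub : V `<=` W; cs_pos : 0 < d;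
  cs_in : forall u, V u -> [/\ `|scal 2 (Y u) a| < d, `|scal 2 (Y u) b| < d &
    g (scal 2 (Y u) a) (scal 2 (Y u) b) = u];
  cs_out : forall s t, `|s| < d -> `|t| < d ->
    [/\ V (g s t), scal 2 (Y (g s t)) a = s & scal 2 (Y (g s t)) b = t];
  cs_smooth : forall n (O : set 'rV[R]_n) (f1 f2 : 'rV[R]_n -> R), open O ->
    smooth_on O f1 -> smooth_on O f2 ->
    (forall v, O v -> `|f1 v| < d /\ `|f2 v| < d) -> smooth_on O (fun v => g (f1 v) (f2 v));
  cs_eq : forall u, V u -> exists t t', [/\
    Y u = Y u0 + scal 2 (Y u) a *: a + t *: z + scal 2 (Y u) b *: b + t' *: w,
    scal 2 (Y u) a ^+ 2 = 2 * t + l * t ^+ 2, scal 2 (Y u) b ^+ 2 = 2 * t' + m * t' ^+ 2,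
    0 < 1 + l * t & 0 < 1 + m * t'] }.

Lemma adapted_swap (y a b z w : 'rV[R]_5) l m : adapted y a b z w l m -> adapted y b a w z m l.
Proof. by case=> *; split => //; rewrite 1?scalC// addrC. Qed.

Lemma conic_surface_swap u0 a b z w l m V d g : conic_surface u0 a b z w l m V d g ->
  conic_surface u0 b a w z m l V d (fun s t => g t s).
Proof.
move=> [ad oV Vu0 VW d0 Hin Hout Hs He]; split => //; first exact: adapted_swap.
- by move=> u /Hin[].
- by move=> s t sd td; have [] := Hout t s td sd.
- by move=> n O f1 f2 oO s1 s2 H; apply: Hs => // v /H[].
- move=> u /He[t [t' [E E1 E2 E3 E4]]]; exists t', t; split => //; rewrite {1}E.
  by move: (scal 2 _ _) (scal 2 _ _) => p q; apply/rowP => j; rewrite !mxE; ring.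
Qed.

Lemma conic_surface_of_chart xi u0 a b z w l m V d g :
  conic_chart W Y xi u0 a b z w l m V d g ->
  conic_surface u0 a b z w l m V d (fun s t => g (pair_row s t)).
Proof.
move=> C; have [ad oV Vu0 VW d0 sg Hin Hout HP HQ HPx HQx HPp HQp] := C.
have Bpair (s t : R) : `|s| < d -> `|t| < d -> ball 0 d (pair_row s t).
  move=> sd td; apply/(ball0P _ d0) => j.
  by case: (ord2P j) => ->; rewrite ?pair_row0 ?pair_row1.
split => //.
- move=> u /Hin[/(ball0P _ d0) H gE]; split => //.
    by have := H 0; rewrite pair_row0.
  by have := H 1; rewrite pair_row1.
- move=> s t sd td; have [Vg E] := Hout _ (Bpair _ _ sd td); split => //.
    by move/rowP/(_ 0): E; rewrite !pair_row0.
  by move/rowP/(_ 1): E; rewrite !pair_row1.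
- move=> n O f1 f2 oO s1 s2 H k.
  have sp : smooth_on O (fun v => pair_row (f1 v) (f2 v)).
    move=> k'; apply/(Ck_rVP _ _ oO) => j; case: (ord2P j) => ->.
      by apply: (Ck_ext oO _ (s1 k')) => u _; rewrite pair_row0.
    by apply: (Ck_ext oO _ (s2 k')) => u _; rewrite pair_row1.
  have oB : open (ball (0 : 'rV[R]_2) d) by exact: ball_open.
  have Hb v : O v -> ball 0 d (pair_row (f1 v) (f2 v)) by move=> /H[]; exact: Bpair.
  exact: (Ck_comp oO oB Hb (sp k) (sg k)).
- move=> u Vu; exists (- scal 2 (pencil Y xi 2^-1 u) (Y u0)), (scal 2 (pencil Y xi (- 2^-1) u) (Y u0)).
  split; rewrite ?mulrN//; last 4 first.
  + by rewrite HPx// sqrrN; ring.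
  + by rewrite HQx.
  + exact: HPp.
  + exact: HQp.
  have YPQ v : Y v = pencil Y xi 2^-1 v + (- pencil Y xi (- 2^-1) v).
    by rewrite /pencil; move: (Y v) (xi v) => p q; apply/rowP => j; rewrite !mxE; field.
  exact: conic_sum (HP u Vu) (HQ u Vu) (YPQ u) (YPQ u0).
Qed.

End ConicSurface.

(** * The three models *)

Section Orthogonal.
Variable R : realType.
Implicit Types t : 'rV[R]_5.

Definition rows5 t0 t1 t2 t3 t4 : 'M[R]_5 := \matrix_(i < 5) [:: t0; t1; t2; t3; t4]`_i.

Lemma mulmx_rows5 (X : 'rV[R]_5) t0 t1 t2 t3 t4 : X *m rows5 t0 t1 t2 t3 t4 =
  X 0 (inord 0) *: t0 + X 0 (inord 1) *: t1 + X 0 (inord 2) *: t2 + X 0 (inord 3) *: t3 + X 0 (inord 4) *: t4.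
Proof.
rewrite mulmx_sum_row (eq_bigr (fun i : 'I_5 => X 0 (inord i) *: [:: t0; t1; t2; t3; t4]`_i)).
  by rewrite !big_ord_recl big_ord0 /= /bump /= !add1n addr0 !addrA.
by move=> i _; rewrite rowK inord_val.
Qed.

Record orthonormal5 t0 t1 t2 t3 t4 : Prop := Orthonormal5 {
  o00 : scal 2 t0 t0 = -1; o11 : scal 2 t1 t1 = -1; o22 : scal 2 t2 t2 = 1;
  o33 : scal 2 t3 t3 = 1; o44 : scal 2 t4 t4 = 1;
  o01 : scal 2 t0 t1 = 0; o02 : scal 2 t0 t2 = 0; o03 : scal 2 t0 t3 = 0; o04 : scal 2 t0 t4 = 0;
  o12 : scal 2 t1 t2 = 0; o13 : scal 2 t1 t3 = 0; o14 : scal 2 t1 t4 = 0;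
  o23 : scal 2 t2 t3 = 0; o24 : scal 2 t2 t4 = 0; o34 : scal 2 t3 t4 = 0 }.

Lemma orthogonal_rows5 t0 t1 t2 t3 t4 : orthonormal5 t0 t1 t2 t3 t4 ->
  orthogonal_mx (rows5 t0 t1 t2 t3 t4).
Proof.
move=> [h00 h11 h22 h33 h44 h01 h02 h03 h04 h12 h13 h14 h23 h24 h34] X Z.
rewrite !mulmx_rows5 (scal5E X Z) !(scalDl, scalZl) !(scalDr, scalZr).
rewrite (scalC 2 t1 t0) (scalC 2 t2 t0) (scalC 2 t3 t0) (scalC 2 t4 t0) (scalC 2 t2 t1).
rewrite (scalC 2 t3 t1) (scalC 2 t4 t1) (scalC 2 t3 t2) (scalC 2 t4 t2) (scalC 2 t4 t3).
rewrite h00 h11 h22 h33 h44 h01 h02 h03 h04 h12 h13 h14 h23 h24 h34.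
move: (X 0 _) (X 0 _) (X 0 _) (X 0 _) (X 0 _) (Z 0 _) (Z 0 _) (Z 0 _) (Z 0 _) (Z 0 _) => *.
ring.
Qed.

End Orthogonal.

Section Equivalence.
Variables (R : realType) (M : topologicalType) (A : set (chart R M)) (x : M -> set 'rV[R]_5).
Hypothesis A_charts : forall c, A c -> is_chart c.

(** Only a vector identity up to the constant [k] remains to be checked for a model, since
    projective points ignore scaling. The conformal transformation is the setwise image under right
    multiplication by [T]. *)
Lemma equivalent_near n (S : set 'rV[R]_n) (iota : 'rV[R]_n -> 'rV[R]_5) (p : M) c W Y
    (V : set 'rV[R]_2) (O : set 'rV[R]_n) (phi : 'rV[R]_2 -> 'rV[R]_n)
    (psi : 'rV[R]_n -> 'rV[R]_2) (T : 'M[R]_5) (k : R) :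
  local_lift A x c W Y -> chart_dom c p -> open V -> V (chart_map c p) -> V `<=` W ->
  open O -> smooth_on V phi -> smooth_on O psi ->
  (forall u, V u -> [/\ S (phi u), O (phi u) & psi (phi u) = u]) ->
  (forall v, S v -> O v -> V (psi v) /\ phi (psi v) = v) ->
  orthogonal_mx T -> k != 0 ->
  (forall u, V u -> k *: Y u = iota (phi u) *m T) ->
  conformally_equivalent_near A x S iota p.
Proof.
move=> [Ac oW Wc sY HY] cp oV Vp VW oO sphi spsi Hphi Hpsi oT k0 E.
have [[od oi] cK cc ci] := A_charts Ac.
pose VM := chart_dom c `&` chart_map c @^-1` V.
have imV : chart_map c @` VM = V.
  apply/seteqP; split=> [u [q [_ Vq] <-]//|u Vu].
  have [q dq qu] := Wc _ (VW _ Vu).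
  by exists q => //; split => //; rewrite /= qu.
have fE (X : 'rV[R]_5) : (fun Z => Z *m T) @` line X = line (X *m T).
  apply/seteqP; split=> [_ [_ [r r0 ->] <-]|_ [r r0 ->]].
    by exists r => //; rewrite -scalemxAl.
  by exists (r *: X); [exists r|rewrite -scalemxAl].
exists c, VM, O, phi, (fun L => (fun Z => Z *m T) @` L); split => //.
- split => //; last by move=> q [].
  rewrite openE => q [dq Vq]; apply: filterI; first exact: open_nbhs_nbhs.
  by apply: (cc q dq); exact: open_nbhs_nbhs.
- rewrite imV; exists psi; split.
  + split=> [u Vu|v [Sv Ov]]; first by have [] := Hphi u Vu.
    by have [] := Hpsi v Sv Ov.
  + split=> [u Vu|v [Sv Ov]]; first by have [] := Hphi u Vu.
    by have [] := Hpsi v Sv Ov.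
  + by move=> u Vu; exists V, phi.
  + by move=> v [Sv Ov]; exists O, psi.
- by exists T.
- move=> q [dq Vq]; have [_] := HY _ (VW _ Vq); rewrite cK// => ->.
  by rewrite fE -E// line_scale.
Qed.

End Equivalence.

Section Coordinates.
Variable R : realType.

Definition o3 k (h : (k < 3)%N) : 'I_3 := Ordinal h.
Definition o4 k (h : (k < 4)%N) : 'I_4 := Ordinal h.

Lemma embHE (u : 'rV[R]_4) : [/\ embH u 0 (inord 0) = u 0 (o4 (isT : 0 < 4)%N),
  embH u 0 (inord 1) = u 0 (o4 (isT : 1 < 4)%N), embH u 0 (inord 2) = u 0 (o4 (isT : 2 < 4)%N),
  embH u 0 (inord 3) = u 0 (o4 (isT : 3 < 4)%N) & embH u 0 (inord 4) = 1].
Proof.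
have E k (h : (k < 4)%N) : embH u 0 (inord k) = u 0 (o4 h).
  have -> : inord k = lshift 1 (o4 h) :> 'I_(4 + 1).
    by apply/val_inj; rewrite /= inordK// ltnS ltnW.
  by rewrite /embH (row_mxEl u).
split; [exact: (E 0%N isT)|exact: (E 1%N isT)|exact: (E 2%N isT)|exact: (E 3%N isT)|].
have -> : inord 4 = rshift 4 (0 : 'I_1) :> 'I_(4 + 1) by apply/val_inj; rewrite /= inordK.
by rewrite /embH (row_mxEr u) mxE.
Qed.

Lemma embSE (u : 'rV[R]_4) : [/\ embS u 0 (inord 0) = 1, embS u 0 (inord 1) = u 0 (o4 (isT : 0 < 4)%N),
  embS u 0 (inord 2) = u 0 (o4 (isT : 1 < 4)%N), embS u 0 (inord 3) = u 0 (o4 (isT : 2 < 4)%N) &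
  embS u 0 (inord 4) = u 0 (o4 (isT : 3 < 4)%N)].
Proof.
have E k (h : (k < 4)%N) : embS u 0 (inord k.+1) = u 0 (o4 h).
  have -> : inord k.+1 = rshift 1 (o4 h) :> 'I_(1 + 4).
    by apply/val_inj; rewrite /= inordK// ltnS.
  by rewrite /embS (row_mxEr (1%:M : 'M[R]_1)).
split; [|exact: (E 0%N isT)|exact: (E 1%N isT)|exact: (E 2%N isT)|exact: (E 3%N isT)].
have -> : inord 0 = lshift 4 (0 : 'I_1) :> 'I_(1 + 4) by apply/val_inj; rewrite /= inordK.
by rewrite /embS (row_mxEl (1%:M : 'M[R]_1)) mxE.
Qed.

Lemma embRE (u : 'rV[R]_3) : [/\ embR u 0 (inord 0) = (scal 1 u u + 1) / 2,
  embR u 0 (inord 1) = u 0 (o3 (isT : 0 < 3)%N), embR u 0 (inord 2) = u 0 (o3 (isT : 1 < 3)%N),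
  embR u 0 (inord 3) = u 0 (o3 (isT : 2 < 3)%N) & embR u 0 (inord 4) = (scal 1 u u - 1) / 2].
Proof.
rewrite /embR; move: ((scal 1 u u + 1) / 2) ((scal 1 u u - 1) / 2) => r s.
pose v : 'rV[R]_(3 + 1) := row_mx u (s%:M : 'M[R]_1).
have E k (h : (k < 3)%N) : row_mx (r%:M : 'M[R]_1) v 0 (inord k.+1) = u 0 (o3 h).
  have -> : inord k.+1 = rshift 1 (lshift 1 (o3 h)) :> 'I_(1 + (3 + 1)).
    by apply/val_inj; rewrite /= inordK// ltnS (leq_trans h).
  by rewrite row_mxEr /v row_mxEl.
split; [|exact: (E 0%N isT)|exact: (E 1%N isT)|exact: (E 2%N isT)|].
  have -> : inord 0 = lshift (3 + 1) (0 : 'I_1) :> 'I_(1 + (3 + 1)) by apply/val_inj; rewrite /= inordK.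
  by apply: etrans (row_mxEl (r%:M : 'M[R]_1) v 0 0) _; rewrite mxE.
have -> : inord 4 = rshift 1 (rshift 3 (0 : 'I_1)) :> 'I_(1 + (3 + 1)) by apply/val_inj; rewrite /= inordK.
by apply: etrans (row_mxEr (r%:M : 'M[R]_1) v 0 _) _; rewrite /v row_mxEr mxE.
Qed.

Lemma scal1_coords2 n (u : 'rV[R]_n) i j :
  scal 1 (coords2 u i j) (coords2 u i j) = - u 0 i ^+ 2 + u 0 j ^+ 2.
Proof. by rewrite /scal big_ord2 /= !mxE /=; ring. Qed.

Lemma scal0_coords2 n (u : 'rV[R]_n) i j :
  scal 0 (coords2 u i j) (coords2 u i j) = u 0 i ^+ 2 + u 0 j ^+ 2.
Proof. by rewrite /scal big_ord2 /= !mxE /=; ring. Qed.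

Lemma HxHE (r s : R) (u : 'rV[R]_4) : HxH r s u <->
  - u 0 (o4 (isT : 0 < 4)%N) ^+ 2 + u 0 (o4 (isT : 2 < 4)%N) ^+ 2 = - r ^+ 2 /\
  - u 0 (o4 (isT : 1 < 4)%N) ^+ 2 + u 0 (o4 (isT : 3 < 4)%N) ^+ 2 = - s ^+ 2.
Proof. by rewrite /HxH /pseudo_hyperbolic /= !scal1_coords2. Qed.

Lemma HxSE (r s : R) (u : 'rV[R]_4) : HxS r s u <->
  - u 0 (o4 (isT : 0 < 4)%N) ^+ 2 + u 0 (o4 (isT : 1 < 4)%N) ^+ 2 = - r ^+ 2 /\
  u 0 (o4 (isT : 2 < 4)%N) ^+ 2 + u 0 (o4 (isT : 3 < 4)%N) ^+ 2 = s ^+ 2.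
Proof.
by rewrite /HxS /pseudo_hyperbolic /pseudo_sphere /= scal1_coords2 scal0_coords2.
Qed.

Lemma HxRE (u : 'rV[R]_3) : HxR u <->
  - u 0 (o3 (isT : 0 < 3)%N) ^+ 2 + u 0 (o3 (isT : 1 < 3)%N) ^+ 2 = - 1.
Proof. by rewrite /HxR /pseudo_hyperbolic /= scal1_coords2 expr1n. Qed.

Definition row4 (a b c d : R) : 'rV[R]_4 := \row_(j < 4) [:: a; b; c; d]`_j.
Definition row3 (a b c : R) : 'rV[R]_3 := \row_(j < 3) [:: a; b; c]`_j.

Lemma row4P (u v : 'rV[R]_4) : u 0 (o4 (isT : 0 < 4)%N) = v 0 (o4 (isT : 0 < 4)%N) ->
  u 0 (o4 (isT : 1 < 4)%N) = v 0 (o4 (isT : 1 < 4)%N) ->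
  u 0 (o4 (isT : 2 < 4)%N) = v 0 (o4 (isT : 2 < 4)%N) ->
  u 0 (o4 (isT : 3 < 4)%N) = v 0 (o4 (isT : 3 < 4)%N) -> u = v.
Proof.
move=> h0 h1 h2 h3; apply/rowP => -[[|[|[|[|]]]]// h]; rewrite (bool_irrelevance h isT);
 [exact: h0|exact: h1|exact: h2|exact: h3].
Qed.

Lemma row3P (u v : 'rV[R]_3) : u 0 (o3 (isT : 0 < 3)%N) = v 0 (o3 (isT : 0 < 3)%N) ->
  u 0 (o3 (isT : 1 < 3)%N) = v 0 (o3 (isT : 1 < 3)%N) ->
  u 0 (o3 (isT : 2 < 3)%N) = v 0 (o3 (isT : 2 < 3)%N) -> u = v.
Proof.
move=> h0 h1 h2; apply/rowP => -[[|[|[|]]]// h]; rewrite (bool_irrelevance h isT);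
 [exact: h0|exact: h1|exact: h2].
Qed.

Lemma smooth_row4 (V : set 'rV[R]_2) (a b c d : 'rV[R]_2 -> R) : open V ->
  smooth_on V a -> smooth_on V b -> smooth_on V c -> smooth_on V d ->
  smooth_on V (fun u => row4 (a u) (b u) (c u) (d u)).
Proof.
move=> oV sa sb sc sd k; apply/(Ck_rVP _ _ oV) => -[[|[|[|[|]]]]// h];
 [apply: (Ck_ext oV _ (sa k))|apply: (Ck_ext oV _ (sb k))|apply: (Ck_ext oV _ (sc k))|
  apply: (Ck_ext oV _ (sd k))] => u _; by rewrite mxE.
Qed.

Lemma smooth_row3 (V : set 'rV[R]_2) (a b c : 'rV[R]_2 -> R) : open V ->
  smooth_on V a -> smooth_on V b -> smooth_on V c ->
  smooth_on V (fun u => row3 (a u) (b u) (c u)).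
Proof.
move=> oV sa sb sc k; apply/(Ck_rVP _ _ oV) => -[[|[|[|]]]// h];
 [apply: (Ck_ext oV _ (sa k))|apply: (Ck_ext oV _ (sb k))|apply: (Ck_ext oV _ (sc k))] => u _;
 by rewrite mxE.
Qed.

Lemma smooth_coord n (O : set 'rV[R]_n) j : smooth_on O (fun u : 'rV[R]_n => u 0 j).
Proof. by move=> k; apply: (@Ck_linear _ _ _ _ _ (coord_map R j)); exact: coord_continuous. Qed.

Lemma open_coord_set n (j : 'I_n) (P : set R) : open P -> open [set u : 'rV[R]_n | P (u 0 j)].
Proof.
move=> oP; apply: (@open_comp _ _ (fun u : 'rV[R]_n => u 0 j) P) => // u _.
exact: coord_continuous.
Qed.

Lemma open_coord_gt0 n (j : 'I_n) : open [set u : 'rV[R]_n | 0 < u 0 j].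
Proof.
have oP : open [set r : R | 0 < r] by exact: open_gt.
exact: (open_coord_set oP).
Qed.

Lemma open_coord_lt n (j : 'I_n) (e : R) : open [set u : 'rV[R]_n | `|u 0 j| < e].
Proof.
have -> : [set u : 'rV[R]_n | `|u 0 j| < e] = [set u | u 0 j \in `]-e, e[].
  by apply/seteqP; split => u /=; rewrite in_itv/= ltr_norml.
have oP : open [set r : R | r \in `]-e, e[] by exact: interval_open.
exact: (open_coord_set oP).
Qed.

End Coordinates.

(** Completing the squares, Y = K + s a + (t + 1/l) z + s' b + (t' + 1/m) w with (1 + l t)^2 - l s^2
    = 1 and likewise for the other conic. Thus [K] spans the axis orthogonal to both planes, and the
    sign of l m decides whether it is space-like or time-like. *)
Lemma conic_center (R : realType) (y a b z w : 'rV[R]_5) (l m : R) :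
  adapted y a b z w l m -> l != 0 -> m != 0 ->
  let K := y - l^-1 *: z - m^-1 *: w in
  [/\ scal 2 K K = (l * m)^-1, scal 2 z K = 0, scal 2 w K = 0, scal 2 a K = 0 & scal 2 b K = 0].
Proof.
move=> [yy ya yb yz yw aa bb ab az aw bz bw zz ww zw lm] l0 m0 K.
have zK : scal 2 z K = 0.
  by rewrite /K !(scalDr, scalNr, scalZr) (scalC 2 z y) yz zz zw; field; rewrite m0 l0.
have wK : scal 2 w K = 0.
  by rewrite !(scalDr, scalNr, scalZr) (scalC 2 w y) (scalC 2 w z) yw ww zw; field; rewrite m0 l0.
split => //.
- rewrite {1}/K !(scalDl, scalNl, scalZl) zK wK !(scalDr, scalNr, scalZr) yy yz yw.
  transitivity ((l + m) / (l * m)); first by field; rewrite m0 l0.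
  by rewrite lm mul1r.
- by rewrite !(scalDr, scalNr, scalZr) (scalC 2 a y) ya az aw; ring.
- by rewrite !(scalDr, scalNr, scalZr) (scalC 2 b y) yb bz bw; ring.
Qed.

Section Models.
Variables (R : realType) (M : topologicalType) (A : set (chart R M)) (x : M -> set 'rV[R]_5).
Hypothesis A_charts : forall c, A c -> is_chart c.
Variables (p : M) (c : chart R M) (W : set 'rV[R]_2) (Y : 'rV[R]_2 -> 'rV[R]_5).
Hypotheses (YL : local_lift A x c W Y) (cp : chart_dom c p).
Variables (a b z w : 'rV[R]_5) (l m : R) (V : set 'rV[R]_2) (d : R) (g : R -> R -> 'rV[R]_2).
Hypothesis C : conic_surface W Y (chart_map c p) a b z w l m V d g.

Let Y0 := Y (chart_map c p).

Lemma conic_coordinates u : V u -> exists s t s' t', [/\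
  [/\ scal 2 (Y u) a = s, scal 2 (Y u) b = s', scal 2 (Y u) z = - (1 + l * t) & scal 2 (Y u) w = - (1 + m * t')],
  Y u = Y0 + s *: a + t *: z + s' *: b + t' *: w,
  [/\ `|s| < d, `|s'| < d & g s s' = u] &
  [/\ s ^+ 2 = 2 * t + l * t ^+ 2, s' ^+ 2 = 2 * t' + m * t' ^+ 2, 0 < 1 + l * t & 0 < 1 + m * t']].
Proof.
move=> Vu; have [yy ya yb yz yw aa bb ab az aw bz bw zz ww zw lm] := cs_adapted C.
have [t [t' [E E1 E2 E3 E4]]] := cs_eq C Vu; have [H1 H2 H3] := cs_in C Vu.
exists (scal 2 (Y u) a), t, (scal 2 (Y u) b), t'; split => //; split => //.
  by rewrite {1}E !(scalDl, scalZl) yz az bz zz (scalC 2 w z) zw; ring.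
by rewrite {1}E !(scalDl, scalZl) yw aw bw zw ww; ring.
Qed.

Lemma sqr_inj_pos (r s : R) : 0 < r -> 0 < s -> r ^+ 2 = s ^+ 2 -> r = s.
Proof. by move=> r0 s0 /eqP; rewrite eqrXn2 ?ltW// => /eqP. Qed.

Let oV := cs_open C.

Lemma smooth_lift_coord v : smooth_on V (fun u => scal 2 (Y u) v).
Proof.
have [_ _ _ sY _] := YL; have sYV := smooth_subset (cs_sub C) sY.
by apply: smooth_scal => //; exact: smooth_cst.
Qed.

(** Scaling by k, the root of l m, makes [K] a unit vector. The first conic then satisfies - m (1 +
    l t)^2 + l m s^2 = - m, which gives the radius; the second has squared radius l = 1 - m. *)
Lemma model_HxH : 0 < l -> 0 < m ->
  conformally_equivalent_near A x (HxH (Num.sqrt m) (Num.sqrt (1 - Num.sqrt m ^+ 2))) (@embH R) p.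
Proof.
move=> l0 m0; have [yy ya yb yz yw aa bb ab az aw bz bw zz ww zw lm] := cs_adapted C.
rewrite -/Y0 in yy ya yb yz yw.
rewrite sqr_sqrtr ?ltW//; have -> : 1 - m = l by rewrite -lm addrK.
have ll := sqr_sqrtr (ltW l0); have mm := sqr_sqrtr (ltW m0).
have sl : 0 < Num.sqrt l by rewrite sqrtr_gt0.
have sm : 0 < Num.sqrt m by rewrite sqrtr_gt0.
move: (Num.sqrt l) (Num.sqrt m) ll mm sl sm => lr mr ll mm lr0 mr0.
have lrn := lt0r_neq0 lr0; have mrn := lt0r_neq0 mr0.
pose k := lr * mr; have k0 : 0 < k by rewrite mulr_gt0.
have kn := lt0r_neq0 k0.
pose K := Y0 - l^-1 *: z - m^-1 *: w.
(* Coordinates 0, 2 of the model go to the plane of [z], [a] and coordinates 1, 3 to that of [w],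
   [b]; the constant last coordinate of [embH] goes to the axis [K]. *)
pose T := rows5 (lr^-1 *: z) (mr^-1 *: w) a b (k *: K).
pose phi u := row4 (- mr * scal 2 (Y u) z) (- lr * scal 2 (Y u) w) (k * scal 2 (Y u) a) (k * scal 2 (Y u) b).
(* The positive coordinates choose a sheet of each hyperbola, so that a point is determined by the
   two remaining coordinates; those are confined to the range of the chart. *)
pose O := [set v : 'rV[R]_4 | 0 < v 0 (o4 (isT : 0 < 4)%N)] `&` [set v : 'rV[R]_4 | 0 < v 0 (o4 (isT : 1 < 4)%N)]
  `&` ([set v : 'rV[R]_4 | `|v 0 (o4 (isT : 2 < 4)%N)| < k * d] `&` [set v : 'rV[R]_4 | `|v 0 (o4 (isT : 3 < 4)%N)| < k * d]).
pose psi (v : 'rV[R]_4) := g (k^-1 * v 0 (o4 (isT : 2 < 4)%N)) (k^-1 * v 0 (o4 (isT : 3 < 4)%N)).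
have oO : open O.
  by apply: openI; apply: openI; do ?[exact: open_coord_gt0|exact: open_coord_lt].
have kd r : `|r| < k * d -> `|k^-1 * r| < d.
  by move=> h; rewrite normrM gtr0_norm ?invr_gt0// mulrC ltr_pdivrMr// mulrC.
have phiE u s t s' t' : V u -> [/\ scal 2 (Y u) a = s, scal 2 (Y u) b = s', scal 2 (Y u) z = - (1 + l * t) & scal 2 (Y u) w = - (1 + m * t')] ->
    [/\ phi u 0 (o4 (isT : 0 < 4)%N) = mr * (1 + l * t), phi u 0 (o4 (isT : 1 < 4)%N) = lr * (1 + m * t'),
     phi u 0 (o4 (isT : 2 < 4)%N) = k * s & phi u 0 (o4 (isT : 3 < 4)%N) = k * s'].
  by move=> Vu [Ea Eb Ez Ew]; rewrite !mxE /= Ea Eb Ez Ew; split; ring.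
have HS u : V u -> HxH mr lr (phi u).
  move=> Vu; have [s [t [s' [t' [E4 _ _ [E1 E2 _ _]]]]]] := conic_coordinates Vu.
  have [p0 p1 p2 p3] := phiE u s t s' t' Vu E4.
  by apply/HxHE; rewrite p0 p1 p2 p3 !exprMn E1 E2 /k ?exprMn ll mm; split; ring.
apply: (equivalent_near A_charts (phi := phi) (psi := psi) (T := T) (k := k) YL cp oV (cs_base C) (cs_sub C) oO) => //.
- by apply: smooth_row4 => //; apply: smoothM => //; do ?[exact: smooth_cst|exact: smooth_lift_coord].
- apply: (cs_smooth C oO).
  + by apply: smoothM => //; [exact: smooth_cst|exact: smooth_coord].
  + by apply: smoothM => //; [exact: smooth_cst|exact: smooth_coord].
  + by move=> v [_ [/kd h2 /kd h3]].
- move=> u Vu; have [s [t [s' [t' [E4 _ [sd sd' gE] [_ _ q1 q2]]]]]] := conic_coordinates Vu.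
  have [p0 p1 p2 p3] := phiE u s t s' t' Vu E4.
  split; first exact: HS.
    split; split; rewrite /= ?p0 ?p1 ?p2 ?p3 ?mulr_gt0//.
      by rewrite normrM gtr0_norm// ltr_pM2l.
    by rewrite normrM gtr0_norm// ltr_pM2l.
  by rewrite /psi p2 p3 !mulKf.
- move=> v Sv [[/= v0 v1] [/= v2 v3]].
  have [Vg Ga Gb] := cs_out C (kd _ v2) (kd _ v3); split => //.
  have [s [t [s' [t' [E4 _ _ [_ _ q1 q2]]]]]] := conic_coordinates Vg.
  have [p0 p1 p2 p3] := phiE _ s t s' t' Vg E4.
  have /HxHE[S1 S2] := HS _ Vg; have /HxHE[S1' S2'] := Sv.
  have [Ea Eb _ _] := E4.
  have e2 : phi (psi v) 0 (o4 (isT : 2 < 4)%N) = v 0 (o4 (isT : 2 < 4)%N) by rewrite p2 -Ea Ga mulVKf.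
  have e3 : phi (psi v) 0 (o4 (isT : 3 < 4)%N) = v 0 (o4 (isT : 3 < 4)%N) by rewrite p3 -Eb Gb mulVKf.
  apply: row4P => //.
    apply: sqr_inj_pos => //; first by rewrite p0 mulr_gt0.
    by move: S1; rewrite e2 -S1' => /addIr/oppr_inj.
  apply: sqr_inj_pos => //; first by rewrite p1 mulr_gt0.
  by move: S2; rewrite e3 -S2' => /addIr/oppr_inj.
- apply: orthogonal_rows5.
  have [KK zK wK aK bK] := conic_center (cs_adapted C) (lt0r_neq0 l0) (lt0r_neq0 m0).
  rewrite -/Y0 -/K in KK zK wK aK bK; clearbody K.
  have za : scal 2 z a = 0 by rewrite scalC. have zb : scal 2 z b = 0 by rewrite scalC.
  have wa : scal 2 w a = 0 by rewrite scalC. have wb : scal 2 w b = 0 by rewrite scalC.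
  split; rewrite ?scalZl ?scalZr ?KK ?zK ?wK ?aK ?bK ?za ?zb ?wa ?wb ?aa ?bb ?ab ?zz ?ww ?zw ?mulr0//.
  + by rewrite -ll; field.
  + by rewrite -mm; field.
  + by rewrite /k -ll -mm; field; rewrite lrn mrn.
- move=> u Vu; have [s [t [s' [t' [E4 E _ _]]]]] := conic_coordinates Vu.
  have [p0 p1 p2 p3] := phiE u s t s' t' Vu E4.
  have [h0 h1 h2 h3 h4] := embHE (phi u).
  rewrite mulmx_rows5 h0 h1 h2 h3 h4 p0 p1 p2 p3 E /K /k -ll -mm.
  apply/rowP => j; rewrite !mxE; field; rewrite ?lrn ?mrn //.
Qed.


(** Now l m is negative, so [K] is time-like and takes the constant first coordinate of [embS],
    while [w] is space-like and the second conic is an ellipse, rescaled to a circle of squared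
    radius l = 1 - m. *)
Lemma model_HxS : 0 < l -> m < 0 ->
  conformally_equivalent_near A x (HxS (Num.sqrt (- m)) (Num.sqrt (Num.sqrt (- m) ^+ 2 + 1))) (@embS R) p.
Proof.
move=> l0 m0; have [yy ya yb yz yw aa bb ab az aw bz bw zz ww zw lm] := cs_adapted C.
rewrite -/Y0 in yy ya yb yz yw.
have m0' : 0 < - m by rewrite oppr_gt0.
rewrite sqr_sqrtr ?ltW//; have -> : - m + 1 = l by rewrite -lm; ring.
have ll := sqr_sqrtr (ltW l0); have mm := sqr_sqrtr (ltW m0').
have sl : 0 < Num.sqrt l by rewrite sqrtr_gt0.
have sm : 0 < Num.sqrt (- m) by rewrite sqrtr_gt0.
move: (Num.sqrt l) (Num.sqrt (- m)) ll mm sl sm => lr mr ll mm lr0 mr0.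
have mE : m = - mr ^+ 2 by rewrite mm opprK.
have lrn := lt0r_neq0 lr0; have mrn := lt0r_neq0 mr0.
pose k := lr * mr; have k0 : 0 < k by rewrite mulr_gt0.
have kn := lt0r_neq0 k0.
pose K := Y0 - l^-1 *: z - m^-1 *: w.
(* The minus sign makes up for 1/m being negative: k (t' + 1/m) = - lr (1 + m t') / mr. *)
pose T := rows5 (k *: K) (lr^-1 *: z) a (- mr^-1 *: w) b.
pose phi u := row4 (- mr * scal 2 (Y u) z) (k * scal 2 (Y u) a) (- lr * scal 2 (Y u) w) (k * scal 2 (Y u) b).
pose O := [set v : 'rV[R]_4 | 0 < v 0 (o4 (isT : 0 < 4)%N)] `&` [set v : 'rV[R]_4 | 0 < v 0 (o4 (isT : 2 < 4)%N)]
  `&` ([set v : 'rV[R]_4 | `|v 0 (o4 (isT : 1 < 4)%N)| < k * d] `&` [set v : 'rV[R]_4 | `|v 0 (o4 (isT : 3 < 4)%N)| < k * d]).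
pose psi (v : 'rV[R]_4) := g (k^-1 * v 0 (o4 (isT : 1 < 4)%N)) (k^-1 * v 0 (o4 (isT : 3 < 4)%N)).
have oO : open O.
  by apply: openI; apply: openI; do ?[exact: open_coord_gt0|exact: open_coord_lt].
have kd r : `|r| < k * d -> `|k^-1 * r| < d.
  by move=> h; rewrite normrM gtr0_norm ?invr_gt0// mulrC ltr_pdivrMr// mulrC.
have phiE u s t s' t' : V u -> [/\ scal 2 (Y u) a = s, scal 2 (Y u) b = s', scal 2 (Y u) z = - (1 + l * t) & scal 2 (Y u) w = - (1 + m * t')] ->
    [/\ phi u 0 (o4 (isT : 0 < 4)%N) = mr * (1 + l * t), phi u 0 (o4 (isT : 1 < 4)%N) = k * s,
     phi u 0 (o4 (isT : 2 < 4)%N) = lr * (1 + m * t') & phi u 0 (o4 (isT : 3 < 4)%N) = k * s'].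
  by move=> Vu [Ea Eb Ez Ew]; rewrite !mxE /= Ea Eb Ez Ew; split; ring.
have HS u : V u -> HxS mr lr (phi u).
  move=> Vu; have [s [t [s' [t' [E4 _ _ [E1 E2 _ _]]]]]] := conic_coordinates Vu.
  have [p0 p1 p2 p3] := phiE u s t s' t' Vu E4.
  by apply/HxSE; rewrite p0 p1 p2 p3 !exprMn E1 E2 /k ?exprMn ll mE; split; ring.
apply: (equivalent_near A_charts (phi := phi) (psi := psi) (T := T) (k := k) YL cp oV (cs_base C) (cs_sub C) oO) => //.
- by apply: smooth_row4 => //; apply: smoothM => //; do ?[exact: smooth_cst|exact: smooth_lift_coord].
- apply: (cs_smooth C oO).
  + by apply: smoothM => //; [exact: smooth_cst|exact: smooth_coord].
  + by apply: smoothM => //; [exact: smooth_cst|exact: smooth_coord].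
  + by move=> v [_ [/kd h2 /kd h3]].
- move=> u Vu; have [s [t [s' [t' [E4 _ [sd sd' gE] [_ _ q1 q2]]]]]] := conic_coordinates Vu.
  have [p0 p1 p2 p3] := phiE u s t s' t' Vu E4.
  split; first exact: HS.
    split; split; rewrite /= ?p0 ?p1 ?p2 ?p3 ?mulr_gt0//.
      by rewrite normrM gtr0_norm// ltr_pM2l.
    by rewrite normrM gtr0_norm// ltr_pM2l.
  by rewrite /psi p1 p3 !mulKf.
- move=> v Sv [[/= v0 v2] [/= v1 v3]].
  have [Vg Ga Gb] := cs_out C (kd _ v1) (kd _ v3); split => //.
  have [s [t [s' [t' [E4 _ _ [_ _ q1 q2]]]]]] := conic_coordinates Vg.
  have [p0 p1 p2 p3] := phiE _ s t s' t' Vg E4.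
  have /HxSE[S1 S2] := HS _ Vg; have /HxSE[S1' S2'] := Sv.
  have [Ea Eb _ _] := E4.
  have e1 : phi (psi v) 0 (o4 (isT : 1 < 4)%N) = v 0 (o4 (isT : 1 < 4)%N) by rewrite p1 -Ea Ga mulVKf.
  have e3 : phi (psi v) 0 (o4 (isT : 3 < 4)%N) = v 0 (o4 (isT : 3 < 4)%N) by rewrite p3 -Eb Gb mulVKf.
  apply: row4P => //.
    apply: sqr_inj_pos => //; first by rewrite p0 mulr_gt0.
    by move: S1; rewrite e1 -S1' => /addIr/oppr_inj.
  apply: sqr_inj_pos => //; first by rewrite p2 mulr_gt0.
  by move: S2; rewrite e3 -S2' => /addIr.
- apply: orthogonal_rows5.
  have [KK zK wK aK bK] := conic_center (cs_adapted C) (lt0r_neq0 l0) (ltr0_neq0 m0).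
  rewrite -/Y0 -/K in KK zK wK aK bK; clearbody K.
  have za : scal 2 z a = 0 by rewrite scalC. have zb : scal 2 z b = 0 by rewrite scalC.
  have wa : scal 2 w a = 0 by rewrite scalC. have wb : scal 2 w b = 0 by rewrite scalC.
  have Kz : scal 2 K z = 0 by rewrite scalC. have Kw : scal 2 K w = 0 by rewrite scalC.
  have Ka : scal 2 K a = 0 by rewrite scalC. have Kb : scal 2 K b = 0 by rewrite scalC.
  split; rewrite ?scalZl ?scalZr ?KK ?Kz ?Kw ?Ka ?Kb ?za ?zb ?wa ?wb ?aa ?bb ?ab ?aw ?zz ?ww ?zw ?mulr0//.
  + by rewrite /k -ll mE; field; rewrite lrn mrn.
  + by rewrite -ll; field.
  + by rewrite mE; field.
- move=> u Vu; have [s [t [s' [t' [E4 E _ _]]]]] := conic_coordinates Vu.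
  have [p0 p1 p2 p3] := phiE u s t s' t' Vu E4.
  have [h0 h1 h2 h3 h4] := embSE (phi u).
  rewrite mulmx_rows5 h0 h1 h2 h3 h4 p0 p1 p2 p3 E /K /k -ll mE.
  apply/rowP => j; rewrite !mxE; field; rewrite ?lrn ?mrn //.
Qed.

(** Here l = 1, [w] is null, and the second conic is the parabola s'^2 = 2 t', which becomes the
    Euclidean line. *)
Lemma model_HxR : m = 0 -> conformally_equivalent_near A x HxR (@embR R) p.
Proof.
move=> m0; have [yy ya yb yz yw aa bb ab az aw bz bw zz ww zw lm] := cs_adapted C.
rewrite -/Y0 in yy ya yb yz yw.
have l1 : l = 1 by rewrite -lm m0 addr0.
rewrite m0 oppr0 in ww; rewrite l1 in zz.
pose K := Y0 - z.
(* [K] has square 1 and product -1 with [w], so [w + K] has square -1. With q = <phi, phi>, the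
   outer coordinates of [embR] give (q + 1)/2 w + K, and q = -1 + s'^2 makes the coefficient of [w]
   equal to t'. *)
pose T := rows5 (w + K) z a b (- K).
pose phi u := row3 (- scal 2 (Y u) z) (scal 2 (Y u) a) (scal 2 (Y u) b).
pose O := [set v : 'rV[R]_3 | 0 < v 0 (o3 (isT : 0 < 3)%N)]
  `&` ([set v : 'rV[R]_3 | `|v 0 (o3 (isT : 1 < 3)%N)| < d] `&` [set v : 'rV[R]_3 | `|v 0 (o3 (isT : 2 < 3)%N)| < d]).
pose psi (v : 'rV[R]_3) := g (v 0 (o3 (isT : 1 < 3)%N)) (v 0 (o3 (isT : 2 < 3)%N)).
have oO : open O.
  by apply: openI; [exact: open_coord_gt0|apply: openI; exact: open_coord_lt].
have phiE u s t s' t' : V u -> [/\ scal 2 (Y u) a = s, scal 2 (Y u) b = s', scal 2 (Y u) z = - (1 + l * t) & scal 2 (Y u) w = - (1 + m * t')] ->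
    [/\ phi u 0 (o3 (isT : 0 < 3)%N) = 1 + t, phi u 0 (o3 (isT : 1 < 3)%N) = s &
     phi u 0 (o3 (isT : 2 < 3)%N) = s'].
  by move=> Vu [Ea Eb Ez Ew]; rewrite !mxE /= Ea Eb Ez l1; split; ring.
have HS u : V u -> HxR (phi u).
  move=> Vu; have [s [t [s' [t' [E4 _ _ [E1 E2 _ _]]]]]] := conic_coordinates Vu.
  have [p0 p1 p2] := phiE u s t s' t' Vu E4.
  by apply/HxRE; rewrite p0 p1 E1 l1; ring.
apply: (equivalent_near A_charts (phi := phi) (psi := psi) (T := T) (k := 1) YL cp oV (cs_base C) (cs_sub C) oO) => //.
- apply: smooth_row3 => //; do ?exact: smooth_lift_coord.
  by apply: smoothN => //; exact: smooth_lift_coord.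
- apply: (cs_smooth C oO); do ?exact: smooth_coord.
  by move=> v [_ []].
- move=> u Vu; have [s [t [s' [t' [E4 _ [sd sd' gE] [_ _ q1 q2]]]]]] := conic_coordinates Vu.
  have [p0 p1 p2] := phiE u s t s' t' Vu E4.
  split; first exact: HS.
    split; first by rewrite /= p0; move: q1; rewrite l1 mul1r.
    by split; rewrite /= ?p1 ?p2.
  by rewrite /psi p1 p2.
- move=> v Sv [/= v0 [/= v1 v2]].
  have [Vg Ga Gb] := cs_out C v1 v2; split => //.
  have [s [t [s' [t' [E4 _ _ [_ _ q1 q2]]]]]] := conic_coordinates Vg.
  have [p0 p1 p2] := phiE _ s t s' t' Vg E4.
  have /HxRE S1 := HS _ Vg; have /HxRE S1' := Sv.
  have [Ea Eb _ _] := E4.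
  have e1 : phi (psi v) 0 (o3 (isT : 1 < 3)%N) = v 0 (o3 (isT : 1 < 3)%N) by rewrite p1 -Ea Ga.
  have e2 : phi (psi v) 0 (o3 (isT : 2 < 3)%N) = v 0 (o3 (isT : 2 < 3)%N) by rewrite p2 -Eb Gb.
  apply: row3P => //; apply: sqr_inj_pos => //; first by rewrite p0; move: q1; rewrite l1 mul1r.
  by move: S1; rewrite e1 -S1' => /addIr/oppr_inj.
- apply: orthogonal_rows5.
  have za : scal 2 z a = 0 by rewrite scalC. have zb : scal 2 z b = 0 by rewrite scalC.
  have wa : scal 2 w a = 0 by rewrite scalC. have wb : scal 2 w b = 0 by rewrite scalC.
  have wz : scal 2 w z = 0 by rewrite scalC.
  have zy : scal 2 z Y0 = -1 by rewrite scalC. have wy : scal 2 w Y0 = -1 by rewrite scalC.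
  have ay : scal 2 a Y0 = 0 by rewrite scalC. have by' : scal 2 b Y0 = 0 by rewrite scalC.
  split; rewrite // /K ?(scalNl, scalDl) ?(scalNr, scalDr);
   rewrite ?za ?zb ?wa ?wb ?wz ?zy ?wy ?ay ?by' ?yy ?ya ?yb ?yz ?yw ?aa ?bb ?ab ?az ?aw ?bz ?bw ?zz ?ww ?zw; ring.
- move=> u Vu; have [s [t [s' [t' [E4 E _ [E1 E2 _ _]]]]]] := conic_coordinates Vu.
  have [p0 p1 p2] := phiE u s t s' t' Vu E4.
  have [h0 h1 h2 h3 h4] := embRE (phi u).
  have /HxRE S1 := HS u Vu.
  have nE : scal 1 (phi u) (phi u) = -1 + s' ^+ 2.
    rewrite -S1 /scal !big_ord_recl big_ord0 /= -p2 !mxE /=.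
    by rewrite -!/(o3 _); ring.
  have t'E : t' = s' ^+ 2 / 2 by rewrite E2 m0; field.
  rewrite mulmx_rows5 h0 h1 h2 h3 h4 p0 p1 p2 nE E t'E /K scale1r.
  by apply/rowP => j; rewrite !mxE; field.
Qed.

End Models.

(** * Uniqueness of the type *)

Section SphereConic.
Variable R : realType.
Implicit Types p q r : 'rV[R]_5.

Definition gap p q := scal 2 (q - p) (q - p).

(** The circumradius formula: four times the Gram determinant times R^2 equals the product of the
    squared sides, with R^2 = -1/l. Cleared of denominators it also makes sense for l = 0. *)
Definition sphere_conic (l : R) p q r :=
  - 4 * (gap p q * gap p r - scal 2 (q - p) (r - p) ^+ 2) = l * (gap p q * gap p r * gap q r).

Lemma gapN p q : gap (- p) (- q) = gap p q.
Proof. by rewrite /gap -opprD scalNl scalNr opprK. Qed.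

Lemma sphere_conicN l p q r : sphere_conic l (- p) (- q) (- r) <-> sphere_conic l p q r.
Proof. by rewrite /sphere_conic !gapN -!opprD scalNl scalNr opprK. Qed.

Lemma sphere_conic_inj l l' p q r : gap p q * gap p r * gap q r != 0 ->
  sphere_conic l p q r -> sphere_conic l' p q r -> l = l'.
Proof. by move=> g0 E E'; apply: (mulIf g0); rewrite -E -E'. Qed.

(* Heron's formula: on the conic s^2 = 2 t + l t^2 the symmetric matrix
   b_ij = t_i + t_j - s_i s_j + l t_i t_j has zero diagonal, is half the matrix of squared
   distances, and equals B N B^T with B = [1 s_i t_i] and det N = 1. *)
Lemma conic_heron (l s0 t0 s1 t1 s2 t2 : R) :
  s0 ^+ 2 = 2 * t0 + l * t0 ^+ 2 -> s1 ^+ 2 = 2 * t1 + l * t1 ^+ 2 ->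
  s2 ^+ 2 = 2 * t2 + l * t2 ^+ 2 ->
  4 * ((s1 - s0) * (t2 - t0) - (s2 - s0) * (t1 - t0)) ^+ 2 =
  ((s1 - s0) ^+ 2 - l * (t1 - t0) ^+ 2) * ((s2 - s0) ^+ 2 - l * (t2 - t0) ^+ 2) *
  ((s2 - s1) ^+ 2 - l * (t2 - t1) ^+ 2).
Proof.
move=> E0 E1 E2.
pose b s t s' t' := t + t' - s * s' + l * t * t'.
have dE s t s' t' : s ^+ 2 = 2 * t + l * t ^+ 2 -> s' ^+ 2 = 2 * t' + l * t' ^+ 2 ->
    (s' - s) ^+ 2 - l * (t' - t) ^+ 2 = 2 * b s t s' t'.
  move=> E E'; have -> : (s' - s) ^+ 2 = s' ^+ 2 + s ^+ 2 - 2 * s * s' by ring.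
  by rewrite E E' /b; ring.
rewrite !dE//.
have c0 : b s0 t0 s0 t0 = 0 by rewrite /b -expr2 E0; ring.
have c1 : b s1 t1 s1 t1 = 0 by rewrite /b -expr2 E1; ring.
have c2 : b s2 t2 s2 t2 = 0 by rewrite /b -expr2 E2; ring.
have -> : ((s1 - s0) * (t2 - t0) - (s2 - s0) * (t1 - t0)) ^+ 2 =
   b s0 t0 s0 t0 * b s1 t1 s1 t1 * b s2 t2 s2 t2 + 2 * b s0 t0 s1 t1 * b s0 t0 s2 t2 * b s1 t1 s2 t2
   - b s0 t0 s0 t0 * b s1 t1 s2 t2 ^+ 2 - b s1 t1 s1 t1 * b s0 t0 s2 t2 ^+ 2
   - b s2 t2 s2 t2 * b s0 t0 s1 t1 ^+ 2.
  rewrite /b; ring.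
by rewrite c0 c1 c2; ring.
Qed.

Section Plane.
Variables (a z : 'rV[R]_5) (l : R).
Hypotheses (aa : scal 2 a a = 1) (az : scal 2 a z = 0) (zz : scal 2 z z = - l).

Definition on_conic p0 p s t := p = p0 + s *: a + t *: z /\ s ^+ 2 = 2 * t + l * t ^+ 2.

Lemma plane_scal (s t s' t' : R) :
  scal 2 (s *: a + t *: z) (s' *: a + t' *: z) = s * s' - l * (t * t').
Proof.
rewrite !(scalDl, scalZl) !(scalDr, scalZr) (scalC 2 z a) aa az zz; ring.
Qed.

Lemma conic_diff p0 p q s t s' t' : on_conic p0 p s t -> on_conic p0 q s' t' ->
  q - p = (s' - s) *: a + (t' - t) *: z.
Proof. by move=> [-> _] [-> _]; apply/rowP => j; rewrite !mxE; ring. Qed.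

Lemma conic_gap p0 p q s t s' t' : on_conic p0 p s t -> on_conic p0 q s' t' ->
  gap p q = (s' - s) ^+ 2 - l * (t' - t) ^+ 2.
Proof. by move=> H H'; rewrite /gap (conic_diff H H') plane_scal !expr2. Qed.

Lemma conic_sphere p0 p q r s t s' t' s'' t'' : on_conic p0 p s t -> on_conic p0 q s' t' ->
  on_conic p0 r s'' t'' -> sphere_conic l p q r.
Proof.
move=> H H' H''; rewrite /sphere_conic (conic_gap H H') (conic_gap H H'') (conic_gap H' H'').
rewrite -(conic_heron H.2 H'.2 H''.2) (conic_diff H H') (conic_diff H H'') plane_scal; ring.
Qed.

(** The vertex and two points at opposite values of s. The branch conditions force t = t', and the
    three squared distances are then 2 t, 2 t and 4 s^2. *)
Lemma conic_triple p0 p q (s t t' : R) : s != 0 -> on_conic p0 p s t -> on_conic p0 q (- s) t' ->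
  0 < 1 + l * t -> 0 < 1 + l * t' -> gap p0 p * gap p0 q * gap p q != 0.
Proof.
move=> s0 H H' q1 q2.
have H0 : on_conic p0 p0 0 0.
  by split; [rewrite !scale0r !addr0|rewrite !expr0n !mulr0 addr0].
have tt : t = t'.
  have E : (t - t') * ((1 + l * t) + (1 + l * t')) = 0.
    transitivity ((2 * t + l * t ^+ 2) - (2 * t' + l * t' ^+ 2)); first by ring.
    by rewrite -H.2 -H'.2 sqrrN subrr.
  move/eqP: E; rewrite mulf_eq0 (gt_eqF (addr_gt0 q1 q2)) orbF subr_eq0 => /eqP//.
have t0 : t != 0.
  apply: contraNneq s0 => t0; have := H.2; rewrite t0 expr0n !mulr0 addr0 => /eqP.
  by rewrite expf_eq0.
rewrite (conic_gap H0 H) (conic_gap H0 H') (conic_gap H H') -tt !subr0 subrr expr0n mulr0 subr0.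
rewrite sqrrN H.2.
have -> : 2 * t + l * t ^+ 2 - l * t ^+ 2 = 2 * t by ring.
have -> : (- s - s) = - (2 * s) by ring.
by rewrite !mulf_neq0 ?expf_neq0 ?oppr_eq0 ?mulf_neq0// pnatr_eq0.
Qed.

End Plane.

End SphereConic.

Section Triples.
Variables (R : realType) (W : set 'rV[R]_2) (Y xi : 'rV[R]_2 -> 'rV[R]_5).
Local Notation P := (pencil Y xi 2^-1).
Local Notation Q := (pencil Y xi (- 2^-1)).
Variables (u0 : 'rV[R]_2) (a b z w : 'rV[R]_5) (l m : R) (V : set 'rV[R]_2) (d : R) (g : 'rV[R]_2 -> 'rV[R]_2).
Hypothesis C : conic_chart W Y xi u0 a b z w l m V d g.

Lemma chart_conicP u : V u ->
  on_conic a z l (P u0) (P u) (scal 2 (Y u) a) (- scal 2 (P u) (Y u0)).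
Proof.
move=> Vu; split; first by rewrite scaleNr; exact: cc_P C u Vu.
by rewrite (cc_Px C Vu) sqrrN mulrN mulNr.
Qed.

Lemma chart_conicQ u : V u ->
  on_conic b w m (- Q u0) (- Q u) (scal 2 (Y u) b) (scal 2 (Q u) (Y u0)).
Proof. by move=> Vu; split; [exact: cc_Q C u Vu|exact: cc_Qx C u Vu]. Qed.

Lemma chart_sphere_conic u1 u2 u3 : V u1 -> V u2 -> V u3 ->
  sphere_conic l (P u1) (P u2) (P u3) /\ sphere_conic m (Q u1) (Q u2) (Q u3).
Proof.
have [_ _ _ _ _ aa bb _ az _ _ bw zz ww _ _] := cc_adapted C.
move=> /[dup] /chart_conicP p1 /chart_conicQ q1 /[dup] /chart_conicP p2 /chart_conicQ q2.
move=> /[dup] /chart_conicP p3 /chart_conicQ q3; split.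
  exact: (conic_sphere aa az zz p1 p2 p3).
exact: ((sphere_conicN m (Q u1) (Q u2) (Q u3)).1 (conic_sphere bb bw ww q1 q2 q3)).
Qed.

(** Nondegenerate triples exist arbitrarily close to the base point, so l and m can be recovered
    from any neighborhood on which two descriptions of the surface overlap. *)
Lemma chart_triple (N : set 'rV[R]_2) : nbhs u0 N ->
  (exists u1 u2, [/\ N u1, N u2 & gap (P u0) (P u1) * gap (P u0) (P u2) * gap (P u1) (P u2) != 0]) /\
  (exists u1 u2, [/\ N u1, N u2 & gap (Q u0) (Q u1) * gap (Q u0) (Q u2) * gap (Q u1) (Q u2) != 0]).
Proof.
move=> Nu0; have [yy ya yb yz yw aa bb ab az aw bz bw zz ww zw lm] := cc_adapted C.
have d0 := cc_pos C.
have g0 : g 0 = u0.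
  have [_] := cc_in C (cc_base C); rewrite ya yb.
  suff -> : pair_row 0 0 = 0 :> 'rV[R]_2 by [].
  by apply/rowP => j; case: (ord2P j) => ->; rewrite ?pair_row0 ?pair_row1 mxE.
have B0 : ball (0 : 'rV[R]_2) d 0 by exact: ballxx.
have /nbhs_ballP[e /= e0 He] : nbhs (0 : 'rV[R]_2) (g @^-1` N).
  have cg := smooth_cont (cc_smooth C) B0.
  by apply: cg; rewrite g0.
pose s := Num.min d e / 2.
have me0 : 0 < Num.min d e by rewrite lt_min d0.
have s0 : 0 < s by rewrite divr_gt0.
have sm : s < Num.min d e by rewrite ltr_pdivrMr// mulr_natr mulr2n ltrDl.
have sd : `|s| < d by rewrite gtr0_norm// (lt_le_trans sm)// ge_min lexx.
have se : `|s| < e by rewrite gtr0_norm// (lt_le_trans sm)// ge_min lexx orbT.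
have near (p q f : R) : 0 < f -> `|p| < f -> `|q| < f -> ball 0 f (pair_row p q).
  move=> f0 pf qf; apply/(ball0P _ f0) => j.
  by case: (ord2P j) => ->; rewrite ?pair_row0 ?pair_row1.
have pt (p q : R) : `|p| < d -> `|q| < d -> `|p| < e -> `|q| < e ->
    [/\ V (g (pair_row p q)), N (g (pair_row p q)), scal 2 (Y (g (pair_row p q))) a = p &
        scal 2 (Y (g (pair_row p q))) b = q].
  move=> pd qd pe qe; have [Vg E] := cc_out C (near _ _ _ d0 pd qd).
  split => //; first exact/He/near.
    by move/rowP/(_ 0): E; rewrite !pair_row0.
  by move/rowP/(_ 1): E; rewrite !pair_row1.
have z0 f : 0 < f -> `|0 : R| < f by rewrite normr0.
split.
  have [||||V1 N1 A1 _] := pt s 0; rewrite ?z0//.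
  have [||||V2 N2 A2 _] := pt (- s) 0; rewrite ?normrN ?z0//.
  exists (g (pair_row s 0)), (g (pair_row (- s) 0)); split => //.
  have p1 := chart_conicP V1; have p2 := chart_conicP V2; rewrite A1 in p1; rewrite A2 in p2.
  apply: (conic_triple aa az zz (lt0r_neq0 s0) p1 p2); rewrite mulrN.
    exact: cc_Ppos C _ V1.
  exact: cc_Ppos C _ V2.
have [||||V1 N1 _ A1] := pt 0 s; rewrite ?z0//.
have [||||V2 N2 _ A2] := pt 0 (- s); rewrite ?normrN ?z0//.
exists (g (pair_row 0 s)), (g (pair_row 0 (- s))); split => //.
have p1 := chart_conicQ V1; have p2 := chart_conicQ V2; rewrite A1 in p1; rewrite A2 in p2.
have := conic_triple bb bw ww (lt0r_neq0 s0) p1 p2; rewrite !gapN; apply.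
  exact: cc_Qpos C _ V1.
exact: cc_Qpos C _ V2.
Qed.

End Triples.

Lemma rank1_pair (R : realType) (a b f g : 'rV[R]_5) :
  scal 2 b f *: a = scal 2 a f *: b -> scal 2 b f * scal 2 a g = scal 2 a f * scal 2 b g.
Proof. by move=> /(congr1 (fun w => scal 2 w g)); rewrite !scalZl. Qed.

(** * Uniqueness of the pair up to sign and order *)

Section PairUniqueness.
Variable R : realType.
Variables (N : set 'rV[R]_2) (Y xi Z eta : 'rV[R]_2 -> 'rV[R]_5).
Hypothesis O : osc_pair N Y xi.
Hypotheses (sZ : smooth_on N Z) (seta : smooth_on N eta).
Hypothesis line_ZY : forall u, N u -> exists2 nu : R, nu != 0 & Z u = nu *: Y u.
Hypothesis eta_unit : forall u, N u -> scal 2 (eta u) (eta u) = -1.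
Hypothesis eta_orth : forall u, N u -> scal 2 (eta u) (Y u) = 0.
Hypothesis eta_tangent : forall u v, N u -> scal 2 (eta u) ('D_v Y u) = 0.
Hypothesis rank1_Z : forall e u, N u -> e ^+ 2 = 4^-1 -> rank1_at (pencil Z eta e) u.
Variable u0 : 'rV[R]_2.
Hypothesis Nu0 : N u0.

Let oN := osc_open O.
Let sY := osc_smooth O.
Let sx := osc_normal_smooth O.
Let light u (Nu : N u) := osc_light (osc_on O Nu).
Let kappa u := - scal 2 (eta u) (xi u).

(** Being orthogonal to [Y] and its derivatives, [eta] has only components along [xi] and [Y]; the
    latter is null and orthogonal to [xi], so the norm forces kappa^2 = 1. *)
Lemma eta_decomposition u : N u -> kappa u ^+ 2 = 1 /\ exists c, eta u = kappa u *: xi u + c *: Y u.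
Proof.
move=> Nu; have [yy xx xy pY _] := osc_on O Nu.
have LF := Nvec_frame oN sY light (fun u Nu => osc_pos (osc_on O Nu)) Nu.
have xt i : scal 2 (xi u) (pder i Y u) = 0 by rewrite pderE; have [_ ->] := osc_normal O (delta_mx 0 i) Nu.
have et i : scal 2 (eta u) (pder i Y u) = 0 by rewrite pderE eta_tangent.
have [n F xn] := light_frame_adjust LF xy (xt 0) (xt 1) xx.
have [_ nn yn ya yb na nb _ _] := F.
have E : eta u = kappa u *: xi u + scal 2 (eta u) n *: Y u.
  apply/eqP; rewrite -subr_eq0; apply/eqP.
  apply: (light_frame_zero F xy xn (xt 0) (xt 1) xx);
    rewrite !(scalBl, scalDl, scalZl) ?xy ?xn ?xt ?xx ?et ?yy ?yn ?ya ?yb ?eta_orth//; try ring.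
  by rewrite (scalC 2 (Y u)) xy /kappa; ring.
split; last by exists (scal 2 (eta u) n).
have := eta_unit Nu; rewrite {1}E scalDl !scalZl (scalC 2 (Y u)) eta_orth// (scalC 2 (xi u)) mulr0 addr0.
rewrite /kappa mulNr => /oppr_inj <-; ring.
Qed.

(** The coefficient of [Y] is c + e nu, where c and nu are known only pointwise. Pairing with a
    fixed [n0], against which [Y] stays positive near [u0], yields a smooth expression; nu being
    nonzero separates the two values of e. *)
Lemma pencil_coefficient : exists (N' : set 'rV[R]_2) (mu : R -> 'rV[R]_2 -> R),
  [/\ open N', N' u0, N' `<=` N, forall e, smooth_on N' (mu e) &
   forall u, N' u -> (forall e, pencil Z eta e u = kappa u *: xi u + mu e u *: Y u) /\ mu 2^-1 u != mu (- 2^-1) u].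
Proof.
have LF := Nvec_frame oN sY light (fun u Nu => osc_pos (osc_on O Nu)) Nu0.
pose n0 := Nvec Y u0; have yn : scal 2 (Y u0) n0 = 1 by exact: lf_yn LF.
pose q u := scal 2 (Y u) n0.
have sq : smooth_on N q by apply: smooth_scal => //; exact: smooth_cst.
pose N' := N `&` [set u | 0 < q u].
have oN' : open N'.
  rewrite openE => u [Nu qu]; apply: filterI; first exact: open_nbhs_nbhs.
  have cq := smooth_cont sq Nu.
  have : nbhs (q u) [set r | 0 < r] by apply: open_nbhs_nbhs; split => //; exact: open_gt.
  by move=> /cq.
have N'N : N' `<=` N by move=> u [].
have sk : smooth_on N kappa by apply: smoothN => //; exact: smooth_scal.
exists N', (fun e u => scal 2 (pencil Z eta e u - kappa u *: xi u) n0 * (q u)^-1).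
split => //.
- by split => //; rewrite /= /q yn.
- move=> e; apply: smoothM => //; last first.
    apply: smoothV => //; last exact: smooth_subset sq.
    by move=> u [_ qu]; rewrite gt_eqF.
  apply: smooth_scal => //; last exact: smooth_cst.
  apply: smoothB => //.
    apply: smoothD => //; first exact: smooth_subset seta.
    by apply: smooth_scale => //; [exact: smooth_cst|exact: smooth_subset sZ].
  by apply: smooth_scale => //; [exact: smooth_subset sk|exact: smooth_subset sx].
- move=> u [Nu qu]; have [_ [c Ec]] := eta_decomposition Nu; have [nu nu0 EZ] := line_ZY Nu.
  have qn := lt0r_neq0 qu.
  have E e : pencil Z eta e u = kappa u *: xi u + (c + e * nu) *: Y u.
    by rewrite /pencil Ec EZ; apply/rowP => j; rewrite !mxE; ring.
  have Em e : scal 2 (pencil Z eta e u - kappa u *: xi u) n0 * (q u)^-1 = c + e * nu.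
    by rewrite E addrAC subrr add0r scalZl -/(q u) mulfK.
  split; first by move=> e; rewrite Em E.
  rewrite !Em; apply: contra nu0 => /eqP H; apply/eqP; lra.
Qed.

(** Since r^2 = 1, the derivative of r vanishes, and the derivative of [mu] contributes a multiple
    of [Y], invisible to tangent vectors. Rank one thus means det (r S + mu) = 0, and this
    determinant is mu^2 - 1/4. *)
Lemma rank1_det u (r mu : 'rV[R]_2 -> R) (e : R) (N' : set 'rV[R]_2) : open N' -> N' `<=` N -> N' u ->
  smooth_on N' mu -> smooth_on N' r -> (forall v, N' v -> r v ^+ 2 = 1) ->
  (forall v, N' v -> pencil Z eta e v = r v *: xi v + mu v *: Y v) ->
  rank1_at (pencil Z eta e) u -> mu u ^+ 2 = 4^-1.
Proof.
move=> oN' N'N N'u smu sr r2 E rk.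
have Nu := N'N _ N'u.
have dr : differentiable r u by exact: smooth_diff sr N'u.
have dmu : differentiable mu u by exact: smooth_diff smu N'u.
have dY : differentiable Y u by exact: smooth_diff sY Nu.
have dx : differentiable xi u by exact: smooth_diff sx Nu.
have r0 : r u != 0 by apply/eqP => r0; have := r2 _ N'u; rewrite r0 expr0n => /eqP; rewrite eq_sym oner_eq0.
have Dr v : 'D_v r u = 0.
  have : 'D_v (r * r) u = 'D_v (fun=> 1 : R) u.
    by apply: near_eq_derive; apply: (open_near_eq oN' N'u) => w /r2; rewrite expr2.
  rewrite derive_cst deriveM; [|exact: diff_derivable|exact: diff_derivable].
  move=> /eqP; rewrite -mulr2n -mulr_natl mulf_eq0 pnatr_eq0 /= scaler_eq0 (negPf r0) /=.
  by move=> /eqP.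
have [S [tS dS HS]] := osc_shape (osc_on O Nu).
have [yy xx xy pY _] := osc_on O Nu.
have yt j : scal 2 (Y u) (pder j Y u) = 0 by exact: (lift_tangent oN sY light j Nu).
have srx : smooth_on N' (fun v => r v *: xi v) by apply: smooth_scale => //; exact: smooth_subset sx.
have smY : smooth_on N' (fun v => mu v *: Y v) by apply: smooth_scale => //; exact: smooth_subset sY.
have DP i : 'D_(delta_mx 0 i) (pencil Z eta e) u = r u *: pder i xi u + ('D_(delta_mx 0 i) mu u *: Y u + mu u *: pder i Y u).
  transitivity ('D_(delta_mx 0 i) (fun v => r v *: xi v + mu v *: Y v) u).
    by apply: near_eq_derive; exact: (open_near_eq oN' N'u).
  rewrite !pderE -(derive_scale _ dmu dY).
  rewrite -[X in X + _](add0r) -(scale0r (xi u)) -(Dr (delta_mx 0 i)) -(derive_scale _ dr dx).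
  apply: deriveD; [exact: (smooth_derivable srx N'u)|exact: (smooth_derivable smY N'u)].
pose G := first_form Y u; pose T := r u *: S + (mu u)%:M.
have TG i j : scal 2 ('D_(delta_mx 0 i) (pencil Z eta e) u) (pder j Y u) = (T *m G) i j.
  rewrite DP HS !(scalDl, scalZl) yt scal_suml !big_ord2 !scalZl -!first_formE [RHS]mxE big_ord2.
  have TE k : T i k = r u * S i k + mu u *+ (i == k) by rewrite /T !mxE.
  by rewrite !TE -/G; case: (ord2P i) => ->; rewrite /= ?mulr1n ?mulr0n; ring.
have dTG : \det (T *m G) = 0.
  rewrite det2 -!TG; apply/eqP; rewrite subr_eq0; apply/eqP; apply: etrans (mulrC _ _) _.
  exact: rank1_pair (rk (delta_mx 0 0) (delta_mx 0 1) (pder 1 Y u)).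
have [_ gd] := pos_def_minors (first_form_sym Y u 0 1) pY.
have dT : \det T = 0.
  by move/eqP: dTG; rewrite det_mulmx mulf_eq0 (gt_eqF gd) orbF => /eqP.
have : \det T = r u ^+ 2 * \det S + r u * mu u * (S 0 0 + S 1 1) + mu u ^+ 2.
  by rewrite !det2 /T !mxE /= ?mulr1n ?mulr0n; ring.
rewrite dT dS tS r2// => H; lra.
Qed.

Lemma pair_unique : exists (s : R) (b : bool), s ^+ 2 = 1 /\ \forall u \near u0,
  pencil Z eta 2^-1 u = s *: pencil Y xi (if b then 2^-1 else - 2^-1) u /\
  pencil Z eta (- 2^-1) u = s *: pencil Y xi (if b then - 2^-1 else 2^-1) u.
Proof.
have [N' [mu [oN' N'u0 N'N smu H]]] := pencil_coefficient.
have sk : smooth_on N' kappa.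
  by apply: smoothN => //; apply: smooth_scal => //; [exact: smooth_subset seta|exact: smooth_subset sx].
have k2 u : N' u -> kappa u ^+ 2 = 1 by move=> /N'N/eta_decomposition[].
have m2 e u : N' u -> e ^+ 2 = 4^-1 -> mu e u ^+ 2 = 4^-1.
  move=> N'u e2.
  have HE v : N' v -> pencil Z eta e v = kappa v *: xi v + mu e v *: Y v by move=> /H[].
  exact: (rank1_det oN' N'N N'u (smu e) sk k2 HE (rank1_Z (N'N _ N'u) e2)).
have sq2 : (2^-1 : R) ^+ 2 = 4^-1 by field.
have sq2' : (- 2^-1 : R) ^+ 2 = 4^-1 by field.
pose f u := kappa u * mu 2^-1 u.
have sf : smooth_on N' f by exact: smoothM.
have val (r : R) : r ^+ 2 = 1 -> r = 1 \/ r = -1.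
  by move=> /eqP; rewrite sqrf_eq1 => /orP[]/eqP; [left|right].
have valh (r : R) : r ^+ 2 = 4^-1 -> r = 2^-1 \/ r = - 2^-1.
  move=> r2; have [] : 2 * r = 1 \/ 2 * r = -1.
    by apply: val; rewrite exprMn r2; field.
  by move=> E; left; lra.
  by move=> E; right; lra.
have near_const (h : 'rV[R]_2 -> R) (c : R) : smooth_on N' h -> 0 < c ->
    (forall u, N' u -> h u = c \/ h u = - c) -> \forall u \near u0, h u = h u0.
  move=> sh c0 hv.
  have ch := smooth_cont sh N'u0.
  have B : nbhs (h u0) [set r | `|h u0 - r| < c].
    by apply/nbhs_ballP; exists c => //= r; rewrite -ball_normE.
  have {}B := ch _ B.
  have N0 := open_nbhs_nbhs (conj oN' N'u0).
  near=> u.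
  have N'u : N' u by near: u.
  have : `|h u0 - h u| < c by near: u; exact: B.
  rewrite ltr_norml => /andP[h1 h2].
  by have [E0|E0] := hv _ N'u0; have [E|E] := hv _ N'u; rewrite E0 E in h1 h2 *; lra.
have kn : \forall u \near u0, kappa u = kappa u0.
  by apply: (near_const _ 1) => // u /k2/val.
have fn : \forall u \near u0, f u = f u0.
  apply: (near_const _ 2^-1) => // u N'u; apply: valh.
  by rewrite exprMn k2// m2// mul1r.
have N0 := open_nbhs_nbhs (conj oN' N'u0).
have main u : N' u -> mu 2^-1 u = f u * kappa u /\ mu (- 2^-1) u = - (f u * kappa u).
  move=> N'u; have E1 : mu 2^-1 u = f u * kappa u.
    by rewrite /f mulrAC -expr2 k2// mul1r.
  split => //; rewrite -E1; have [_] := H _ N'u.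
  have [e1|e1] := valh _ (m2 _ _ N'u sq2); have [e2|e2] := valh _ (m2 _ _ N'u sq2'); rewrite e1 e2 ?eqxx// opprK//.
exists (kappa u0), (f u0 == 2^-1); split; first exact: k2.
near=> u.
have N'u : N' u by near: u.
have ku : kappa u = kappa u0 by near: u.
have fu : f u = f u0 by near: u.
have [HE _] := H _ N'u; have [M1 M2] := main _ N'u.
rewrite !HE M1 M2 ku fu /pencil.
have f2 : f u0 ^+ 2 = 4^-1 by rewrite exprMn k2// m2// mul1r.
have [f1|f1] := valh _ f2.
  by rewrite f1 eqxx; split; apply/rowP => j; rewrite !mxE; ring.
rewrite f1 (_ : (- 2^-1 == 2^-1 :> R) = false); last by apply/eqP; lra.
by split; apply/rowP => j; rewrite !mxE; ring.
Unshelve. all: by end_near. Qed.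

End PairUniqueness.

(** * The type along a connected component *)

Section Types.
Variables (R : realType) (M : topologicalType) (A : set (chart R M)) (x : M -> set 'rV[R]_5).
Hypothesis M_surface : smooth_surface A.

(** Existential in the chart, lift and normal. Changing the sign of [Y] or of [xi] exchanges the two
    curves up to sign, so only the unordered pair of l and m can be well defined. *)
Definition has_type (l m : R) (p : M) : Prop := exists c W Y xi V,
  [/\ local_lift A x c W Y, chart_dom c p, osc_pair W Y xi &
   [/\ open V, V (chart_map c p), V `<=` W & forall u1 u2 u3, V u1 -> V u2 -> V u3 ->
     sphere_conic l (pencil Y xi 2^-1 u1) (pencil Y xi 2^-1 u2) (pencil Y xi 2^-1 u3) /\
     sphere_conic m (pencil Y xi (- 2^-1) u1) (pencil Y xi (- 2^-1) u2) (pencil Y xi (- 2^-1) u3)]].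

Lemma sphere_conic_sign (s l : R) (p q r : 'rV[R]_5) : s ^+ 2 = 1 ->
  sphere_conic l (s *: p) (s *: q) (s *: r) -> sphere_conic l p q r.
Proof.
move=> /eqP; rewrite sqrf_eq1 => /orP[]/eqP ->; first by rewrite !scale1r.
by rewrite !scaleN1r => /sphere_conicN.
Qed.

Lemma osc_pair_subset W W' (Y xi : 'rV[R]_2 -> 'rV[R]_5) : open W' -> W' `<=` W ->
  osc_pair W Y xi -> osc_pair W' Y xi.
Proof.
move=> oW' W'W [oW sY sx H]; split => //; [exact: smooth_subset sY|exact: smooth_subset sx|].
by move=> u /W'W/H.
Qed.

Lemma transition_open c c' : A c -> A c' -> open (chart_map c @` (chart_dom c `&` chart_dom c')).
Proof.
have [_ _ Ach _ _] := M_surface => Ac Ac'.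
have [[od oi] cK _ ci] := Ach _ Ac; have [[od' _] _ _ _] := Ach _ Ac'.
rewrite openE => _ [q [dq dq'] <-].
have iq : chart_img c (chart_map c q) by exists q.
have c1 := ci _ iq.
have B : nbhs (chart_inv c (chart_map c q)) (chart_dom c') by rewrite cK//; exact: open_nbhs_nbhs.
have {}B := c1 _ B.
have B' := open_nbhs_nbhs (conj oi iq).
have : nbhs (chart_map c q) ([set u | chart_dom c' (chart_inv c u)] `&` chart_img c).
  exact: filterI.
apply: filterS => u [/= Bu [q' dq1 qu]].
by exists q' => //; split => //; move: Bu; rewrite -qu cK.
Qed.

Lemma rank1_comp (f : 'rV[R]_2 -> 'rV[R]_5) (h : 'rV[R]_2 -> 'rV[R]_2) u :
  differentiable h u -> differentiable f (h u) -> rank1_at f (h u) -> rank1_at (f \o h) u.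
Proof. by move=> dh df rk v w e; rewrite !(derive_comp _ dh df). Qed.

(** The second description is pulled back to the chart of the first by the transition map. There
    [pair_unique] identifies the curves up to sign and order, and a nondegenerate triple on each
    determines its parameter. *)
Lemma type_unique l m l' m' p : has_type l m p -> has_type l' m' p ->
  (l = l' /\ m = m') \/ (l = m' /\ m = l').
Proof.
move=> [c [W [Y [xi [V [YL cp O [oV Vp VW HV]]]]]]] [c' [W' [Y' [xi' [V' [YL' cp' O' [oV' Vp' VW' HV']]]]]]].
have [_ _ Ach _ comp] := M_surface.
have [Ac oW Wc sY HY] := YL; have [Ac' oW' Wc' sY' HY'] := YL'.
have [_ cK _ _] := Ach _ Ac; have [_ cK' _ _] := Ach _ Ac'.
pose D := chart_map c @` (chart_dom c `&` chart_dom c').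
have oD : open D by exact: transition_open.
pose psi := chart_map c' \o chart_inv c.
have spsi : smooth_on D psi by exact: comp Ac Ac'.
set u0 := chart_map c p in Vp *.
have Du0 : D u0 by exists p.
have psi0 : psi u0 = chart_map c' p by rewrite /psi /= cK.
pose N := V `&` D `&` psi @^-1` V'.
have oN : open N.
  rewrite openE => u [[Vu Du] Pu].
  have cpsi := smooth_cont spsi Du.
  have B : nbhs (psi u) V' by exact: open_nbhs_nbhs.
  have {}B := cpsi _ B.
  apply: filterI => //; apply: filterI; exact: open_nbhs_nbhs.
have Nu0 : N u0 by split => //; rewrite /= psi0.
have NW : N `<=` W by move=> u [[/VW]].
have ND : N `<=` D by move=> u [[]].
have NW' u : N u -> W' (psi u) by move=> [_ /VW'].
have ON := osc_pair_subset oN NW O.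
have sN := smooth_subset ND spsi.
pose Z := Y' \o psi; pose eta := xi' \o psi.
have sZ : smooth_on N Z by move=> k; exact: (Ck_comp oN oW' NW' (sN k) (sY' k)).
have sx' := osc_normal_smooth O'.
have seta : smooth_on N eta by move=> k; exact: (Ck_comp oN oW' NW' (sN k) (sx' k)).
have line_ZY u : N u -> exists2 nu : R, nu != 0 & Z u = nu *: Y u.
  move=> Nu; have [_ E] := HY _ (NW _ Nu); have [_ E'] := HY' _ (NW' _ Nu).
  have [q [dq dq'] qu] := ND _ Nu.
  have : line (Z u) = line (Y u).
    by rewrite /Z /= -E' -E /psi /= -qu cK// cK'.
  move=> /seteqP[H _]; have [|nu nu0 ->] := H (Z u); first by exists 1; rewrite ?oner_neq0 ?scale1r.
  by exists nu.
have dpsi u : N u -> differentiable psi u by exact: smooth_diff sN.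
have eta_unit u : N u -> scal 2 (eta u) (eta u) = -1 by move=> /NW'/(osc_on O')[].
have eta_orth u : N u -> scal 2 (eta u) (Y u) = 0.
  move=> Nu; have [nu nu0 E] := line_ZY u Nu; have [_ _ h _ _] := osc_on O' (NW' _ Nu).
  apply: (mulfI nu0); rewrite mulr0 -scalZr -E; exact: h.
(* Differentiating <eta, Y> = 0 reduces this to <d eta, Y> = 0, which holds because [Y] is
   proportional to [Z] and d xi' is orthogonal to [Y']. *)
have eta_tangent u v : N u -> scal 2 (eta u) ('D_v Y u) = 0.
  move=> Nu; have [nu nu0 E] := line_ZY u Nu.
  have de : differentiable eta u by exact: smooth_diff seta Nu.
  have dY : differentiable Y u by exact: smooth_diff sY (NW _ Nu).
  have dY' : differentiable Y' (psi u) by exact: smooth_diff sY' (NW' _ Nu).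
  have dx' : differentiable xi' (psi u) by exact: smooth_diff sx' (NW' _ Nu).
  have D1 : scal 2 ('D_v eta u) (Y u) + scal 2 (eta u) ('D_v Y u) = 0.
    rewrite -(derive_scal _ _ de dY) -[RHS](derive_cst (0 : R) u v).
    by apply: near_eq_derive; exact: (open_near_eq oN Nu).
  have D2 w : scal 2 ('D_w xi' (psi u)) (Y' (psi u)) = 0.
    have [_ h] := osc_normal O' w (NW' _ Nu).
    rewrite -[LHS]addr0 -[X in _ + X]h -(derive_scal _ _ dx' dY') -[RHS](derive_cst (0 : R) (psi u) w).
    by apply: near_eq_derive; apply: (open_near_eq oW' (NW' _ Nu)) => v' /(osc_on O')[].
  have D3 : scal 2 ('D_v eta u) (Y u) = 0.
    apply: (mulfI nu0); rewrite mulr0 -scalZr -E /eta (derive_comp _ (dpsi _ Nu) dx').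
    exact: D2.
  by move: D1; rewrite D3 add0r.
have rank1_Z e u : N u -> e ^+ 2 = 4^-1 -> rank1_at (pencil Z eta e) u.
  move=> Nu e2; apply: (rank1_comp (f := pencil Y' xi' e) (dpsi _ Nu)).
    exact: smooth_diff (smooth_pencil O' e) (NW' _ Nu).
  exact: (pencil_rank1 O' (NW' _ Nu) e2).
have [s [b [s2 nearPQ]]] := pair_unique ON sZ seta line_ZY eta_unit eta_orth eta_tangent rank1_Z Nu0.
(* The normal form at [u0] serves only to supply nondegenerate triples of parameters inside [N]. *)
have [a [b' [z [w [k [k' [V1 [d [g CC]]]]]]]]] := normal_form O (VW _ Vp).
have /(_ (nbhs_filter u0)) NN := filterI (open_nbhs_nbhs (conj oN Nu0)) nearPQ.
have [[u1 [u2 [[N1 E1] [N2 E2] gP]]] [u3 [u4 [[N3 E3] [N4 E4] gQ]]]] := chart_triple CC NN.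
have [_ E0] := nbhs_singleton NN.
have inV u : N u -> V u by move=> [[]].
have inV' u : N u -> V' (psi u) by case.
have [HP _] := HV _ _ _ (inV _ Nu0) (inV _ N1) (inV _ N2).
have [_ HQ] := HV _ _ _ (inV _ Nu0) (inV _ N3) (inV _ N4).
have [HP1 HQ1] := HV' _ _ _ (inV' _ Nu0) (inV' _ N1) (inV' _ N2).
have [HP2 HQ2] := HV' _ _ _ (inV' _ Nu0) (inV' _ N3) (inV' _ N4).
have pE e u : pencil Y' xi' e (psi u) = pencil Z eta e u by [].
rewrite !pE E0.1 E1.1 E2.1 in HP1; rewrite !pE E0.2 E1.2 E2.2 in HQ1.
rewrite !pE E0.1 E3.1 E4.1 in HP2; rewrite !pE E0.2 E3.2 E4.2 in HQ2.
move: HP1 HQ1 HP2 HQ2 => /(sphere_conic_sign s2) HP1 /(sphere_conic_sign s2) HQ1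
  /(sphere_conic_sign s2) HP2 /(sphere_conic_sign s2) HQ2.
case: b HP1 HQ1 HP2 HQ2 {nearPQ NN E0 E1 E2 E3 E4} => HP1 HQ1 HP2 HQ2.
  by left; split; [exact: sphere_conic_inj gP HP HP1|exact: sphere_conic_inj gQ HQ HQ2].
by right; split; [exact: sphere_conic_inj gP HP HQ1|exact: sphere_conic_inj gQ HQ HP2].
Qed.

Lemma has_type_open l m p : has_type l m p -> nbhs p [set q | has_type l m q].
Proof.
move=> [c [W [Y [xi [V [YL cp O [oV Vp VW HV]]]]]]].
have [_ _ Ach _ _] := M_surface; have [Ac _ _ _ _] := YL.
have [[od _] _ cc _] := Ach _ Ac.
have B : nbhs (chart_map c p) V by exact: open_nbhs_nbhs.
have {}B := cc _ cp _ B.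
apply: filterS (filterI (open_nbhs_nbhs (conj od cp)) B) => q [dq Vq].
by exists c, W, Y, xi, V.
Qed.

Hypothesis x_conformal : space_like_conformal_surface A x.

Lemma local_structure p : exists l m, [/\ l + m = 1, has_type l m p &
  exists c W Y V d g a b z w, [/\ local_lift A x c W Y, chart_dom c p &
    conic_surface W Y (chart_map c p) a b z w l m V d g]].
Proof.
have [c [W [Y [xi [YL cp Wp O]]]]] := exists_osc_pair x_conformal p.
have [a [b [z [w [l [m [V [d [g C]]]]]]]]] := normal_form O Wp.
exists l, m; split; first exact: ad_sum (cc_adapted C).
  exists c, W, Y, xi, V; split => //; split; [exact: cc_open C|exact: cc_base C|exact: cc_sub C|].
  by move=> u1 u2 u3; exact: (chart_sphere_conic C).
exists c, W, Y, V, d, (fun s t => g (pair_row s t)), a, b, z, w; split => //.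
exact: conic_surface_of_chart C.
Qed.

Lemma component_structure p0 : exists l m, [/\ l + m = 1, m <= l &
  forall p, connected_component [set: M] p0 p ->
  exists c W Y V d g a b z w, [/\ local_lift A x c W Y, chart_dom c p &
    conic_surface W Y (chart_map c p) a b z w l m V d g]].
Proof.
have [l [m [lm T0 _]]] := local_structure p0.
pose Z := [set p | has_type l m p \/ has_type m l p].
have Z0 : Z p0 by left.
have oZ : open Z.
  rewrite openE => p [] /has_type_open; apply: filterS => q Tq; [by left|by right].
have cZ : closed Z.
  (* A point outside [Z] has some other type, shared by its neighbors; a neighbor in [Z] would
     identify the two types. *)
  rewrite -[Z]setCK; apply: open_closedC; rewrite openE => p nZ.
  have [l' [m' [_ T' _]]] := local_structure p.
  apply: filterS (has_type_open T') => q Tq [] Tq'.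
    have [[e1 e2]|[e1 e2]] := type_unique Tq Tq'; apply: nZ; [left|right]; by rewrite -e1 -e2.
  have [[e1 e2]|[e1 e2]] := type_unique Tq Tq'; apply: nZ; [right|left]; by rewrite -e1 -e2.
have M0Z p : connected_component [set: M] p0 p -> Z p.
  have cM : connected (connected_component [set: M] p0) by exact: component_connected.
  have E := cM (connected_component [set: M] p0 `&` Z).
  have {}E : connected_component [set: M] p0 `&` Z = connected_component [set: M] p0.
    apply: E; [|by exists Z|by exists Z].
    by exists p0; split => //; exact: connected_component_refl.
  by rewrite -E => -[].
have struct p : connected_component [set: M] p0 p ->
    exists c W Y V d g a b z w, [/\ local_lift A x c W Y, chart_dom c p &
    conic_surface W Y (chart_map c p) a b z w l m V d g].
  move=> /M0Z Zp; have [l' [m' [_ T' [c [W [Y [V [d [g [a [b [z [w [YL cp C]]]]]]]]]]]]]] := local_structure p.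
  have [[e1 e2]|[e1 e2]] : (l' = l /\ m' = m) \/ (l' = m /\ m' = l).
    by case: Zp => Tp; have [] := type_unique T' Tp; [left|right|right|left].
    by rewrite -e1 -e2; exists c, W, Y, V, d, g, a, b, z, w.
  rewrite -e1 -e2; exists c, W, Y, V, d, (fun s t => g t s), b, a, w, z; split => //.
  exact: conic_surface_swap.
have [ml|lm'] := leP m l; first by exists l, m; split.
exists m, l; split; [by rewrite addrC|exact: ltW|].
move=> p /struct[c [W [Y [V [d [g [a [b [z [w [YL cp C]]]]]]]]]]].
exists c, W, Y, V, d, (fun s t => g t s), b, a, w, z; split => //.
exact: conic_surface_swap.
Qed.

End Types.

Theorem theorem3p1 (R : realType) (M : topologicalType) (A : set (chart R M))
    (x : M -> set 'rV[R]_5)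
    (M_surface : smooth_surface A)
    (x_conformal : space_like_conformal_surface A x)
    (p0 : M) :
  let M0 := connected_component [set: M] p0 in
  [\/ exists r : R, [/\ 0 < r, r < 1 & forall p, M0 p ->
        conformally_equivalent_near A x
          (HxH r (Num.sqrt (1 - r ^+ 2))) (@embH R) p],
      exists r : R, 0 < r /\ forall p, M0 p ->
        conformally_equivalent_near A x
          (HxS r (Num.sqrt (r ^+ 2 + 1))) (@embS R) p |
      forall p, M0 p ->
        conformally_equivalent_near A x HxR (@embR R) p].
Proof.
move=> M0; have [_ _ A_charts _ _] := M_surface.
have [l [m [lm ml H]]] := component_structure M_surface x_conformal p0.
(* With sum 1 and [m <= l], the parameter l is at least 1/2, so the sign of m alone separates the
   three models. *)
have l0 : 0 < l by lra.
have [m0|m0|m0] := ltrgtP m 0.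
- apply: Or32; exists (Num.sqrt (- m)); split; first by rewrite sqrtr_gt0 oppr_gt0.
  move=> p /H[c [W [Y [V [d [g [a [b [z [w [YL cp C]]]]]]]]]]].
  exact: (model_HxS A_charts YL cp C l0 m0).
- apply: Or31; exists (Num.sqrt m); split; first by rewrite sqrtr_gt0.
    by rewrite -sqrtr1 ltr_sqrt//; lra.
  move=> p /H[c [W [Y [V [d [g [a [b [z [w [YL cp C]]]]]]]]]]].
  exact: (model_HxH A_charts YL cp C l0 m0).
- apply: Or33 => p /H[c [W [Y [V [d [g [a [b [z [w [YL cp C]]]]]]]]]]].
  exact: (model_HxR A_charts YL cp C m0).
Qed.
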